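(* Let $f$ be an inner function and $0<D<1$ with $\sup_{z\in\mathbb D}D_h(f)(z)<D$. Then there exists $t=t(D)\in(0,1)$ such that $$\dim\Big\{\xi\in I:\limsup_{r\to1}|f(r\xi)|<t\Big\}>1-D$$ for every arc $I\subset\partial\mathbb D$. Moreover $t(D)$ can be chosen with $t(D)\to0$ as $D\to0$.
   Context: $D_h(f)(z)=\frac{(1-|z|^2)|f'(z)|}{1-|f(z)|^2}$. An inner function is a bounded analytic function on $\mathbb D$ with radial limits of modulus $1$ a.e. on $\partial\mathbb D$. $\dim$ denotes Hausdorff dimension. *)

(* Defs.v *)
From HB Require Import structures.
From mathcomp Require Import all_boot all_order all_algebra.
From mathcomp Require Import all_classical all_reals all_analysis.
From mathcomp.real_closed Require Import complex.
Import Order.TTheory GRing.Theory Num.Theory numFieldNormedType.Exports.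

Set Implicit Arguments.
Unset Strict Implicit.
Unset Printing Implicit Defensive.

Local Open Scope ring_scope.
Local Open Scope complex_scope.
Local Open Scope classical_set_scope.

(* The complex plane, as a normed module over itself (standard topology). *)
Notation Cx R := ((complex R)^o).

Section Defs.
Variable R : realType.

Definition cabs (z : Cx R) : R := Normc.normc z.

Definition expi (theta : R) : Cx R := (cos theta +i* sin theta).

Definition holomorphic_on_disc (f : Cx R -> Cx R) : Prop :=
  forall z : Cx R, cabs z < 1 -> derivable f z 1.

Definition bounded_on_disc (f : Cx R -> Cx R) : Prop :=
  exists M : R, forall z : Cx R, cabs z < 1 -> cabs (f z) <= M.

(* inner function: bounded analytic on the disc with radial limits of
   modulus 1 at almost every point of the circle (a.e. w.r.t. arc length,
   i.e. Lebesgue measure in the angle theta) *)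
Definition inner (f : Cx R -> Cx R) : Prop :=
  [/\ holomorphic_on_disc f, bounded_on_disc f &
      {ae (@lebesgue_measure R), forall theta : R,
         exists L : Cx R, cabs L = 1 /\
           f (r%:C * expi theta) @[r --> (1:R)^'-] --> L}].

Definition Dh (f : Cx R -> Cx R) (z : Cx R) : R :=
  (1 - cabs z ^+ 2) * cabs (derive1 f z) / (1 - cabs (f z) ^+ 2).

Definition diam (A : set (Cx R)) : \bar R :=
  ereal_sup [set (cabs (x - y))%:E | x in A & y in A].

Definition hterm (s : R) (A : set (Cx R)) : \bar R :=
  if pselect (A !=set0) then (powR (fine (diam A)) s)%:E else 0%E.

Definition hcontent (s delta : R) (E : set (Cx R)) : \bar R :=
  ereal_inf [set (\sum_(i <oo) hterm s (U i))%E | U in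
    [set U : nat -> set (Cx R) |
       E `<=` \bigcup_i U i /\ forall i, (diam (U i) <= delta%:E)%E]].

Definition hmeasure (s : R) (E : set (Cx R)) : \bar R :=
  ereal_sup [set hcontent s delta E | delta in [set delta : R | 0 < delta]].

Definition hdim (E : set (Cx R)) : \bar R :=
  ereal_inf [set s%:E | s in [set s : R | 0 <= s /\ hmeasure s E = 0%E]].

Definition circle_arc (a b : R) : set (Cx R) := [set expi theta | theta in `]a, b[].

End Defs.

(* Main.v *)
(* In the coordinate zeta with z = exp (- zeta) the function becomes a map F of
   the right half-plane into the disc with |F'| <= D (1 - |F|^2) / (2 Re zeta);
   an arc J = [a, a + l[ of the boundary line has the apex l + i a. Given J, put
   w = F (apex J), g = (F - w) / (1 - w^* F), and bisect J, stopping at an arc K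
   as soon as |g (apex K)| >= del. Since F is inner, almost all of J is stopped.
   Averages of a holomorphic G over arcs at a fixed small height x are additive
   in the arc and, by the gradient bound, comparable to the value of G at the
   apex. Applied to suitable G built from g this shows that a fixed proportion c
   of the stopped arcs lies where g points from w towards the origin, so that
   1 - |F|^2 grows by a factor gam > 1 until it reaches a threshold q0.
   - For arbitrary D < 1, G runs over Cayley transforms of g: their real parts
     are Poisson kernels, and two different heights of the pole isolate the
     stopped arcs with g near the inward boundary point. Here del is close to 1.
   - For small D, G is g or g^2 with del = 1000 sqrt D, which yields t -> 0; a
     variance estimate shows that few arcs stop within the first 50 / D
     generations.
   A stopped arc is shorter than J by a factor eps with eps^(3D/4) <= c/4,
   because |g| moves slowly. Iterating gives a tree of arcs, on whose branches
   |F| stays below t and which carries a measure with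
   mu (I) <= const |I|^(1 - 3D/4); hence the dimension exceeds 1 - D. *)
Require Import Defs.
From HB Require Import structures.
From mathcomp Require Import all_boot all_order all_algebra.
From mathcomp Require Import all_classical all_reals all_analysis.
From mathcomp.real_closed Require Import complex.
From mathcomp Require Import ring lra.
Import Order.TTheory GRing.Theory Num.Theory numFieldNormedType.Exports.
Set Implicit Arguments.
Unset Strict Implicit.
Unset Printing Implicit Defensive.
Local Open Scope ring_scope.
Local Open Scope complex_scope.
Local Open Scope classical_set_scope.
Local Notation Re := (@complex.Re _).
Local Notation Im := (@complex.Im _).

(** * Modulus, real and imaginary parts *)

Section ComplexModulus.
Variable R : realType.
Implicit Types (x y z c : R[i]) (r s : R).

(** For D close to 1 the obstacle is that the proportion c degenerates as del tends to 1. Let mu^2 =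
    (1 - del) / (1 + del). Reaching |g| >= del costs hyperbolic distance -2 ln mu, so a stopped arc
    has relative length at most e mu^(2/D), and eps^(3D/4) is of order mu^(3/2). The proportion c is
    of order mu, like the parameter x1 of the Poisson kernel closer to the circle. As 3/2 > 1, a
    small mu gives eps^(3D/4) <= c/4; any exponent strictly between D/2 and D would do here, and
    3D/4 is the middle one. The aperture th of the inward region is of order mu too: passing to K
    multiplies 1 - |F|^2 by (1 - |g|^2) / |1 + w^* g|^2, whose numerator is at least of order mu^2.
    The condition D < 1 enters through the averages: Re G may grow like x^(-D) towards the boundary,
    and transporting an average down to height x integrates this growth. For small D the averaging
    errors are O(D |J|), while |g|^2 contributes del^2 |J|; the factor 10^6 in del^2 = 10^6 D is the
    margin between the two. *)

Lemma cabs_ge0 z : 0 <= cabs z.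
Proof. by case: z => a b; rewrite /cabs /= sqrtr_ge0. Qed.

Lemma cabsM x y : cabs (x * y) = cabs x * cabs y.
Proof. exact: Normc.normcM. Qed.

Lemma cabsV x : cabs (x^-1) = (cabs x)^-1.
Proof. exact: Normc.normcV. Qed.

Lemma cabs0 : cabs (0 : R[i]) = 0.
Proof. exact: Normc.normc0. Qed.

Lemma cabs1 : cabs (1 : R[i]) = 1.
Proof. exact: Normc.normc1. Qed.

Lemma cabs_eq0 z : cabs z = 0 -> z = 0.
Proof. exact: Normc.eq0_normc. Qed.

Lemma cabs_gt0 z : (0 < cabs z) = (z != 0).
Proof.
apply/idP/idP => [|z0]; first by apply: contraTneq => ->; rewrite cabs0 ltxx.
by rewrite lt_def cabs_ge0 andbT; apply: contra z0 => /eqP/cabs_eq0 ->.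
Qed.

Lemma normE z : `|z| = (cabs z)%:C.
Proof. by case: z. Qed.

Lemma cabsD x y : cabs (x + y) <= cabs x + cabs y.
Proof. by have := ler_normD x y; rewrite !normE -rmorphD lecR. Qed.

Lemma cabsN z : cabs (- z) = cabs z.
Proof. by case: z => a b; rewrite /cabs /= !sqrrN. Qed.

Lemma cabsr r : cabs r%:C = `|r|.
Proof. by rewrite /cabs /= expr0n /= addr0 sqrtr_sqr. Qed.

Lemma cabsi : cabs ('i : R[i]) = 1.
Proof. by rewrite /cabs /= expr0n /= add0r expr1n sqrtr1. Qed.

Lemma cabs_conj z : cabs z^* = cabs z.
Proof. by case: z => a b; rewrite /cabs /= sqrrN. Qed.

Lemma cabs_sqr z : cabs z ^+ 2 = Re z ^+ 2 + Im z ^+ 2.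
Proof. by case: z => a b; rewrite /cabs /= sqr_sqrtr // addr_ge0 ?sqr_ge0. Qed.

Lemma ReM x y : Re (x * y) = Re x * Re y - Im x * Im y.
Proof. by case: x y => a b [c d]. Qed.

Lemma ImM x y : Im (x * y) = Re x * Im y + Im x * Re y.
Proof. by case: x y => a b [c d]. Qed.

Lemma ReD x y : Re (x + y) = Re x + Re y.
Proof. by case: x y => a b [c d]. Qed.

Lemma ImD x y : Im (x + y) = Im x + Im y.
Proof. by case: x y => a b [c d]. Qed.

Lemma ReN x : Re (- x) = - Re x.
Proof. by case: x. Qed.

Lemma ImN x : Im (- x) = - Im x.
Proof. by case: x. Qed.

Lemma Re_conj x : Re x^* = Re x.
Proof. by case: x. Qed.

Lemma Im_conj x : Im x^* = - Im x.
Proof. by case: x. Qed.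

Lemma conjM z : z * z^* = (cabs z ^+ 2)%:C.
Proof.
by rewrite cabs_sqr; case: z => a b; simpc; congr (_ +i* _); ring.
Qed.

Lemma Re_le_cabs z : Re z <= cabs z.
Proof.
apply: le_trans (ler_norm _) _.
rewrite -(@ler_pXn2r _ 2) ?nnegrE ?cabs_ge0 //.
by rewrite cabs_sqr real_normK ?num_real // lerDl sqr_ge0.
Qed.

Lemma ReM_le_cabs c z : cabs c <= 1 -> Re (c * z) <= cabs z.
Proof.
move=> c1; apply: le_trans (Re_le_cabs _) _; rewrite cabsM.
by rewrite ler_piMl ?cabs_ge0.
Qed.

Lemma Im_le_cabs z : `|Im z| <= cabs z.
Proof.
rewrite -(@ler_pXn2r _ 2) ?nnegrE ?cabs_ge0 //.
by rewrite cabs_sqr real_normK ?num_real // lerDr sqr_ge0.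
Qed.

Lemma normRe_le_cabs z : `|Re z| <= cabs z.
Proof.
rewrite -(@ler_pXn2r _ 2) ?nnegrE ?cabs_ge0 //.
by rewrite cabs_sqr real_normK ?num_real // lerDl sqr_ge0.
Qed.

Lemma cabs_le_ReIm z : cabs z <= `|Re z| + `|Im z|.
Proof.
rewrite -(@ler_pXn2r _ 2) ?nnegrE ?cabs_ge0 ?addr_ge0 // cabs_sqr.
rewrite sqrrD !real_normK ?num_real // -addrA lerD2l lerDr.
by rewrite mulrn_wge0 // mulr_ge0.
Qed.

Lemma cabs_attained z : exists2 c, cabs c <= 1 & Re (c * z) = cabs z.
Proof.
have [->|z0] := eqVneq z 0; first by exists 0; rewrite ?cabs0 ?mulr0 //.
have p0 : cabs z != 0 by rewrite gt_eqF ?cabs_gt0.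
exists ((cabs z)^-1%:C * z^*).
  by rewrite cabsM cabs_conj cabsr ger0_norm ?invr_ge0 ?cabs_ge0 // mulVf.
rewrite -mulrA (mulrC _ z) conjM -rmorphM /= expr2 mulrA mulVf // mul1r //.
Qed.

Lemma cabs_le z r : (forall c, cabs c <= 1 -> Re (c * z) <= r) -> cabs z <= r.
Proof. by move=> H; have [c c1 <-] := cabs_attained z; exact: H. Qed.

Lemma cabs_leB x y : cabs x - cabs y <= cabs (x - y).
Proof. by rewrite lerBlDr -{1}(subrK y x) cabsD. Qed.

End ComplexModulus.

(** * Derivatives of one real variable and the mean value inequality *)

Section RealDerivative.
Variable R : realType.
Implicit Types (p q dp dq : R -> R) (t d a b : R).

Lemma is_derive_epsP p t d :
  is_derive t 1 p d <->
  (forall e : R, 0 < e -> exists2 del : R, 0 < del & forall h, `|h| < del ->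
     `|p (t + h) - p t - d * h| <= e * `|h|).
Proof.
split=> [H e e0|H].
  have [D E] := H; have := derivable_nbhs D; rewrite E.
  move=> /eqaddoP /(_ e e0) /nbhs_normP [del /= del0 B]; exists del => // h hd.
  have := B h; rewrite /= sub0r normrN => /(_ hd) /=.
  by rewrite -[(_ - _) h]/(_ h - _) /= opprD /cst addrA; congr (`| p _ - _ - _| <= _);
    rewrite ?[h%:A]mulr1 1?addrC // [_ *: _]mulrC.
have C : (fun h => h^-1 *: (p (h *: 1 + t) - p t)) @ 0^' --> d.
  apply/cvgrPdist_le => e e0; have [del del0 B] := H _ e0.
  apply/nbhs_normP; exists del => //= h; rewrite /= sub0r normrN => hd h0.
  have h00 : 0 < `|h| by rewrite normr_gt0.
  rewrite distrC -(ler_pM2r h00) -normrM; apply: le_trans (B h hd).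
  rewrite mulrBl [_ *: _ * h]mulrAC mulVf // mul1r [h *: 1]mulr1 (addrC h t).
  exact: lexx.
split; first by apply/cvg_ex; exists d.
exact/cvg_lim.
Qed.

Lemma is_derive_continuous p t d : is_derive t 1 p d -> {for t, continuous p}.
Proof. by move=> [D _]; apply: differentiable_continuous; exact/derivable1_diffP. Qed.

(** The mean value theorem for [q - p]. The majorant [q] is arbitrary, so this plays the role of
    integrating [dp <= dq]; powers, logarithms and linear functions serve as [q] later. *)
Lemma increment_le p dp q dq a b : a <= b ->
  (forall t, a <= t <= b -> is_derive t 1 p (dp t)) ->
  (forall t, a <= t <= b -> is_derive t 1 q (dq t)) ->
  (forall t, a <= t <= b -> dp t <= dq t) -> p b - p a <= q b - q a.
Proof.
move=> ab Dp Dq le.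
have D t : a <= t <= b -> is_derive t 1 (q - p) (dq t - dp t).
  by move=> tab; apply: is_deriveB; [exact: Dq|exact: Dp].
have [||c cab E] := @MVT_segment R (q - p) (fun t => dq t - dp t) a b ab.
- by move=> t; rewrite in_itv /= => /andP[ta tb]; apply: D; rewrite !ltW.
- apply: continuous_in_subspaceT => t; rewrite inE /= in_itv /= => tab.
  exact: is_derive_continuous (D _ tab).
have : 0 <= (q - p) b - (q - p) a.
  rewrite E mulr_ge0 ?subr_ge0 //; apply: le; by rewrite in_itv in cab.
by rewrite -![(q - p) _]/(_ - _); lra.
Qed.

End RealDerivative.

(** * Complex differentiability and derivatives along paths *)

Section ComplexDerivative.
Variable R : realType.
Local Notation C := R[i].
Implicit Types (G dG : C -> C) (z d c v : C) (x y t : R).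

Definition cdiff G z d : Prop :=
  forall e : R, 0 < e -> exists2 del : R, 0 < del &
    forall h : C, cabs h < del ->
      cabs (G (z + h) - G z - d * h) <= e * cabs h.

(** A complex path is differentiated through all its real projections, so that real calculus
    applies; the modulus is the maximum of these projections over |c| <= 1, so bounds on it are
    recovered without loss. *)
Definition path_derive (phi : R -> C) t d : Prop :=
  forall c, is_derive t 1 (fun s => Re (c * phi s)) (Re (c * d)).

Lemma cdiff_path G z v d t : cdiff G (z + t%:C * v) d ->
  path_derive (fun s => G (z + s%:C * v)) t (d * v).
Proof.
move=> H c; apply/is_derive_epsP => e e0.
pose K := (cabs c + 1) * (cabs v + 1).
have K0 : 0 < K by rewrite mulr_gt0 ?ltr_wpDl ?cabs_ge0.
have [del del0 B] := H (e / K) (divr_gt0 e0 K0).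
exists (del / K); first exact: divr_gt0.
move=> h hd; have hv : cabs (h%:C * v) < del.
  rewrite cabsM cabsr; apply: le_lt_trans (_ : `|h| * K < _).
    by rewrite ler_wpM2l // /K; have := cabs_ge0 c; have := cabs_ge0 v; nra.
  by rewrite -ltr_pdivlMr.
have -> : Re (c * G (z + (t + h)%:C * v)) - Re (c * G (z + t%:C * v)) -
  Re (c * (d * v)) * h = Re (c * (G (z + t%:C * v + h%:C * v)
    - G (z + t%:C * v) - d * (h%:C * v))).
  rewrite rmorphD /= mulrDl addrA !(ReM, ImM, ReD, ImD, ReN, ImN) /=; ring.
apply: le_trans (normRe_le_cabs _) _; rewrite cabsM.
apply: le_trans (ler_wpM2l (cabs_ge0 _) (B _ hv)) _.
rewrite cabsM cabsr mulrCA [e / K * _]mulrC.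
rewrite [X in X <= _](_ : _ = (e * `|h|) * ((cabs c * cabs v) / K)); last by ring.
rewrite ler_piMr ?mulr_ge0 ?(ltW e0) // ler_pdivrMr // mul1r.
by rewrite ler_pM ?cabs_ge0 ?lerDl.
Qed.

Lemma cdiff_vert G x t d : cdiff G (x +i* t) d ->
  path_derive (fun s => G (x +i* s)) t ('i * d).
Proof.
have E s : x +i* s = x%:C + s%:C * 'i by simpc.
by rewrite E (mulrC 'i) => /cdiff_path H c; under eq_fun do rewrite E; exact: H.
Qed.

Lemma cdiff_horiz G y t d : cdiff G (t +i* y) d ->
  path_derive (fun s => G (s +i* y)) t d.
Proof.
have E s : s +i* y = y *i + s%:C * 1 by simpc.
rewrite E => /cdiff_path H c; under eq_fun do rewrite E.
by have := H c; rewrite mulr1.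
Qed.

Lemma path_increment (phi : R -> C) (dphi : R -> C) (q dq : R -> R) (a b : R) :
  a <= b -> (forall t, a <= t <= b -> path_derive phi t (dphi t)) ->
  (forall t, a <= t <= b -> is_derive t 1 q (dq t)) ->
  (forall t, a <= t <= b -> cabs (dphi t) <= dq t) ->
  cabs (phi b - phi a) <= q b - q a.
Proof.
move=> ab Dp Dq le; apply: cabs_le => c c1.
have := @increment_le R (fun s => Re (c * phi s)) (fun t => Re (c * dphi t))
  q dq a b ab _ Dq _.
rewrite mulrBr ReD ReN; apply => [t tab|t tab]; first exact: Dp.
exact: le_trans (ReM_le_cabs _ c1) (le _ tab).
Qed.

Lemma cdiff_continuous G z d : cdiff G z d -> forall e : R, 0 < e ->
  exists2 del : R, 0 < del & forall h, cabs h < del -> cabs (G (z + h) - G z) <= e.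
Proof.
move=> H e e0; have [del del0 B] := H 1 ltr01.
pose K := 1 + cabs d.
have K0 : 0 < K by rewrite ltr_pwDl ?cabs_ge0.
exists (Num.min del (e / K)); first by rewrite lt_min del0 divr_gt0.
move=> h; rewrite lt_min => /andP[h1 h2].
have -> : G (z + h) - G z = (G (z + h) - G z - d * h) + d * h by ring.
apply: le_trans (cabsD _ _) _; rewrite cabsM.
have := B h h1; rewrite mul1r => B1.
apply: le_trans (_ : cabs h * K <= _); last by rewrite -ler_pdivlMr // ltW.
by rewrite /K mulrDr mulr1 lerD // mulrC.
Qed.

Lemma path_derive_continuous (phi : R -> C) t d : path_derive phi t d ->
  forall c, {for t, continuous (fun s => Re (c * phi s))}.
Proof. by move=> H c; apply: is_derive_continuous (H c). Qed.

Lemma antiderivative_right (f : R -> R) (a : R) : continuous f ->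
  exists F : R -> R, forall x, a < x -> is_derive x 1 F (f x).
Proof.
move=> cf; exists (fun x => \int[lebesgue_measure]_(t in `[a, x]) (f t)).
move=> x ax.
have [|||D E] := @continuous_FTC1_closed R f a x (x + 1) _ _ ax.
- by rewrite ltrDl.
- apply: continuous_compact_integrable; first exact: segment_compact.
  by apply: continuous_subspaceT => u; exact: cf.
- exact: cf.
by apply: DeriveDef; [exact: D|rewrite -derive1E; exact: E].
Qed.

(** Integration from -1 gives a primitive on ]-1, +oo[, and the reflected function gives one on
    ]-oo, 1[. They differ by a constant on the overlap, so they can be glued at 0. *)
Lemma antiderivative (f : R -> R) : continuous f ->
  exists F : R -> R, forall x, is_derive x 1 F (f x).
Proof.
move=> cf; have [A DA] := @antiderivative_right f (-1) cf.
have cfN : continuous (fun s => f (- s)).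
  by move=> s; apply: (@continuous_comp _ _ _ -%R f); [exact: oppr_continuous|exact: cf].
have [B0 DB0] := @antiderivative_right (fun s => f (- s)) (-1) cfN.
pose B x := - B0 (- x).
have DB x : x < 1 -> is_derive x 1 B (f x).
  move=> x1; have x1' : -1 < - x by rewrite ltrN2.
  have D := is_derive1_comp (DB0 _ x1') (is_deriveNid x (1 : R)).
  have := is_deriveN D; rewrite opprK mulrN mulr1 opprK; exact.
have AB x : -1 < x -> x < 1 -> A x - A 0 = B x - B 0.
  move=> x1 x2; apply/eqP; rewrite eq_le.
  have [x0|/ltW x0] := leP 0 x.
    by apply/andP; split; apply: (@increment_le R _ f _ f) => // t /andP[t0 tx];
      solve [apply: DA; lra|apply: DB; lra].
  rewrite -(opprB _ (A x)) -(opprB _ (B x)) !lerN2.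
  by apply/andP; split; apply: (@increment_le R _ f _ f) => // t /andP[t0 tx];
      solve [apply: DA; lra|apply: DB; lra].
exists (fun x => if x < 0 then B x - B 0 + A 0 else A x) => x.
have [x0|x0] := ltP x 0.
  apply: (@near_eq_is_derive _ _ _ (fun s => B s - B 0 + A 0)); rewrite ?oner_neq0 //.
    near=> s; have s0 : s < 0 by near: s; exact: lt_nbhsl.
    by rewrite s0.
  have := DB x (lt_trans x0 ltr01) => D.
  have D1 : is_derive x 1 (B + cst (- B 0 + A 0)) (f x + 0) by apply: is_deriveD.
  rewrite addr0 in D1; move: D1; congr (is_derive _ _ _ _).
  by apply/funext => s; rewrite -[LHS]/(B s + (- B 0 + A 0)) addrA.
apply: (@near_eq_is_derive _ _ _ A); rewrite ?oner_neq0 //.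
  near=> s; have s0 : -1 < s by near: s; apply: lt_nbhsr; lra.
  case: ltP => // s1; rewrite -AB ?subrK //; lra.
by apply: DA; lra.
Unshelve. all: by end_near. Qed.

Lemma path_antiderivative (phi : R -> C) :
  (forall c, continuous (fun s => Re (c * phi s))) ->
  exists Phi : R -> C, forall t, path_derive Phi t (phi t).
Proof.
move=> cphi.
have [P DP] := antiderivative (cphi 1); have [Q DQ] := antiderivative (cphi (- 'i)).
exists (fun s => P s +i* Q s) => t c.
have -> : (fun s => Re (c * (P s +i* Q s))) = (fun s => Re c * P s - Im c * Q s).
  by apply/funext => s; rewrite ReM.
have D : is_derive t 1 (Re c *: P - Im c *: Q)
    (Re c *: Re (1 * phi t) - Im c *: Re (- 'i * phi t)).
  exact: is_deriveB.
have <- : Re c *: Re (1 * phi t) - Im c *: Re (- 'i * phi t) = Re (c * phi t).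
  rewrite /GRing.scale /=.
  by rewrite !(ReM,ReN,ImN) /=; ring.
exact: D.
Qed.

Lemma nested_intervals (u v : nat -> R) : (forall n, u n <= u n.+1) ->
  (forall n, v n.+1 <= v n) -> (forall n, u n <= v n) ->
  exists l, forall n, u n <= l <= v n.
Proof.
move=> uS vS uv.
have um : {homo u : m n / (m <= n)%N >-> m <= n} by apply: homo_leq => //; apply: le_trans.
have vm : {homo v : m n / (m <= n)%N >-> n <= m}.
  by apply: (@homo_leq _ v (fun a b => b <= a)) => // a b c ab bc; apply: le_trans bc ab.
have ub n : ubound (range u) (v n).
  move=> _ [m _ <-]; apply: le_trans (um _ _ (leq_maxl m n)) _.
  exact: le_trans (uv _) (vm _ _ (leq_maxr m n)).
exists (sup (range u)) => n; apply/andP; split.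
  by apply: ub_le_sup; [exists (v 0%N); exact: ub|exists n].
by apply: ge_sup; [exists (u 0%N), 0%N|exact: ub].
Qed.

End ComplexDerivative.

(** * Goursat's lemma and primitives on the right half-plane *)

Section Primitive.
Variable R : realType.
Local Notation C := R[i].
Implicit Types (G dG : C -> C) (z d c : C) (x y t : R).

Lemma Re_realM (r : R) z : Re (r%:C * z) = r * Re z.
Proof. by case: z => a b; rewrite ReM /= mul0r subr0. Qed.

Definition hol G dG : Prop := forall z, 0 < Re z -> cdiff G z (dG z).

Lemma is_derive_linear (e t : R) : is_derive t 1 (fun s => e * s) e.
Proof.
have D : is_derive t 1 (e *: id) (e *: (1 : R)) by apply: is_deriveZ.
by apply: (is_derive_eq D); rewrite /GRing.scale /= mulr1.
Qed.

Lemma path_deriveB (p q : R -> C) t d d' : path_derive p t d ->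
  path_derive q t d' -> path_derive (fun s => p s - q s) t (d - d').
Proof.
move=> P Q c; have D := is_deriveB (P c) (Q c).
have -> : (fun s => Re (c * (p s - q s))) =
   ((fun s => Re (c * p s)) - (fun s => Re (c * q s))).
  by apply/funext => s; rewrite mulrBr ReD ReN.
by rewrite mulrBr ReD ReN.
Qed.

(** Primitive of z |-> A + B z along a horizontal line. Subtracting it, and its vertical analogue
    below, removes the first-order part of G in Goursat's lemma. *)
Lemma path_derive_horiz_poly (A B : C) y t :
  path_derive (fun s => A * s%:C + B * ((s ^+ 2 / 2)%:C + 'i * y%:C * s%:C)) t
    (A + B * (t +i* y)).
Proof.
move=> c; apply/is_derive_epsP => e e0; pose K := cabs (c * B) + 1.
have K0 : 0 < K by rewrite ltr_wpDl ?cabs_ge0.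
exists (e / K); first exact: divr_gt0.
move=> h hd.
have -> : Re (c * (A * (t + h)%:C + B * (((t + h) ^+ 2 / 2)%:C + 'i * y%:C * (t + h)%:C))) -
   Re (c * (A * t%:C + B * ((t ^+ 2 / 2)%:C + 'i * y%:C * t%:C))) -
   Re (c * (A + B * (t +i* y))) * h = Re (c * B) * (h ^+ 2 / 2).
  by rewrite !(ReM, ImM, ReD, ImD) /=; field.
rewrite normrM; have := normRe_le_cabs (c * B); set u := `|Re _| => ub.
rewrite normrM normrX (ger0_norm (_ : 0 <= 2^-1)) //.
have u0 : 0 <= u by exact: normr_ge0.
have h0 := normr_ge0 h.
have : `|h| * K <= e by rewrite -ler_pdivlMr // ltW.
by rewrite /K; nra.
Qed.

Lemma path_derive_vert_poly (A B : C) x t :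
  path_derive (fun s => A * s%:C + B * (x%:C * s%:C + 'i * (s ^+ 2 / 2)%:C)) t
    (A + B * (x +i* t)).
Proof.
move=> c; apply/is_derive_epsP => e e0; pose K := cabs (c * B * 'i) + 1.
have K0 : 0 < K by rewrite ltr_wpDl ?cabs_ge0.
exists (e / K); first exact: divr_gt0.
move=> h hd.
have -> : Re (c * (A * (t + h)%:C + B * (x%:C * (t + h)%:C + 'i * ((t + h) ^+ 2 / 2)%:C))) -
   Re (c * (A * t%:C + B * (x%:C * t%:C + 'i * (t ^+ 2 / 2)%:C))) -
   Re (c * (A + B * (x +i* t))) * h = Re (c * B * 'i) * (h ^+ 2 / 2).
  by rewrite !(ReM, ImM, ReD, ImD) /=; field.
rewrite normrM; have := normRe_le_cabs (c * B * 'i); set u := `|Re _| => ub.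
rewrite normrM normrX (ger0_norm (_ : 0 <= 2^-1)) //.
have u0 : 0 <= u by exact: normr_ge0.
have h0 := normr_ge0 h.
have : `|h| * K <= e by rewrite -ler_pdivlMr // ltW.
by rewrite /K; nra.
Qed.

Lemma vert_antiderivative G dG : hol G dG -> exists V : R -> R -> C,
  forall x y, 0 < x -> path_derive (V x) y (G (x +i* y)).
Proof.
move=> hG.
suff /choice[V HV] : forall x, exists V : R -> C,
    forall y, 0 < x -> path_derive V y (G (x +i* y)).
  by exists V => x y x0; exact: HV.
move=> x; have [x0|x0] := ltP 0 x; last by exists (cst 0).
have [|V HV] := @path_antiderivative R (fun s => G (x +i* s)).
  move=> c s; apply: (path_derive_continuous (cdiff_vert _)); exact: hG.
by exists V.
Qed.

(** G is controlled for x > 0 only, so x is parametrised by exp s with s on the whole line; the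
    factor exp s is cancelled by the derivative of ln. *)
Lemma horiz_antiderivative G dG : hol G dG -> exists H : R -> R -> C,
  forall x y, 0 < x -> path_derive (H y) x (G (x +i* y)).
Proof.
move=> hG.
suff /choice[H HH] : forall y, exists H : R -> C,
    forall x, 0 < x -> path_derive H x (G (x +i* y)).
  by exists H => x y x0; exact: HH.
move=> y.
have [|H HH] := @path_antiderivative R (fun s => (expR s)%:C * G (expR s +i* y)).
  move=> c.
  have -> : (fun s => Re (c * ((expR s)%:C * G (expR s +i* y)))) =
     (fun s => expR s * (Re (c * G (expR s +i* y)))).
    by apply/funext => s; rewrite mulrCA Re_realM.
  move=> s; apply: cvgM; first exact: continuous_expR.
  apply: (@continuous_comp _ _ _ expR (fun x => Re (c * G (x +i* y)))).
    exact: continuous_expR.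
  apply: (path_derive_continuous (cdiff_horiz _)); apply: hG.
  exact: expR_gt0.
exists (fun x => H (ln x)) => x x0 c.
have D := is_derive1_comp (HH (ln x) c) (is_derive1_ln x0).
have E : Re (c * ((expR (ln x))%:C * G (expR (ln x) +i* y))) * x^-1 =
    Re (c * G (x +i* y)).
  rewrite lnK ?posrE // mulrCA Re_realM mulrAC mulfV ?gt_eqF //.
  by rewrite mul1r.
by rewrite E in D.
Qed.

Section Goursat.
Variables (G dG : C -> C) (V H : R -> R -> C).
Hypothesis hG : hol G dG.
Hypothesis DV : forall x y, 0 < x -> path_derive (V x) y (G (x +i* y)).
Hypothesis DH : forall x y, 0 < x -> path_derive (H y) x (G (x +i* y)).

(** The integral of G dz counterclockwise around the rectangle [x1, x2] x [y1, y2]. *)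
Let loop (x1 x2 y1 y2 : R) : C :=
  (H y1 x2 - H y1 x1) + 'i * (V x2 y2 - V x2 y1)
  - (H y2 x2 - H y2 x1) - 'i * (V x1 y2 - V x1 y1).

(** The loop integral of an affine function vanishes, so only the deviation e from it counts,
    multiplied by the perimeter. *)
Lemma loop_le (A B : C) (e x1 x2 y1 y2 : R) : 0 < x1 -> x1 <= x2 -> y1 <= y2 ->
  (forall x y, x1 <= x <= x2 -> y1 <= y <= y2 ->
     cabs (G (x +i* y) - (A + B * (x +i* y))) <= e) ->
  cabs (loop x1 x2 y1 y2) <= 2 * e * ((x2 - x1) + (y2 - y1)).
Proof.
move=> x10 x12 y12 le.
pose h y x := H y x - (A * x%:C + B * ((x ^+ 2 / 2)%:C + 'i * y%:C * x%:C)).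
pose v x y := V x y - (A * y%:C + B * (x%:C * y%:C + 'i * (y ^+ 2 / 2)%:C)).
have hB y : y1 <= y <= y2 -> cabs (h y x2 - h y x1) <= e * x2 - e * x1.
  move=> yy; apply: (@path_increment R _ (fun x => G (x +i* y) - (A + B * (x +i* y)))
    _ (fun=> e)) => // [t /andP[t1 t2]|t tt|t tt].
  - apply: path_deriveB; first by apply: DH; exact: lt_le_trans t1.
    exact: path_derive_horiz_poly.
  - exact: is_derive_linear.
  - exact: le.
have vB x : x1 <= x <= x2 -> cabs (v x y2 - v x y1) <= e * y2 - e * y1.
  move=> xx; apply: (@path_increment R _ (fun y => G (x +i* y) - (A + B * (x +i* y)))
    _ (fun=> e)) => // [t tt|t tt|t tt].
  - apply: path_deriveB; last exact: path_derive_vert_poly.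
    by apply: DV; case/andP: xx => /(lt_le_trans x10).
  - exact: is_derive_linear.
  - exact: le.
have -> : loop x1 x2 y1 y2 = (h y1 x2 - h y1 x1) + 'i * (v x2 y2 - v x2 y1)
  - (h y2 x2 - h y2 x1) - 'i * (v x1 y2 - v x1 y1).
  by rewrite /loop /h /v; ring.
have T (a b c d : C) : cabs (a + b - c - d) <= cabs a + cabs b + cabs c + cabs d.
  apply: le_trans (cabsD _ _) _; rewrite cabsN lerD2r.
  by apply: le_trans (cabsD _ _) _; rewrite cabsN lerD2r; exact: cabsD.
apply: le_trans (T _ _ _ _) _.
rewrite !cabsM cabsi !mul1r.
have h1 := hB y1; have h2 := hB y2; have v1 := vB x1; have v2 := vB x2.
rewrite !lexx ?x12 ?y12 in h1 h2 v1 v2.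
have := h1 isT; have := h2 isT; have := v1 isT; have := v2 isT; lra.
Qed.

(** The classical bisection: some quarter keeps at least a fourth of the loop integral. Near the
    limit point G is affine up to o(side), the perimeter supplies another factor side, and the
    product, o(4^-n), offsets the factor 4^n. *)
Lemma Goursat (x1 x2 y1 y2 : R) : 0 < x1 -> x1 <= x2 -> y1 <= y2 ->
  loop x1 x2 y1 y2 = 0.
Proof.
move=> x10 x12 y12; apply: cabs_eq0; apply/eqP; rewrite eq_le cabs_ge0 andbT.
pose w := x2 - x1; pose h := y2 - y1.
have w0 : 0 <= w by rewrite subr_ge0.
have h0 : 0 <= h by rewrite subr_ge0.
pose I n (p : R * R) := cabs (loop p.1 (p.1 + w / 2 ^+ n) p.2 (p.2 + h / 2 ^+ n)).
have I0 : I 0%N (x1, y1) = cabs (loop x1 x2 y1 y2).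
  by rewrite /I /= expr0 !divr1 /w /h !subrKC.
have step n p : exists q : R * R,
    [/\ p.1 <= q.1, q.1 + w / 2 ^+ n.+1 <= p.1 + w / 2 ^+ n, p.2 <= q.2,
        q.2 + h / 2 ^+ n.+1 <= p.2 + h / 2 ^+ n & I n p <= 4 * I n.+1 q].
  case: p => x y /=.
  have E (k : R) : k / 2 ^+ n = k / 2 ^+ n.+1 + k / 2 ^+ n.+1.
    by rewrite exprS; field; rewrite expf_neq0.
  have pw : 0 <= w / 2 ^+ n.+1 by rewrite divr_ge0 ?exprn_ge0.
  have ph : 0 <= h / 2 ^+ n.+1 by rewrite divr_ge0 ?exprn_ge0.
  pose a := w / 2 ^+ n.+1; pose b := h / 2 ^+ n.+1.
  have In : I n (x, y) = cabs (loop x (x + (a + a)) y (y + (b + b))).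
    by rewrite /I /= !E.
  rewrite !E In -/a -/b.
  have split4 : loop x (x + (a + a)) y (y + (b + b)) =
      loop x (x + a) y (y + b) + loop (x + a) (x + a + a) y (y + b) +
      (loop x (x + a) (y + b) (y + b + b) +
       loop (x + a) (x + a + a) (y + b) (y + b + b)).
    by rewrite !addrA /loop; ring.
  have := cabsD (loop x (x + a) y (y + b) + loop (x + a) (x + a + a) y (y + b))
     (loop x (x + a) (y + b) (y + b + b) + loop (x + a) (x + a + a) (y + b) (y + b + b)).
  rewrite -split4.
  have := cabsD (loop x (x + a) y (y + b)) (loop (x + a) (x + a + a) y (y + b)).
  have := cabsD (loop x (x + a) (y + b) (y + b + b))
     (loop (x + a) (x + a + a) (y + b) (y + b + b)).
  rewrite -/a -/b in pw ph *.
  have e1 : I n.+1 (x, y) = cabs (loop x (x + a) y (y + b)) by [].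
  have e2 : I n.+1 (x + a, y) = cabs (loop (x + a) (x + a + a) y (y + b)) by [].
  have e3 : I n.+1 (x, y + b) = cabs (loop x (x + a) (y + b) (y + b + b)) by [].
  have e4 : I n.+1 (x + a, y + b) =
    cabs (loop (x + a) (x + a + a) (y + b) (y + b + b)) by [].
  rewrite -e1 -e2 -e3 -e4.
  set T := cabs (loop x _ y _) => i1 i2 i3.
  have [l1|l1] := leP T (4 * I n.+1 (x, y)); first by exists (x, y); split => //=; lra.
  have [l2|l2] := leP T (4 * I n.+1 (x + a, y)).
    by exists (x + a, y); split => //=; lra.
  have [l3|l3] := leP T (4 * I n.+1 (x, y + b)).
    by exists (x, y + b); split => //=; lra.
  by exists (x + a, y + b); split => //=; lra.
have /choice[next Hnext] : forall np : nat * (R * R), exists q : R * R,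
    [/\ np.2.1 <= q.1, q.1 + w / 2 ^+ np.1.+1 <= np.2.1 + w / 2 ^+ np.1,
        np.2.2 <= q.2, q.2 + h / 2 ^+ np.1.+1 <= np.2.2 + h / 2 ^+ np.1 &
        I np.1 np.2 <= 4 * I np.1.+1 q] by move=> [n p]; exact: step.
pose fix P n := if n is m.+1 then next (m, P m) else (x1, y1).
have HP n := Hnext (n, P n).
have [X HX] : exists l, forall n, (P n).1 <= l <= (P n).1 + w / 2 ^+ n.
  apply: nested_intervals => n; try by have [] := HP n.
  by rewrite lerDl divr_ge0 ?exprn_ge0.
have [Y HY] : exists l, forall n, (P n).2 <= l <= (P n).2 + h / 2 ^+ n.
  apply: nested_intervals => n; try by have [] := HP n.
  by rewrite lerDl divr_ge0 ?exprn_ge0.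
have IP n : cabs (loop x1 x2 y1 y2) <= 4 ^+ n * I n (P n).
  elim: n => [|n IH]; first by rewrite expr0 mul1r -I0.
  apply: le_trans IH _; rewrite exprSr -mulrA ler_wpM2l ?exprn_ge0 //.
  by have [] := HP n.
have Px n : x1 <= (P n).1.
  by elim: n => //= n IH; apply: le_trans IH _; have [] := HP n.
have X0 : 0 < Re (X +i* Y) by have /andP[l _] := HX 0%N; exact: lt_le_trans l.
apply/ler_addgt0Pl => e e0; rewrite addr0.
pose K := 2 * (w + h) ^+ 2 + 1.
have K0 : 0 < K by rewrite ltr_wpDl // mulr_ge0 // sqr_ge0.
have [del del0 B] := hG X0 (divr_gt0 e0 K0).
have [n Hn] : exists n, (w + h) / 2 ^+ n < del.
  pose N := Num.trunc ((w + h) / del); exists N.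
  rewrite ltr_pdivrMr ?exprn_gt0 // -ltr_pdivrMl // mulrC.
  have : (w + h) / del < N.+1%:R by exact: truncnS_gt.
  move/lt_le_trans; apply; rewrite -natrX ler_nat; exact: ltn_expl.
have n20 : 0 < 2 ^+ n :> R by exact: exprn_gt0.
apply: le_trans (IP n) _.
have wn0 : 0 <= w / 2 ^+ n by rewrite divr_ge0 ?exprn_ge0.
have hn0 : 0 <= h / 2 ^+ n by rewrite divr_ge0 ?exprn_ge0.
have L : I n (P n) <= 2 * (e / K * ((w + h) / 2 ^+ n)) * ((w + h) / 2 ^+ n).
  rewrite [X in _ * X](_ : _ = ((P n).1 + w / 2 ^+ n - (P n).1)
     + ((P n).2 + h / 2 ^+ n - (P n).2)); last by ring.
  apply: (@loop_le (G (X +i* Y) - dG (X +i* Y) * (X +i* Y)) (dG (X +i* Y)));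
    rewrite ?lerDl //; first exact: lt_le_trans (Px n).
  move=> x y /andP[xa xb] /andP[ya yb]; set hh := (x - X) +i* (y - Y).
  have /andP[Xa Xb] := HX n; have /andP[Ya Yb] := HY n.
  have hhle : cabs hh <= (w + h) / 2 ^+ n.
    apply: le_trans (cabs_le_ReIm _) _; rewrite mulrDl lerD // ler_norml /=; lra.
  have := B hh (le_lt_trans hhle Hn).
  have -> : x +i* y = X +i* Y + hh by rewrite /hh; simpc; rewrite !subrKC.
  move=> B1; rewrite (_ : _ - _ = G (X +i* Y + hh) - G (X +i* Y) - dG (X +i* Y) * hh); last by ring.
  exact: le_trans B1 (ler_wpM2l (ltW (divr_gt0 e0 K0)) hhle).
apply: le_trans (ler_wpM2l (exprn_ge0 _ (ler0n _ 4)) L) _.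
have -> : 4 ^+ n = 2 ^+ n * 2 ^+ n :> R by rewrite -exprMn; congr (_ ^+ _); lra.
rewrite [X in X <= _](_ : _ = e * ((2 * (w + h) ^+ 2) / K)); last first.
  by field; rewrite !gt_eqF.
by rewrite ler_piMr ?(ltW e0) // ler_pdivrMr // mul1r /K lerDl.
Qed.

End Goursat.

(** [Gam] integrates G from 1 along the real axis to Re z and then vertically to z. Goursat's lemma
    moves the horizontal leg of an increment to the height of z, so that the increment only involves
    values of G near z. *)
Lemma primitive G dG : hol G dG -> exists Gam : C -> C, hol Gam G.
Proof.
move=> hG; have [V DV] := vert_antiderivative hG.
have [H DH] := horiz_antiderivative hG.
pose Gam (z : C) := (H 0 (Re z) - H 0 1) + 'i * (V (Re z) (Im z) - V (Re z) 0).
exists Gam => -[x y] /= x0 e e0.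
have [del del0 B] := cdiff_continuous (hG (x +i* y) x0) (divr_gt0 e0 (ltr0n _ 2) : 0 < e / 2).
have loop0 (a b c d : R) : 0 < a -> 0 < b ->
   (H c b - H c a) + 'i * (V b d - V b c) = (H d b - H d a) + 'i * (V a d - V a c).
  move=> a0 b0.
  have [ab|/ltW ab] := leP a b; have [cd|/ltW cd] := leP c d.
  - have := Goursat hG DV DH a0 ab cd => /eqP; rewrite subr_eq0 => /eqP E.
    by rewrite -E; ring.
  - have := Goursat hG DV DH a0 ab cd => /eqP; rewrite subr_eq0 subr_eq => /eqP E.
    have E2 : 'i * (V a d - V a c) = - ('i * (V a c - V a d)) by ring.
    rewrite E2 -[H d b - H d a](addrK ('i * (V b c - V b d))) E; ring.
  - have := Goursat hG DV DH b0 ab cd => /eqP; rewrite subr_eq0 subr_eq => /eqP E.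
    rewrite -[H c b - H c a]opprB.
    rewrite -[H c a - H c b](addrK ('i * (V a d - V a c))) E; ring.
  - have := Goursat hG DV DH b0 ab cd => /eqP; rewrite subr_eq0 subr_eq => /eqP E.
    rewrite -[H d b - H d a]opprB.
    rewrite -[H d a - H d b](addrK ('i * (V a c - V a d))) E; ring.
exists (Num.min del x); first by rewrite lt_min del0.
move=> [h k]; rewrite lt_min => /andP[hd hx].
have hh : `|h| <= cabs (h +i* k) := normRe_le_cabs (h +i* k).
have kk : `|k| <= cabs (h +i* k) := Im_le_cabs (h +i* k).
have hb : `|h| < x by exact: le_lt_trans hh hx.
have xh0 : 0 < x + h by move: hb; rewrite ltr_norml => /andP[]; lra.
have cont s t : `|s| <= `|h| -> `|t| <= `|k| ->
    cabs (G ((x + s) +i* (y + t)) - G (x +i* y)) <= e / 2.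
  move=> sh tk; have := B (s +i* t); rewrite -[_ +i* _ + _]/((x + s) +i* (y + t)); apply.
  apply: le_lt_trans hd.
  rewrite -(@ler_pXn2r _ 2) ?nnegrE ?cabs_ge0 // !cabs_sqr /=.
  by rewrite lerD // -[leLHS]real_normK ?num_real // -[leRHS]real_normK ?num_real //
    ler_pXn2r ?nnegrE.
(* Mean value estimate for a path whose derivative stays near G (x +i* y), with a step s of either
   sign. *)
have seg (phi : R -> C) a s : (forall t, (a <= t <= a + s) || (a + s <= t <= a) ->
    exists2 d, path_derive phi t d & cabs (d - G (x +i* y)) <= e / 2) ->
    cabs (phi (a + s) - phi a - G (x +i* y) * s%:C) <= e / 2 * `|s|.
  move=> Hp; pose q := fun t : R => G (x +i* y) * t%:C.
  have Dq t : path_derive q t (G (x +i* y)).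
    move=> c; have := path_derive_horiz_poly (G (x +i* y)) 0 0 t c.
    rewrite !mul0r addr0; under eq_fun do rewrite mul0r addr0.
    by [].
  have key a1 b1 : a1 <= b1 -> (forall t, a1 <= t <= b1 ->
      exists2 d, path_derive phi t d & cabs (d - G (x +i* y)) <= e / 2) ->
      cabs ((phi b1 - q b1) - (phi a1 - q a1)) <= e / 2 * b1 - e / 2 * a1.
    move=> ab Hq.
    have /choice[d Hd] : forall t, exists d, a1 <= t <= b1 ->
        path_derive phi t d /\ cabs (d - G (x +i* y)) <= e / 2.
      move=> t; have [tt|tt] := boolP (a1 <= t <= b1); last by exists 0.
      by have [d D1 D2] := Hq t tt; exists d.
    apply: (@path_increment R (fun t => phi t - q t) (fun t => d t - G (x +i* y))
       _ (fun=> e / 2)) => // t tt.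
    - by apply: path_deriveB; [have [] := Hd t tt|exact: Dq].
    - exact: is_derive_linear.
    - by have [] := Hd t tt.
  have [s0|/ltW s0] := leP 0 s.
    have := key a (a + s); rewrite lerDl s0 => /(_ isT).
    rewrite (_ : phi (a + s) - _ - _ = phi (a + s) - q (a + s) - (phi a - q a)).
      move=> K; apply: le_trans (K _) _; last by rewrite ger0_norm //; lra.
      by move=> t tt; apply: Hp; rewrite tt.
    by rewrite /q rmorphD /=; ring.
  have := key (a + s) a; rewrite gerDl s0 => /(_ isT).
  rewrite (_ : phi (a + s) - _ - _ = - (phi a - q a - (phi (a + s) - q (a + s)))).
    rewrite cabsN => K; apply: le_trans (K _) _; last by rewrite ler0_norm //; lra.
    by move=> t tt; apply: Hp; rewrite tt orbT.
  by rewrite /q rmorphD /=; ring.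
have -> : Gam (x +i* y + h +i* k) - Gam (x +i* y) - G (x +i* y) * (h +i* k) =
   (H y (x + h) - H y x - G (x +i* y) * h%:C) +
   'i * (V (x + h) (y + k) - V (x + h) y - G (x +i* y) * k%:C).
  rewrite /Gam /= (_ : h +i* k = h%:C + 'i * k%:C); last by simpc.
  have := loop0 x (x + h) 0 y x0 xh0; move: (H 0 (x + h)) => a.
  move=> /(canRL (addrK _)) /(canRL (subrK _)) ->; ring.
apply: le_trans (cabsD _ _) _; rewrite cabsM cabsi mul1r.
apply: le_trans (_ : e / 2 * `|h| + e / 2 * `|k| <= _); last first.
  have := ler_wpM2l (ltW e0) (lerD hh kk); lra.
apply: lerD.
  apply: (seg (H y)) => t tt; exists (G (t +i* y)).
    apply: DH; move: tt => /orP[] /andP[t1 t2]; first exact: lt_le_trans t1.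
    exact: lt_le_trans t1.
  have := cont (t - x) 0; rewrite subrKC addr0 normr0; apply => //.
  move: tt => /orP[] /andP[t1 t2].
    by rewrite ger0_norm ?subr_ge0 // (le_trans _ (ler_norm _)) // lerBlDl.
  by rewrite ler0_norm ?subr_le0 // -normrN (le_trans _ (ler_norm _)) // opprB; lra.
apply: (seg (V (x + h))) => t tt; exists (G ((x + h) +i* t)).
  exact: DV.
have := cont h (t - y); rewrite subrKC; apply => //.
move: tt => /orP[] /andP[t1 t2].
  by rewrite ger0_norm ?subr_ge0 // (le_trans _ (ler_norm _)) // lerBlDl.
by rewrite ler0_norm ?subr_le0 // -normrN (le_trans _ (ler_norm _)) // opprB; lra.
Qed.

End Primitive.

(** * Averages of a holomorphic function over an arc at small height *)

Section Averages.
Variable R : realType.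
Local Notation C := R[i].
Local Notation arc := (R * R)%type.
Implicit Types (G dG Gam : C -> C) (z d c : C) (x y t : R) (J K : arc).

Lemma le_of_eq (a b : R) : a = b -> a <= b.
Proof. by move=> ->. Qed.

(* The arc (a, l) stands for the interval [a, a + l[. *)
Definition left_half J : arc := (J.1, J.2 / 2).
Definition right_half J : arc := (J.1 + J.2 / 2, J.2 / 2).
Definition apex J : C := J.2 +i* J.1.

(* If Gam is a primitive of G, this is the integral over y in J of G (x + iy). *)
Definition mass Gam x J : C :=
  - 'i * (Gam (x +i* (J.1 + J.2)) - Gam (x +i* J.1)).

Lemma mass_halves Gam x J :
  mass Gam x J = mass Gam x (left_half J) + mass Gam x (right_half J).
Proof.
case: J => a l; rewrite /mass /left_half /right_half /=.
by rewrite (_ : a + l / 2 + l / 2 = a + l); [ring|field].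
Qed.

Lemma is_derive_cpow (k p t : R) : 0 < t ->
  is_derive t 1 (fun u => k * u `^ p) (k * (p * t `^ (p - 1))).
Proof.
move=> t0; have D := is_derive1_powR p t0.
have D2 : is_derive t 1 (k *: (@powR R ^~ p)) (k *: (p * t `^ (p - 1))).
  exact: is_deriveZ.
exact: D2.
Qed.

Lemma powRNr (t s : R) : 0 < t -> t `^ s * t `^ (- s) = 1.
Proof. by move=> t0; rewrite powRN mulfV // gt_eqF // powR_gt0. Qed.

Lemma mass_ler Gam G x J (m : R) : hol Gam G -> 0 < x -> 0 <= J.2 ->
  (forall y, J.1 <= y <= J.1 + J.2 -> m <= Re (G (x +i* y))) ->
  m * J.2 <= Re (mass Gam x J).
Proof.
case: J => a l /= hG x0 l0 H.
have := @increment_le R (fun y => m * y) (fun=> m)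
   (fun y => Re (- 'i * Gam (x +i* y))) (fun y => Re (- 'i * ('i * G (x +i* y)))) a (a + l).
rewrite lerDl => /(_ l0).
have E y : Re (- 'i * ('i * G (x +i* y))) = Re (G (x +i* y)).
  by rewrite !(ReM, ImM, ReN, ImN) /=; ring.
rewrite /mass /= mulrBr ReD ReN (_ : m * (a + l) - m * a = m * l); last by ring.
apply => t tt.
- exact: is_derive_linear.
- by apply: (cdiff_vert _ (- 'i)); exact: hG.
- by rewrite E; exact: H.
Qed.

Lemma mass_cabs_le Gam G x J (w : C) (m : R) : hol Gam G -> 0 < x -> 0 <= J.2 ->
  (forall y, J.1 <= y <= J.1 + J.2 -> cabs (G (x +i* y) - w) <= m) ->
  cabs (mass Gam x J - w * J.2%:C) <= m * J.2.
Proof.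
case: J => a l /= hG x0 l0 H.
have := @path_increment R (fun y => - 'i * Gam (x +i* y) - w * y%:C)
   (fun y => - 'i * ('i * G (x +i* y)) - w) (fun y => m * y) (fun=> m) a (a + l).
rewrite lerDl => /(_ l0).
have -> : - 'i * Gam (x +i* (a + l)) - w * (a + l)%:C - (- 'i * Gam (x +i* a) - w * a%:C)
  = mass Gam x (a, l) - w * l%:C by rewrite /mass /= rmorphD /=; ring.
rewrite (_ : m * (a + l) - m * a = m * l); last by ring.
have E y : - 'i * ('i * G (x +i* y)) = G (x +i* y).
  by rewrite mulrA mulNr (_ : 'i * 'i = -1) ?opprK ?mul1r //; simpc.
apply => t tt.
- apply: path_deriveB.
    move=> c; have := cdiff_vert (hG (x +i* t) x0) (c * - 'i).
    by under eq_fun do rewrite -mulrA; rewrite -mulrA.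
  move=> c; have := path_derive_horiz_poly w 0 0 t c.
  by rewrite !mul0r addr0; under eq_fun do rewrite mul0r addr0.
- exact: is_derive_linear.
- by rewrite E; exact: H.
Qed.

Section Estimate.
Variables (G dG Gam : C -> C) (J : arc) (x b s : R).
Hypotheses (hG : hol G dG) (hGam : hol Gam G).
Hypotheses (x0 : 0 < x) (xJ : x <= J.2) (b0 : 0 <= b) (s0 : 0 < s) (s1 : s < 1).
Hypothesis B : forall t y, x <= t <= J.2 -> J.1 <= y <= J.1 + J.2 ->
  cabs (dG (t +i* y)) <= b * J.2 `^ s * t `^ (- s - 1).

Let l := J.2.
Let l0 : 0 < l. Proof. exact: lt_le_trans xJ. Qed.

Lemma vertical_oscillation t y : x <= t <= l -> J.1 <= y <= J.1 + l ->
  cabs (G (l +i* y) - G (t +i* y)) <= b / s * (l `^ s * t `^ (- s) - 1).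
Proof.
move=> /andP[xt tl] yy.
apply: le_trans (_ : (- (b / s * l `^ s)) * l `^ (- s) -
   (- (b / s * l `^ s)) * t `^ (- s) <= _); last first.
  rewrite [X in X <= _](_ : _ = - (b / s) * (l `^ s * l `^ (- s)) +
    b / s * (l `^ s * t `^ (- s))); last by ring.
  by rewrite powRNr //; lra.
apply: (@path_increment R (fun t => G (t +i* y)) (fun t => dG (t +i* y))
  (fun u => - (b / s * l `^ s) * u `^ (- s)) (fun u => - (b / s * l `^ s) * (- s * u `^ (- s - 1))) t l tl) => u /andP[tu ul].
- by apply: cdiff_horiz; apply: hG; exact: lt_le_trans (le_trans xt tu).
- by apply: is_derive_cpow; exact: lt_le_trans (le_trans xt tu).
- apply: le_trans (B _ yy) _; first by rewrite (le_trans xt tu) ul.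
  rewrite -/l; apply: le_of_eq; field; exact: lt0r_neq0.
Qed.

Lemma horizontal_oscillation y y' : J.1 <= y -> y <= y' -> y' <= J.1 + l ->
  cabs (G (l +i* y') - G (l +i* y)) <= b.
Proof.
move=> ay yy' yb.
apply: le_trans (_ : b / l * y' - b / l * y <= _); last first.
  rewrite -mulrBr -mulrA ler_piMr // ler_pdivrMl // mulr1; lra.
apply: (@path_increment R (fun t => G (l +i* t)) (fun t => 'i * dG (l +i* t))
  (fun t => b / l * t) (fun=> b / l)) => // t /andP[t1 t2].
- by apply: cdiff_vert; exact: hG.
- exact: is_derive_linear.
- rewrite cabsM cabsi mul1r; apply: le_trans (B _ _) _.
  + by rewrite xJ lexx.
  + by rewrite -/l; lra.
  rewrite -/l -mulrA -powRD; last by rewrite (gt_eqF l0) implybT.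
  rewrite addrA subrr add0r powR_inv1; first exact: lexx.
  exact: ltW.
Qed.

(** At height l the mass is close to l G (apex J). Its derivative in the height is, up to the factor
    -i, the difference of G at the two ends of J, hence bounded by two vertical oscillations, of
    order t^(-s), and a horizontal one. Since s < 1 this is integrable down to 0, and the bound does
    not depend on x. *)
Lemma mass_estimate :
  cabs (mass Gam x J - G (apex J) * l%:C) <= b * (2 / (s * (1 - s)) + 1) * l.
Proof.
have M1 : cabs (mass Gam l J - G (apex J) * l%:C) <= b * l.
  apply: mass_cabs_le hGam _ _ _ => //; first exact: ltW.
  by move=> y /andP[y1 y2]; apply: horizontal_oscillation.
have s10 : 0 < 1 - s by rewrite subr_gt0.
have sn0 : s != 0 by rewrite gt_eqF.
have sn1 : 1 - s != 0 by rewrite gt_eqF.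
have M2 : cabs (mass Gam l J - mass Gam x J) <= 2 * b / (s * (1 - s)) * l.
  pose k := 2 * b / (s * (1 - s)) * l `^ s.
  have k0 : 0 <= k by rewrite mulr_ge0 ?powR_ge0 // divr_ge0 ?mulr_ge0 // ltW.
  apply: le_trans (_ : k * l `^ (1 - s) - k * x `^ (1 - s) <= _); last first.
    apply: le_trans (_ : k * l `^ (1 - s) <= _).
      by rewrite gerBl mulr_ge0 ?powR_ge0.
    rewrite /k -mulrA -powRD; last by rewrite (gt_eqF l0) implybT.
    by rewrite subrKC powRr1 // ltW.
  apply: (@path_increment R (fun t => mass Gam t J)
    (fun t => - 'i * (G (t +i* (J.1 + J.2)) - G (t +i* J.1)))
    (fun t => k * t `^ (1 - s))
    (fun t => k * ((1 - s) * t `^ (1 - s - 1))) x l xJ) => t /andP[xt tl].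
  - have t0 : 0 < t := lt_le_trans x0 xt.
    move=> c; have := path_deriveB (cdiff_horiz (@hGam (t +i* (J.1 + J.2)) t0))
      (cdiff_horiz (@hGam (t +i* J.1) t0)) (c * - 'i).
    by rewrite /mass; under eq_fun do rewrite -mulrA; rewrite -mulrA.
  - by apply: is_derive_cpow; exact: lt_le_trans xt.
  - rewrite cabsM cabsN cabsi mul1r.
    have V1 := @vertical_oscillation t J.1; have V2 := @vertical_oscillation t (J.1 + J.2).
    have Hz := @horizontal_oscillation J.1 (J.1 + J.2).
    rewrite xt tl !lexx !lerDl (ltW l0) /= in V1 V2 Hz.
    have {}V1 := V1 isT isT; have {}V2 := V2 isT isT; have {}Hz := Hz isT isT isT.
    have -> : G (t +i* (J.1 + J.2)) - G (t +i* J.1) =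
       - (G (l +i* (J.1 + J.2)) - G (t +i* (J.1 + J.2))) +
       (G (l +i* J.1) - G (t +i* J.1)) +
       (G (l +i* (J.1 + J.2)) - G (l +i* J.1)) by ring.
    apply: le_trans (cabsD _ _) _; apply: le_trans (lerD (cabsD _ _) Hz) _.
    rewrite cabsN; apply: le_trans (lerD (lerD V2 V1) (lexx b)) _.
    rewrite (_ : 1 - s - 1 = - s); last by ring.
    set p := l `^ s * t `^ (- s).
    have -> : k * ((1 - s) * t `^ (- s)) = 2 * (b / s) * p.
      by rewrite /k /p; field; rewrite sn0 sn1.
    have : b <= b / s by rewrite ler_pdivlMr // ler_piMr // ltW.
    move: b0 (b / s) p => ? u p ?; nra.
have -> : mass Gam x J - G (apex J) * l%:C =
   (mass Gam l J - G (apex J) * l%:C) - (mass Gam l J - mass Gam x J) by ring.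
apply: le_trans (cabsD _ _) _; rewrite cabsN.
apply: le_trans (lerD M1 M2) _; apply: le_of_eq; field.
by rewrite sn0 sn1.
Qed.

End Estimate.

End Averages.

(** * Lipschitz bounds for the hyperbolic metric *)

Section HyperbolicLipschitz.
Variable R : realType.
Local Notation C := R[i].
Implicit Types (G dG Gam : C -> C) (z c : C) (x y t l : R).

(** The D-Lipschitz condition for the metric |dz| / Re z, imposed on horizontal and vertical
    segments, the only ones travelled. *)
Definition hyp_lip (D : R) (Lam : C -> R) : Prop := forall x y, 0 < x ->
  (exists2 d : R, is_derive x 1 (fun t => Lam (t +i* y)) d & `|d| <= D / x) /\
  (exists2 d : R, is_derive y 1 (fun t => Lam (x +i* t)) d & `|d| <= D / x).

Lemma is_derive_cln (k t : R) : 0 < t -> is_derive t 1 (fun u => k * ln u) (k / t).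
Proof.
move=> t0; have D := is_derive1_ln t0.
have D2 : is_derive t 1 (k *: @ln R) (k *: t^-1) by exact: is_deriveZ.
exact: D2.
Qed.

Lemma increment_abs_le (p q dq : R -> R) (a b : R) : a <= b ->
  (forall t, a <= t <= b -> exists2 d : R, is_derive t 1 p d & `|d| <= dq t) ->
  (forall t, a <= t <= b -> is_derive t 1 q (dq t)) ->
  `|p b - p a| <= q b - q a.
Proof.
move=> ab Dp Dq.
have /choice[d Hd] : forall t, exists d : R, a <= t <= b ->
    is_derive t 1 p d /\ `|d| <= dq t.
  move=> t; have [tt|tt] := boolP (a <= t <= b); last by exists 0.
  by have [d D1 D2] := Dp t tt; exists d.
rewrite ler_norml; apply/andP; split; last first.
  apply: (increment_le ab (fun t tt => (Hd t tt).1) Dq) => t tt.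
  by have [_ /(le_trans (ler_norm _))] := Hd t tt.
have := @increment_le R (fun t => - p t) (fun t => - d t) q dq a b ab _ Dq.
rewrite lerNl -opprB opprK addrC; apply => t tt.
  by have [D1 _] := Hd t tt; exact: is_deriveN.
by have [_] := Hd t tt; rewrite -normrN => /(le_trans (ler_norm _)).
Qed.

(** The route goes up from height t to height l and then across at height l, where a horizontal move
    costs only |y - y'| / l. *)
Lemma hyp_lip_le D Lam t l y y' : 0 <= D -> hyp_lip D Lam -> 0 < t -> t <= l ->
  `|Lam (t +i* y) - Lam (l +i* y')| <= D * (ln l - ln t + `|y - y'| / l).
Proof.
move=> D0 H t0 tl; have l0 := lt_le_trans t0 tl.
have V : `|Lam (l +i* y) - Lam (t +i* y)| <= D * ln l - D * ln t.
  apply: (@increment_abs_le (fun t => Lam (t +i* y)) (fun t => D * ln t)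
    (fun t => D / t)) => // u /andP[tu ul].
    by have [] := H u y (lt_le_trans t0 tu).
  by apply: is_derive_cln; exact: lt_le_trans tu.
have hz y1 y2 : y1 <= y2 -> `|Lam (l +i* y2) - Lam (l +i* y1)| <= D / l * y2 - D / l * y1.
  move=> yy; apply: (@increment_abs_le (fun t => Lam (l +i* t)) (fun t => D / l * t)
    (fun=> D / l)) => // u uu; last exact: is_derive_linear.
  by have [] := H l u l0.
have Hz : `|Lam (l +i* y) - Lam (l +i* y')| <= D * (`|y - y'| / l).
  have [yy|/ltW yy] := leP y y'.
    rewrite distrC (@ler0_norm _ (y - y')) ?subr_le0 //; apply: le_trans (hz _ _ yy) _; lra.
  rewrite (@ger0_norm _ (y - y')) ?subr_ge0 //; apply: le_trans (hz _ _ yy) _; lra.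
rewrite distrC in V.
have -> : Lam (t +i* y) - Lam (l +i* y') = (Lam (t +i* y) - Lam (l +i* y)) +
  (Lam (l +i* y) - Lam (l +i* y')) by ring.
apply: le_trans (ler_normD _ _) _; apply: le_trans (lerD V Hz) _; lra.
Qed.

Lemma hyp_lip_lnRe D G dG : hol G dG -> (forall z, 0 < Re z -> 0 < Re (G z)) ->
  (forall z, 0 < Re z -> cabs (dG z) <= D * Re (G z) / Re z) ->
  hyp_lip D (fun z => ln (Re (G z))).
Proof.
move=> hG G0 HD x y x0; have H := hG (x +i* y) x0.
have u0 := G0 (x +i* y) x0.
have key (d : C) : cabs d <= cabs (dG (x +i* y)) -> `|(Re (G (x +i* y)))^-1 * Re d| <= D / x.
  move=> dd; rewrite normrM gtr0_norm ?invr_gt0 //.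
  rewrite ler_pdivrMl //; apply: le_trans (normRe_le_cabs _) _.
  by apply: le_trans dd _; apply: le_trans (HD (x +i* y) x0) _; rewrite /= mulrCA mulrA.
split.
  have D1 := cdiff_horiz H 1.
  have L0 : 0 < Re (1 * G (x +i* y)) by rewrite mul1r.
  have := is_derive1_comp (is_derive1_ln L0) D1; rewrite !mul1r => D2.
  exists ((Re (G (x +i* y)))^-1 * Re (dG (x +i* y))); last exact: key.
  by move: D2; under eq_fun do rewrite /= mul1r.
have D1 := cdiff_vert H 1.
have L0 : 0 < Re (1 * G (x +i* y)) by rewrite mul1r.
have := is_derive1_comp (is_derive1_ln L0) D1; rewrite !mul1r => D2.
exists ((Re (G (x +i* y)))^-1 * Re ('i * dG (x +i* y))); last first.
  by apply: key; rewrite cabsM cabsi mul1r.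
by move: D2; under eq_fun do rewrite /= mul1r.
Qed.

(** For 0 <= r < 1 this is the hyperbolic distance from 0 to r in the disc with density 2 / (1 -
    |z|^2). *)
Definition lnq (r : R) : R := ln (1 + r) - ln (1 - r).

Lemma lnq_mono (r s : R) : -1 < r -> r <= s -> s < 1 -> lnq r <= lnq s.
Proof.
by move=> r1 rs s1; apply: lerB; rewrite ler_ln ?posrE; lra.
Qed.

Lemma is_derive_lnq (p : R -> R) t d : is_derive t 1 p d -> -1 < p t < 1 ->
  is_derive t 1 (fun s => lnq (p s)) (2 * d / (1 - p t ^+ 2)).
Proof.
move=> Dp /andP[p1 p2].
have q1 : 0 < 1 + p t by lra.
have q2 : 0 < 1 - p t by lra.
have D1 : is_derive t 1 (cst 1 + p) d.
  have D := is_deriveD (is_derive_cst (1 : R) t (1 : R)) Dp.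
  by apply: (is_derive_eq D); rewrite add0r.
have D2 : is_derive t 1 (cst 1 - p) (- d).
  have D := is_deriveB (is_derive_cst (1 : R) t (1 : R)) Dp.
  by apply: (is_derive_eq D); rewrite sub0r.
have L1 := is_derive1_comp (is_derive1_ln q1 : is_derive ((cst 1 + p) t) 1 (@ln R) _) D1.
have L2 := is_derive1_comp (is_derive1_ln q2 : is_derive ((cst 1 - p) t) 1 (@ln R) _) D2.
apply: (is_derive_eq (is_deriveB L1 L2)).
rewrite (_ : 1 - p t ^+ 2 = (1 + p t) * (1 - p t)); last by ring.
by field; rewrite !gt_eqF.
Qed.

(** With density 1 / Re z on the half-plane and 2 / (1 - |z|^2) on the disc, the last clause says
    that g is infinitesimally D-Lipschitz. *)
Definition hyp_contr (D : R) (g dg : C -> C) : Prop :=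
  [/\ hol g dg, (forall z, 0 < Re z -> cabs (g z) < 1) &
      forall z, 0 < Re z -> cabs (dg z) <= D * (1 - cabs (g z) ^+ 2) / (2 * Re z)].

Lemma hyp_lip_lnq D g dg c : hyp_contr D g dg -> cabs c <= 1 ->
  hyp_lip D (fun z => lnq (Re (c * g z))).
Proof.
move=> [hg g1 HD] c1 x y x0; have H := hg (x +i* y) x0.
have cg z : cabs (c * z) <= cabs z by rewrite cabsM ler_piMl ?cabs_ge0.
have p1 : `|Re (c * g (x +i* y))| < 1.
  apply: le_lt_trans (normRe_le_cabs _) _.
  by apply: le_lt_trans (cg _) _; exact: g1.
have p1' : -1 < Re (c * g (x +i* y)) < 1 by rewrite -ltr_norml.
set p := Re (c * g (x +i* y)) in p1 p1' *.
have q0 : 0 < 1 - p ^+ 2.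
  by rewrite subr_gt0 -[ltLHS]real_normK ?num_real // expr_lt1.
have key (d : C) : cabs d <= cabs (dg (x +i* y)) -> `|2 * Re (c * d) / (1 - p ^+ 2)| <= D / x.
  move=> dd; rewrite normrM [X in _ * X]gtr0_norm ?invr_gt0 //.
  rewrite ler_pdivrMr // normrM (ger0_norm (ler0n _ 2)).
  have pg : p ^+ 2 <= cabs (g (x +i* y)) ^+ 2.
    rewrite -[leLHS]real_normK ?num_real // ler_pXn2r ?nnegrE ?cabs_ge0 //.
    exact: le_trans (normRe_le_cabs _) (cg _).
  have D0 : 0 <= D.
    have := le_trans (cabs_ge0 _) (HD (x +i* y) x0).
    rewrite /= pmulr_lge0 ?invr_gt0 ?mulr_gt0 // pmulr_lge0 //.
    by rewrite subr_gt0 expr_lt1 ?cabs_ge0 // g1.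
  have : `|Re (c * d)| <= D * (1 - p ^+ 2) / (2 * x).
    apply: le_trans (normRe_le_cabs _) _; apply: le_trans (cg _) _.
    apply: le_trans dd _; apply: le_trans (HD (x +i* y) x0) _.
    rewrite /= ler_pM2r ?invr_gt0 ?mulr_gt0 // ler_wpM2l // lerD2l lerN2 //.
  have -> : D * (1 - p ^+ 2) / (2 * x) = (D / x * (1 - p ^+ 2)) / 2.
    by field; rewrite gt_eqF.
  lra.
split.
  exists (2 * Re (c * dg (x +i* y)) / (1 - p ^+ 2)); last exact: key.
  exact: (is_derive_lnq (cdiff_horiz H c)).
exists (2 * Re (c * ('i * dg (x +i* y))) / (1 - p ^+ 2)).
  exact: (is_derive_lnq (cdiff_vert H c)).
by apply: key; rewrite cabsM cabsi mul1r.
Qed.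

(** The modulus |g| need not be differentiable at zeros of g. The bound is therefore taken from a
    projection Re (c g), where c realises the modulus at one of the two points, and at the other
    point the projection is at most the modulus. *)
Lemma hyp_contr_le D g dg t l y y' : 0 <= D -> hyp_contr D g dg -> 0 < t -> t <= l ->
  `|lnq (cabs (g (t +i* y))) - lnq (cabs (g (l +i* y')))| <=
    D * (ln l - ln t + `|y - y'| / l).
Proof.
move=> D0 H t0 tl; have l0 := lt_le_trans t0 tl.
have [_ g1 _] := H.
have low z z' c : 0 < Re z -> cabs c <= 1 -> lnq (Re (c * g z)) <= lnq (cabs (g z)).
  move=> z0 c1; apply: lnq_mono; last exact: g1.
    have : `|Re (c * g z)| < 1.
      apply: le_lt_trans (normRe_le_cabs _) _; rewrite cabsM.
      by apply: le_lt_trans (g1 z z0); rewrite ler_piMl ?cabs_ge0.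
    by rewrite ltr_norml => /andP[].
  exact: ReM_le_cabs.
rewrite ler_norml; apply/andP; split.
  have [c c1 E] := cabs_attained (g (l +i* y')).
  have := hyp_lip_le y y' D0 (hyp_lip_lnq H c1) t0 tl.
  rewrite ler_norml => /andP[A _]; apply: le_trans A _.
  by rewrite E lerD2r; exact: (low _ 0).
have [c c1 E] := cabs_attained (g (t +i* y)).
have := hyp_lip_le y y' D0 (hyp_lip_lnq H c1) t0 tl.
rewrite ler_norml => /andP[_ A]; apply: le_trans _ A.
by rewrite E lerD2l lerN2; exact: (low _ 0).
Qed.

End HyperbolicLipschitz.

(** * Two-sided bounds for averages of functions with positive real part *)

Section PositiveRealPart.
Variable R : realType.
Local Notation C := R[i].
Local Notation arc := (R * R)%type.

Section Bounds.
Variables (D : R) (G dG Gam Gam2 : C -> C) (J : arc).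
Hypotheses (D0 : 0 < D) (D1 : D < 1).
Hypotheses (hG : hol G dG) (hGam : hol Gam G) (hGam2 : hol Gam2 Gam).
Hypothesis G0 : forall z, 0 < Re z -> 0 < Re (G z).
Hypothesis dG_le : forall z, 0 < Re z -> cabs (dG z) <= D * Re (G z) / Re z.
Hypothesis l0 : 0 < J.2.

Let l := J.2.
Let h := l / 2.
Let u := Re (G (apex J)).
Let b := D * expR 1 * u.
Let k := 2 / (D * (1 - D)) + 1.

Let u0 : 0 < u. Proof. exact: G0. Qed.
Let b0 : 0 < b. Proof. by rewrite !mulr_gt0 // expR_gt0. Qed.

Lemma ln_oscillation t y : 0 < t <= l -> J.1 <= y <= J.1 + l ->
  `|ln (Re (G (t +i* y))) - ln u| <= D * (ln l - ln t) + 1.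
Proof.
move=> /andP[t0 tl] /andP[y1 y2].
have := hyp_lip_le y J.1 (ltW D0) (hyp_lip_lnRe hG G0 dG_le) t0 tl.
move/le_trans; apply; rewrite mulrDr lerD2l.
have : `|y - J.1| / l <= 1.
  by rewrite ler_pdivrMr // mul1r ger0_norm; lra.
have : 0 <= `|y - J.1| / l by rewrite divr_ge0 // ltW.
by have := D0; have := D1; nra.
Qed.

Lemma ReG_le t y : 0 < t <= l -> J.1 <= y <= J.1 + l ->
  Re (G (t +i* y)) <= expR 1 * u * (l `^ D * t `^ (- D)).
Proof.
move=> tl yy; have := ln_oscillation tl yy; have /andP[t0 _] := tl.
rewrite ler_norml => /andP[_ H].
have v0 : 0 < Re (G (t +i* y)) by exact: G0.
rewrite -ler_ln ?posrE ?mulr_gt0 ?expR_gt0 ?powR_gt0 //.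
rewrite !lnM ?posrE ?mulr_gt0 ?expR_gt0 ?powR_gt0 // expRK !ln_powR; lra.
Qed.

Lemma ReG_ge t y : 0 < t <= l -> J.1 <= y <= J.1 + l ->
  expR (-1) * u * (l `^ (- D) * t `^ D) <= Re (G (t +i* y)).
Proof.
move=> tl yy; have := ln_oscillation tl yy; have /andP[t0 _] := tl.
rewrite ler_norml => /andP[H _].
have v0 : 0 < Re (G (t +i* y)) by exact: G0.
rewrite -ler_ln ?posrE ?mulr_gt0 ?expR_gt0 ?powR_gt0 //.
rewrite !lnM ?posrE ?mulr_gt0 ?expR_gt0 ?powR_gt0 // expRK !ln_powR; lra.
Qed.

Lemma dG_le_pow t y : 0 < t <= l -> J.1 <= y <= J.1 + l ->
  cabs (dG (t +i* y)) <= b * l `^ D * t `^ (- D - 1).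
Proof.
move=> tl yy; have /andP[t0 _] := tl.
apply: le_trans (dG_le (z := t +i* y) t0) _; rewrite /=.
rewrite ler_pdivrMr // -!mulrA ler_pM2l //.
apply: le_trans (ReG_le tl yy) _.
have -> : t `^ (- D - 1) * t = t `^ (- D).
  rewrite powRB ?(gt_eqF t0) ?implybT // powRr1; last exact: ltW.
  by rewrite divfK // gt_eqF.
by rewrite -!mulrA.
Qed.

Lemma mass_le_of_pos x : 0 < x -> x <= l ->
  cabs (mass Gam x J - G (apex J) * l%:C) <= b * k * l.
Proof.
move=> x0 xl; apply: (mass_estimate hG hGam) => //; first exact: ltW.
by move=> t y /andP[xt tl]; apply: dG_le_pow; rewrite tl (lt_le_trans x0 xt).
Qed.

(** Both halves are compared with the same number, so the difference of their masses is bounded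
    uniformly in x; up to a factor of modulus 1 it is the derivative of the trapezoid average
    below. *)
Lemma half_mass_estimate x (K : arc) : K = left_half J \/ K = right_half J ->
  0 < x -> x <= h -> cabs (mass Gam x K - G (apex J) * h%:C) <= b * (3 * k) * h.
Proof.
move=> HK x0 xh.
have h0 : 0 < h by rewrite divr_gt0.
have hl : h <= l by rewrite /h; have := l0; rewrite -/l; lra.
have K2 : K.2 = h by case: HK => ->.
have Ka : J.1 <= K.1 by case: HK => -> //=; rewrite lerDl ltW.
have Kb : K.1 + h <= J.1 + l by case: HK => -> /=; rewrite -/l /h; have := l0; rewrite -/l; lra.
have lh : l `^ D = 2 `^ D * h `^ D.
  by rewrite -powRM ?(ltW h0) // /h mulrC divfK.
have p2 : 2 `^ D <= 2 by rewrite ler1_powR // ?ler1n // ltW.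
have lD : l `^ D <= 2 * h `^ D by rewrite lh ler_wpM2r ?powR_ge0.
have E1 : cabs (mass Gam x K - G (apex K) * h%:C) <= 2 * b * k * h.
  rewrite -K2; apply: (mass_estimate hG hGam) => //; rewrite ?K2 //.
    by rewrite mulr_ge0 // ltW.
  move=> t y /andP[xt th] /andP[y1 y2]; apply: le_trans (dG_le_pow _ _) _.
  - by rewrite (lt_le_trans x0 xt) (le_trans th hl).
  - by rewrite (le_trans Ka y1) (le_trans y2 Kb).
  rewrite ler_wpM2r ?powR_ge0 //.
  by rewrite (mulrC 2 b) -(mulrA b 2) ler_pM2l.
have E2 : cabs (G (apex K) - G (apex J)) <= b * k.
  have B : forall t y, h <= t <= J.2 -> J.1 <= y <= J.1 + J.2 ->
      cabs (dG (t +i* y)) <= b * J.2 `^ D * t `^ (- D - 1).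
    by move=> t y /andP[ht tl]; apply: dG_le_pow; rewrite tl (lt_le_trans h0 ht).
  have K1r : J.1 <= K.1 <= J.1 + l by rewrite Ka; have := h0; lra.
  have := vertical_oscillation hG h0 hl D0 B (t := h) (y := K.1).
  rewrite lexx hl -/l => /(_ isT K1r) V.
  have := horizontal_oscillation hG h0 hl (ltW b0) B (y := J.1) (y' := K.1).
  rewrite lexx -/l => /(_ isT Ka); case/andP: K1r => _ K1r /(_ K1r) Hz.
  have -> : G (apex K) - G (apex J) = - (G (l +i* K.1) - G (h +i* K.1)) +
     (G (l +i* K.1) - G (l +i* J.1)) by rewrite /apex K2 -/l; ring.
  apply: le_trans (cabsD _ _) _; rewrite cabsN; apply: le_trans (lerD V Hz) _.
  have -> : l `^ D * h `^ (- D) = 2 `^ D.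
    by rewrite lh -mulrA powRNr ?mulr1.
  have : b / D <= b * (2 / (D * (1 - D))).
    rewrite ler_pM2l // ler_pdivlMr ?mulr_gt0 ?subr_gt0 // mulrA mulVf ?gt_eqF //.
    by have := D0; lra.
  have : b / D * (2 `^ D - 1) <= b / D 
    by apply: ler_piMr; [apply: divr_ge0; exact: ltW|have := p2; lra].
  rewrite /k mulrDr; lra.
have -> : mass Gam x K - G (apex J) * h%:C = (mass Gam x K - G (apex K) * h%:C) +
   (G (apex K) - G (apex J)) * h%:C by ring.
apply: le_trans (cabsD _ _) _; rewrite cabsM cabsr (gtr0_norm h0).
by have := ler_wpM2r (ltW h0) E2; lra.
Qed.

(* The trapezoid average: the integral over s in [a, a + h] of the mass of
   [s, s + h], which has a bounded derivative in x, unlike the mass itself. *)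
Let T x : C := - (Gam2 (x +i* (J.1 + h + h)) - Gam2 (x +i* (J.1 + h)) -
  (Gam2 (x +i* (J.1 + h)) - Gam2 (x +i* J.1))).

Let T_slope x s : 0 < x -> path_derive
   (fun s => - (Gam2 (x +i* (s + h)) - Gam2 (x +i* s))) s (mass Gam x (s, h)).
Proof.
move=> x0 c; rewrite /mass /=.
have D2 : path_derive (fun s => Gam2 (x +i* (s + h))) s ('i * Gam (x +i* (s + h))).
  have E r : x +i* (r + h) = x +i* h + r%:C * 'i by simpc; rewrite addrC.
  rewrite mulrC E; move=> c'; under eq_fun do rewrite E.
  by apply: cdiff_path; apply: hGam2; rewrite -E.
have := path_deriveB (cdiff_vert (@hGam2 (x +i* s) x0)) D2 c.
under eq_fun do rewrite -opprB.
by congr (is_derive _ _ _ (Re (c * _))); ring.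
Qed.

Let T_ge x m : 0 < x -> (forall y, J.1 <= y <= J.1 + l -> m <= Re (G (x +i* y))) ->
  m * h * h <= Re (T x).
Proof.
move=> x0 H.
have h0 : 0 < h by rewrite divr_gt0.
have hh : h + h = l by rewrite /h; field.
have := @increment_le R (fun s => m * h * s) (fun=> m * h)
  (fun s => Re (1 * - (Gam2 (x +i* (s + h)) - Gam2 (x +i* s))))
  (fun s => Re (1 * mass Gam x (s, h))) J.1 (J.1 + h).
rewrite lerDl (ltW h0) => /(_ isT); rewrite !mul1r -ReN -ReD.
have -> : - (Gam2 (x +i* (J.1 + h + h)) - Gam2 (x +i* (J.1 + h))) -
   - (Gam2 (x +i* (J.1 + h)) - Gam2 (x +i* J.1)) = T x by rewrite /T; ring.
rewrite (_ : m * h * (J.1 + h) - m * h * J.1 = m * h * h); last by ring.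
apply => s /andP[s1 s2].
- exact: is_derive_linear.
- exact: T_slope.
- rewrite mul1r; apply: (@mass_ler R Gam G x (s, h) m hGam x0); rewrite /= ?(ltW h0) // => y /andP[y1 y2].
  by apply: H; have := hh; lra.
Qed.

(** Each window [s, s + h] lies in J, and the two remaining pieces of J have nonnegative mass
    because Re G > 0. *)
Let T_le x : 0 < x -> Re (T x) <= Re (mass Gam x J) * h.
Proof.
move=> x0.
have h0 : 0 < h by rewrite divr_gt0.
have hh : h + h = l by rewrite /h; field.
have := @increment_le R
  (fun s => Re (1 * - (Gam2 (x +i* (s + h)) - Gam2 (x +i* s))))
  (fun s => Re (1 * mass Gam x (s, h)))
  (fun s => Re (mass Gam x J) * s) (fun=> Re (mass Gam x J)) J.1 (J.1 + h).
rewrite lerDl (ltW h0) => /(_ isT); rewrite !mul1r -ReN -ReD.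
have -> : - (Gam2 (x +i* (J.1 + h + h)) - Gam2 (x +i* (J.1 + h))) -
   - (Gam2 (x +i* (J.1 + h)) - Gam2 (x +i* J.1)) = T x by rewrite /T; ring.
rewrite -mulrBr (_ : J.1 + h - J.1 = h); last by ring.
apply => s /andP[s1 s2].
- exact: T_slope.
- exact: is_derive_linear.
- rewrite mul1r.
  have M1 := @mass_ler R Gam G x (J.1, s - J.1) 0 hGam x0.
  have M2 := @mass_ler R Gam G x (s + h, J.1 + l - (s + h)) 0 hGam x0.
  rewrite !mul0r !subr_ge0 /= in M1 M2.
  have {}M1 : 0 <= Re (mass Gam x (J.1, s - J.1)).
    by apply: M1 => // y _; rewrite ltW // G0.
  have {}M2 : 0 <= Re (mass Gam x (s + h, J.1 + l - (s + h))).
    by apply: M2 => [|y _]; [have := hh; lra|rewrite ltW // G0].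
  have -> : mass Gam x J = mass Gam x (J.1, s - J.1) + mass Gam x (s, h) +
     mass Gam x (s + h, J.1 + l - (s + h)).
    by rewrite /mass /= !subrKC -/l; ring.
  by rewrite !ReD; lra.
Qed.

Let T_lip x e : 0 < x -> x <= e -> e <= h ->
  Re (T e) - b * (6 * k) * h * (e - x) <= Re (T x).
Proof.
move=> x0 xe eh.
have h0 : 0 < h by rewrite divr_gt0.
have hh : h + h = l by rewrite /h; field.
have : cabs (T e - T x) <= b * (6 * k) * h * e - b * (6 * k) * h * x.
  apply: (@path_increment R T (fun t => - (Gam (t +i* (J.1 + h + h)) -
     Gam (t +i* (J.1 + h)) - (Gam (t +i* (J.1 + h)) - Gam (t +i* J.1))))
     (fun t => b * (6 * k) * h * t) (fun=> b * (6 * k) * h)) => // t /andP[xt te].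
  - have t0 := lt_le_trans x0 xt.
    have P y := cdiff_horiz (@hGam2 (t +i* y) t0).
    have := path_deriveB (path_deriveB (P (J.1 + h)) (P J.1))
       (path_deriveB (P (J.1 + h + h)) (P (J.1 + h))).
    move=> PD c; have := PD c; rewrite /T; under [X in is_derive _ _ X _ -> _]eq_fun do rewrite -opprB.
    by rewrite -opprB.
  - exact: is_derive_linear.
  - have t0 := lt_le_trans x0 xt.
    have th : t <= h := le_trans te eh.
    have L := half_mass_estimate (or_introl erefl) t0 th.
    have Rr := half_mass_estimate (or_intror erefl) t0 th.
    have -> : - (Gam (t +i* (J.1 + h + h)) - Gam (t +i* (J.1 + h)) -
       (Gam (t +i* (J.1 + h)) - Gam (t +i* J.1))) = 'i * (
         (mass Gam t (left_half J) - G (apex J) * h%:C) -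
         (mass Gam t (right_half J) - G (apex J) * h%:C)).
      rewrite /mass /left_half /right_half /= -/l -/h.
      have i2 : 'i * 'i = -1 :> C by simpc.
      move: (Gam (t +i* J.1)) (Gam (t +i* (J.1 + h))) (Gam (t +i* (J.1 + h + h))) => p q r.
      rewrite [RHS](_ : _ = - ('i * 'i) * ((q - p) - (r - q))); last by ring.
      by rewrite i2; ring.
    rewrite cabsM cabsi mul1r; apply: le_trans (cabsD _ _) _; rewrite cabsN.
    lra.
move/(le_trans (Re_le_cabs _)); rewrite ReD ReN; lra.
Qed.

(** The error in [mass_le_of_pos] may exceed the main term, so it gives no lower bound. Instead, at
    height e l the pointwise bound makes the trapezoid average at least a multiple of e^D, and the
    descent to height x costs at most a multiple of e. Since D < 1 the former wins for small e; the
    last hypothesis is this comparison. *)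
Lemma mass_ge_of_pos x e : 0 < x -> x <= e * l -> 0 < e <= 1 / 2 ->
  12 * D * expR 1 ^+ 2 * k * e <= e `^ D / 4 ->
  expR (-1) / 4 * e `^ D * l * u <= Re (mass Gam x J).
Proof.
move=> x0 xe /andP[e0 e2] He.
have h0 : 0 < h by rewrite divr_gt0.
have hh : h + h = l by rewrite /h; field.
have el0 : 0 < e * l by rewrite mulr_gt0.
have elh : e * l <= h by rewrite /h mulrC ler_pM2l //; lra.
have B1 : expR (-1) * u * e `^ D * h * h <= Re (T (e * l)).
  apply: T_ge => // y yy.
  have := @ReG_ge (e * l) y; rewrite el0 (le_trans elh) /=; last by have := hh; lra.
  move=> /(_ isT yy); rewrite powRM ?(ltW e0) ?(ltW l0) // (_ : l `^ (- D) * _ = e `^ D) //.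
  by rewrite mulrCA (mulrC (l `^ (- D))) powRNr // mulr1.
have B2 := T_lip x0 xe elh.
have B3 := T_le x0.
have k0 : 0 < k by rewrite addr_gt0 // divr_gt0 // mulr_gt0 // subr_gt0.
rewrite -(ler_pM2r h0); apply: le_trans B3; apply: le_trans _ B2.
apply: le_trans (_ : expR (-1) * u * e `^ D * h * h - b * (6 * k) * h * (e * l) <= _); last first.
  have : b * (6 * k) * h * (e * l - x) <= b * (6 * k) * h * (e * l).
    apply: ler_wpM2l; last by rewrite gerBl ltW.
    apply: mulr_ge0; last exact: ltW.
    by apply: mulr_ge0; [exact: ltW|rewrite mulr_ge0 ?(ltW k0)].
  lra.
rewrite -hh /b.
have E1 : expR (-1) * expR 1 = 1 :> R by rewrite expRN mulVf // gt_eqF // expR_gt0.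
have hp : 0 < expR (-1) * u * h * h.
  by rewrite mulr_gt0 // mulr_gt0 // mulr_gt0 // expR_gt0.
have : 0 <= expR (-1) * u * h * h * (e `^ D / 4 - 12 * D * expR 1 ^+ 2 * k * e).
  by rewrite pmulr_rge0 // subr_ge0.
have -> : expR (-1) * u * h * h * (e `^ D / 4 - 12 * D * expR 1 ^+ 2 * k * e) =
   expR (-1) * u * h * h * e `^ D / 4 - 12 * D * (expR (-1) * expR 1) * expR 1 * k * e * u * h * h.
  by ring.
rewrite E1.
have : 0 <= expR (-1) * u * h * h * e `^ D.
  by rewrite pmulr_rge0 // powR_ge0.
have -> : expR (-1) / 4 * e `^ D * (h + h) * u * h = expR (-1) * u * h * h * e `^ D / 2 by field.
have -> : D * expR 1 * u * (6 * k) * h * (e * (h + h)) =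
   12 * D * 1 * expR 1 * k * e * u * h * h by ring.
have -> : expR (-1) * u * e `^ D * h * h = expR (-1) * u * h * h * e `^ D by ring.
lra.
Qed.

End Bounds.

Lemma positive_mass_bounds (D : R) : 0 < D < 1 -> exists Cu cl e : R,
  [/\ 1 <= Cu, 0 < cl, 0 < e, e <= 1 & forall G dG Gam : C -> C,
    hol G dG -> hol Gam G -> (forall z, 0 < Re z -> 0 < Re (G z)) ->
    (forall z, 0 < Re z -> cabs (dG z) <= D * Re (G z) / Re z) ->
    forall (J : arc) (x : R), 0 < x -> 0 < J.2 ->
    (x <= J.2 -> Re (mass Gam x J) <= Cu * (J.2 * Re (G (apex J)))) /\
    (x <= e * J.2 -> cl * (J.2 * Re (G (apex J))) <= Re (mass Gam x J))].
Proof.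
move=> /andP[D0 D1].
pose k := 2 / (D * (1 - D)) + 1.
have sD : 0 < 1 - D by rewrite subr_gt0.
have k0 : 0 < k by rewrite addr_gt0 // divr_gt0 // mulr_gt0.
pose q := 48 * D * expR 1 ^+ 2 * k.
have q0 : 0 < q by rewrite !mulr_gt0 // ?exprn_gt0 ?expR_gt0.
pose kap := Num.min (1 / 2) q^-1.
have kap0 : 0 < kap by rewrite lt_min invr_gt0 q0 divr_gt0.
have kap2 : kap <= 1 / 2 by rewrite ge_min lexx.
have kapq : kap <= q^-1 by rewrite ge_min lexx orbT.
(* Chosen so that e^(1 - D) = kap <= 1 / q, which amounts to q e <= e^D. *)
pose e := kap `^ (1 - D)^-1.
have e0 : 0 < e by exact: powR_gt0.
have ek : e <= kap.
  by apply: ge1r_powR; [rewrite kap0 (le_trans kap2) //; lra|rewrite invf_ge1 //; lra].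
have eD : e `^ (1 - D) = kap by rewrite -powRrM mulVf ?gt_eqF // powRr1 // ltW.
have He : 12 * D * expR 1 ^+ 2 * k * e <= e `^ D / 4.
  have E : e = e `^ D * kap.
    by rewrite -eD -powRD ?subrKC ?powRr1 ?ltW // (gt_eqF e0) implybT.
  have : q * e <= e `^ D.
    by rewrite {1}E mulrCA ger_pMr ?powR_gt0 // -(mulfV (lt0r_neq0 q0)) ler_pM2l.
  by rewrite /q; lra.
exists (1 + D * expR 1 * k), (expR (-1) / 4 * e `^ D), e; split.
- by rewrite lerDl !mulr_ge0 ?expR_ge0 ?(ltW k0) ?(ltW D0).
- by rewrite mulr_gt0 ?divr_gt0 ?expR_gt0 ?powR_gt0.
- exact: e0.
- by apply: le_trans ek _; apply: le_trans kap2 _; lra.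
move=> G dG Gam hG hGam G0 dG_le J x x0 l0; split=> [xl|xe].
  have := mass_le_of_pos D0 D1 hG hGam G0 dG_le l0 x0 xl.
  rewrite -/k => /(le_trans (Re_le_cabs _)); rewrite ReD ReN (mulrC (G _)) Re_realM.
  by move=> H; lra.
have [Gam2 hGam2] := primitive hGam.
have := mass_ge_of_pos D0 D1 hG hGam hGam2 G0 dG_le l0 x0 xe _ He.
rewrite e0 (le_trans ek kap2) => /(_ isT) H; rewrite mulrA; exact: H.
Qed.

End PositiveRealPart.

(** * The bisection tree with a stopping rule *)

Section StoppedTree.
Variable R : realType.
Local Notation arc := (R * R)%type.
Variable stop : pred arc.
Implicit Types (J K : arc) (n : nat).

(** The arcs stopped within n bisections; [rest] collects the arcs of generation n that are still
    running. An arc is tested before it is bisected, so a stopped root is its own single leaf. *)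
Fixpoint leaves n J : seq arc :=
  if stop J then [:: J] else
  if n is m.+1 then leaves m (left_half J) ++ leaves m (right_half J) else [::].

Fixpoint rest n J : seq arc :=
  if stop J then [::] else
  if n is m.+1 then rest m (left_half J) ++ rest m (right_half J) else [:: J].

Lemma tree_additive (V : zmodType) (Lam : arc -> V) n J :
  (forall K, Lam K = Lam (left_half K) + Lam (right_half K)) ->
  Lam J = \sum_(K <- leaves n J) Lam K + \sum_(K <- rest n J) Lam K.
Proof.
move=> H; elim: n J => [|n IH] J /=; case: (stop J).
- by rewrite big_seq1 big_nil addr0.
- by rewrite big_seq1 big_nil add0r.
- by rewrite big_seq1 big_nil addr0.
- by rewrite !big_cat /= addrACA -!IH -H.
Qed.

Lemma leaves_superadditive (Lam : arc -> R) n J :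
  (forall K, 0 <= K.2 -> 0 <= Lam K) ->
  (forall K, 0 <= K.2 -> Lam (left_half K) + Lam (right_half K) <= Lam K) ->
  0 <= J.2 -> \sum_(K <- leaves n J) Lam K <= Lam J.
Proof.
move=> H0 H; elim: n J => [|n IH] J l0 /=; case: (stop J);
  rewrite ?big_seq1 ?big_nil ?H0 // big_cat /=.
have l2 : 0 <= J.2 / 2 by rewrite divr_ge0.
by apply: le_trans (H J l0); apply: lerD; exact: IH.
Qed.

Lemma leaves_ind (P : arc -> arc -> Prop) :
  (forall J, stop J -> P J J) ->
  (forall J K, ~~ stop J -> P (left_half J) K -> P J K) ->
  (forall J K, ~~ stop J -> P (right_half J) K -> P J K) ->
  forall n J K, K \in leaves n J -> P J K.
Proof.
move=> P0 Pl Pr; elim=> [|n IH] J K /=; case: ifPn => sJ.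
- by rewrite inE => /eqP ->; exact: P0.
- by rewrite in_nil.
- by rewrite inE => /eqP ->; exact: P0.
- by rewrite mem_cat => /orP[] /IH; [exact: Pl|exact: Pr].
Qed.

Lemma rest_ind (P : arc -> arc -> Prop) :
  (forall J, ~~ stop J -> P J J) ->
  (forall J K, ~~ stop J -> P (left_half J) K -> P J K) ->
  (forall J K, ~~ stop J -> P (right_half J) K -> P J K) ->
  forall n J K, K \in rest n J -> P J K.
Proof.
move=> P0 Pl Pr; elim=> [|n IH] J K /=; case: ifPn => sJ.
- by rewrite in_nil.
- by rewrite inE => /eqP ->; exact: P0.
- by rewrite in_nil.
- by rewrite mem_cat => /orP[] /IH; [exact: Pl|exact: Pr].
Qed.

Lemma rest_stop n J K : K \in rest n J -> ~~ stop K.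
Proof. by move: n J K; apply: (@rest_ind (fun _ K => ~~ stop K)). Qed.

Lemma leaves_stop n J K : K \in leaves n J -> stop K.
Proof. by move: n J K; apply: (@leaves_ind (fun _ K => stop K)). Qed.

Lemma rest_length n J K : K \in rest n J -> K.2 = J.2 / 2 ^+ n.
Proof.
elim: n J K => [|n IH] J K /=; case: ifP => _; rewrite ?in_nil //.
  by rewrite inE => /eqP ->; rewrite expr0 divr1.
by rewrite mem_cat => /orP[] /IH ->; rewrite /= exprS invfM mulrA.
Qed.

Lemma leaves_length n J K : 0 <= J.2 -> K \in leaves n J -> J.2 / 2 ^+ n <= K.2.
Proof.
elim: n J K => [|n IH] J K l0 /=; case: ifP => _; rewrite ?in_nil ?inE //.
- by move/eqP ->; rewrite expr0 divr1.
- move/eqP ->; rewrite ler_pdivrMr ?exprn_gt0 // ler_peMr //.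
  by rewrite exprn_ege1 // ler1n.
- have l2 : 0 <= J.2 / 2 by rewrite divr_ge0.
  by rewrite mem_cat exprS invfM mulrA => /orP[] /IH; apply.
Qed.

Lemma leaves_sub n J K : 0 <= J.2 -> K \in leaves n J ->
  [/\ J.1 <= K.1, K.1 + K.2 <= J.1 + J.2 & K.2 <= J.2].
Proof.
move=> l0 KJ.
suff : 0 <= J.2 -> [/\ 0 <= K.2, J.1 <= K.1, K.1 + K.2 <= J.1 + J.2 & K.2 <= J.2].
  by case/(_ l0).
move: n J K KJ {l0}; apply: leaves_ind => [J _ l0|J K _ H l0|J K _ H l0]; first by [].
  have l2 : 0 <= J.2 / 2 by rewrite divr_ge0.
  by have [h0 h1 h2 h3] := H l2; rewrite /= in h0 h1 h2 h3; split; lra.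
have l2 : 0 <= J.2 / 2 by rewrite divr_ge0.
by have [h0 h1 h2 h3] := H l2; rewrite /= in h0 h1 h2 h3; split; lra.
Qed.

Lemma leaves_gt0 n J K : 0 < J.2 -> K \in leaves n J -> 0 < K.2.
Proof.
move=> l0 /leaves_length -/(_ (ltW l0)); apply: lt_le_trans.
by rewrite divr_gt0 ?exprn_gt0.
Qed.

(** The union of the arcs in [rest], as a set to which Lebesgue measure applies; half-open arcs make
    the two halves disjoint. *)
Fixpoint rest_set n J : set R :=
  if stop J then set0 else
  if n is m.+1 then rest_set m (left_half J) `|` rest_set m (right_half J)
  else `[J.1, J.1 + J.2[%classic.

Lemma rest_set_sub n J : 0 <= J.2 -> rest_set n J `<=` `[J.1, J.1 + J.2[%classic.
Proof.
elim: n J => [|n IH] J l0 /=; case: ifP => _ //.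
have l2 : 0 <= J.2 / 2 by rewrite divr_ge0.
move=> y [] /IH - /(_ l2) /=; rewrite !in_itv /=; lra.
Qed.

Lemma rest_setP n J y : 0 <= J.2 -> rest_set n J y ->
  exists2 K, K \in rest n J & K.1 <= y < K.1 + K.2.
Proof.
elim: n J => [|n IH] J l0 /=; case: ifP => _ //.
  by move=> yJ; exists J; [rewrite inE|move: yJ; rewrite /= in_itv].
have l2 : 0 <= J.2 / 2 by rewrite divr_ge0.
by case=> /IH - /(_ l2) [K KJ yK]; exists K => //; rewrite mem_cat KJ ?orbT.
Qed.

Lemma measurable_rest_set n J : measurable (rest_set n J).
Proof.
elim: n J => [|n IH] J /=; case: ifP => _ //.
exact: measurableU.
Qed.

Lemma rest_set_mono n J : 0 <= J.2 -> rest_set n.+1 J `<=` rest_set n J.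
Proof.
elim: n J => [|n IH] J l0.
  move=> y H; have := rest_set_sub l0 H; move: H => /=.
  by case: ifP.
have l2 : 0 <= J.2 / 2 by rewrite divr_ge0.
rewrite [rest_set n.+2 J]/= [rest_set n.+1 J]/=; case: ifP => _ //.
by apply: setUSS; apply: IH.
Qed.

Lemma measure_rest_set n J : 0 <= J.2 ->
  lebesgue_measure (rest_set n J) = (\sum_(K <- rest n J) K.2)%:E.
Proof.
elim: n J => [|n IH] J l0 /=; case: ifP => _; rewrite ?big_nil ?measure0 ?big_seq1 //.
  rewrite lebesgue_measure_itv /= lte_fin ltrDl.
  case: ltP => [_|l0']; first by rewrite -EFinB addrAC subrr add0r.
  by congr (_%:E); apply/eqP; rewrite eq_le l0 l0'.
have l2 : 0 <= J.2 / 2 by rewrite divr_ge0.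
rewrite measureU; [|exact: measurable_rest_set|exact: measurable_rest_set|].
  by rewrite big_cat /= EFinD -!IH.
apply/seteqP; split=> // y [yl yr].
have := @rest_set_sub n (left_half J) l2 y yl.
have := @rest_set_sub n (right_half J) l2 y yr.
by rewrite /= !in_itv /=; lra.
Qed.

(** Continuity of Lebesgue measure from above along the decreasing sets [rest_set n J]. *)
Lemma rest_small J (nu : R) : 0 <= J.2 -> 0 < nu ->
  (@lebesgue_measure R).-negligible (\bigcap_n rest_set n J) ->
  exists n, \sum_(K <- rest n J) K.2 <= nu.
Proof.
move=> l0 nu0 N.
have mcap : measurable (\bigcap_n rest_set n J).
  by apply: bigcapT_measurable => n; exact: measurable_rest_set.
have cap0 : lebesgue_measure (\bigcap_n rest_set n J) = 0%E.
  exact: measure_negligible.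
have cv : (lebesgue_measure \o (fun n => rest_set n J)) @ \oo -->
    lebesgue_measure (\bigcap_n rest_set n J).
  apply: nonincreasing_cvg_mu => //.
  - have := ltry (\sum_(K <- rest 0 J) K.2).
    by rewrite -(measure_rest_set 0 l0).
  - by move=> n; exact: measurable_rest_set.
  - move=> m n mn; apply/subsetPset.
    elim: n mn => [|n IH]; first by rewrite leqn0 => /eqP ->.
    rewrite leq_eqVlt => /orP[/eqP -> //|]; rewrite ltnS => /IH.
    by apply: subset_trans; exact: rest_set_mono.
rewrite cap0 in cv.
move/fine_cvgP: cv => [_ /cvgrPdist_le /(_ nu nu0)] [n _ /(_ n (leqnn n))] /=.
rewrite sub0r normrN => H; exists n; apply: le_trans H.
have := ler_norm (fine (\sum_(K <- rest n J) K.2)%:E).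
by rewrite {2}(_ : (\sum_(K <- rest n J) K.2)%:E = lebesgue_measure (rest_set n J)) // measure_rest_set.
Qed.

End StoppedTree.

(** * Disc automorphisms and Cayley transforms *)

Section Mobius.
Variable R : realType.
Local Notation C := R[i].
Implicit Types (F dF g dg G dG : C -> C) (z w c : C).

Lemma cdiff_comp (H G : C -> C) z (d d' : C) : cdiff G z d -> cdiff H (G z) d' ->
  cdiff (fun u => H (G u)) z (d' * d).
Proof.
move=> hG hH e e0.
pose k1 := cabs d' + 1; pose k2 := cabs d + 1.
have k10 : 0 < k1 by rewrite ltr_wpDl ?cabs_ge0.
have k20 : 0 < k2 by rewrite ltr_wpDl ?cabs_ge0.
have [d1 d10 B1] := hH (e / (2 * k2)) (divr_gt0 e0 (mulr_gt0 (ltr0n _ 2) k20)).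
have [d2 d20 B2] := hG _ (divr_gt0 e0 (mulr_gt0 (ltr0n _ 2) k10)).
have [d3 d30 B3] := hG _ ltr01.
exists (Num.min (d1 / k2) (Num.min d2 d3)); first by rewrite !lt_min divr_gt0 // d20 d30.
move=> h; rewrite !lt_min => /and3P[h1 h2 h3].
set k := G (z + h) - G z.
have kle : cabs k <= k2 * cabs h.
  rewrite (_ : k = (k - d * h) + d * h); last by ring.
  apply: le_trans (cabsD _ _) _; rewrite cabsM /k2.
  by have := B3 h h3; rewrite -/k; lra.
have kd : cabs k < d1 by apply: le_lt_trans kle _; rewrite mulrC -ltr_pdivlMr.
have E : G (z + h) = G z + k by rewrite /k; ring.
rewrite E (_ : _ - _ = (H (G z + k) - H (G z) - d' * k) + d' * (k - d * h)); last by ring.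
apply: le_trans (cabsD _ _) _; rewrite cabsM.
have A1 : cabs (H (G z + k) - H (G z) - d' * k) <= e / 2 * cabs h.
  apply: le_trans (B1 _ kd) _.
  apply: le_trans (ler_wpM2l _ kle) _; first by rewrite divr_ge0 ?mulr_ge0 ?ltW.
  by apply: le_of_eq; field; rewrite gt_eqF.
have A2 : cabs d' * cabs (k - d * h) <= e / 2 * cabs h.
  apply: le_trans (_ : k1 * (e / (2 * k1) * cabs h) <= _); last first.
    by apply: le_of_eq; field; rewrite gt_eqF.
  by apply: ler_pM; rewrite ?cabs_ge0 ?lerDl // B2.
lra.
Qed.

Lemma cdiff_sqr w : cdiff (fun u => u ^+ 2) w (2 * w).
Proof.
move=> e e0; exists e => // h he.
rewrite (_ : _ - _ = h * h); last by ring.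
by rewrite cabsM ler_wpM2r ?cabs_ge0 // ltW.
Qed.

Lemma cdiff_mobius (a b p q w : C) : p * w + q != 0 ->
  cdiff (fun u => (a * u + b) / (p * u + q)) w ((a * q - b * p) / (p * w + q) ^+ 2).
Proof.
move=> n0 e e0; set N := p * w + q; set Del := a * q - b * p.
have N0 : 0 < cabs N by rewrite cabs_gt0.
pose k := 2 * cabs Del * cabs p / cabs N ^+ 3 + 1.
have k0 : 0 < k.
  by rewrite ltr_wpDl // divr_ge0 ?exprn_ge0 ?mulr_ge0 ?cabs_ge0.
pose m := cabs N / (2 * (cabs p + 1)).
have p0 : 0 < cabs p + 1 by rewrite ltr_wpDl ?cabs_ge0.
have m0 : 0 < m by rewrite divr_gt0 // mulr_gt0.
exists (Num.min m (e / k)); first by rewrite lt_min m0 divr_gt0.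
move=> h; rewrite lt_min => /andP[hm hk].
have hp : cabs (p * h) <= cabs N / 2.
  rewrite cabsM; apply: le_trans (_ : (cabs p + 1) * m <= _).
    by apply: ler_pM; rewrite ?cabs_ge0 ?lerDl // ltW.
  by rewrite /m; apply: le_of_eq; field; rewrite gt_eqF.
have N2 : cabs N / 2 <= cabs (N + p * h).
  have := cabs_leB N (- (p * h)); rewrite opprK cabsN; lra.
have N20 : 0 < cabs (N + p * h) by apply: lt_le_trans N2; rewrite divr_gt0.
have n20 : N + p * h != 0 by rewrite -cabs_gt0.
rewrite (_ : _ - _ = - (Del * p * h * h / (N ^+ 2 * (N + p * h)))); last first.
  have n3 : p * (w + h) + q != 0.
    by rewrite (_ : p * (w + h) + q = N + p * h) //; rewrite /N; ring.
  rewrite /N in n0 n20 *; by rewrite /Del; field; rewrite ?n0 ?n3 ?n20.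
rewrite cabsN !cabsM cabsV !cabsM ler_pdivrMr; last first.
  by rewrite !mulr_gt0 // exprn_gt0.
rewrite -expr2.
have hk2 : cabs h * k <= e by rewrite -ler_pdivlMr // ltW.
apply: le_trans (_ : (cabs h * k) * cabs h * (cabs N ^+ 2 * cabs (N + p * h)) <= _).
  rewrite [X in _ <= X](_ : _ = cabs h * cabs h * (k * cabs N ^+ 2 * cabs (N + p * h))); last by ring.
  rewrite [X in X <= _](_ : _ = cabs h * cabs h * (cabs Del * cabs p)); last by ring.
  rewrite ler_wpM2l ?mulr_ge0 ?cabs_ge0 //.
  apply: le_trans (_ : k * cabs N ^+ 2 * (cabs N / 2) <= _); last first.
    by rewrite ler_wpM2l // mulr_ge0 ?exprn_ge0 ?cabs_ge0 ?(ltW k0).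
  rewrite /k [X in _ <= X](_ : _ = cabs Del * cabs p + cabs N ^+ 3 / 2); last first.
    by field; rewrite gt_eqF.
  by rewrite lerDl divr_ge0 ?exprn_ge0 ?cabs_ge0.
by rewrite !ler_wpM2r ?mulr_ge0 ?exprn_ge0 ?cabs_ge0.
Qed.

(** The identity behind every formula below for 1 - |.|^2 under a disc automorphism. *)
Lemma mobius_norm w z :
  cabs (1 + w^* * z) ^+ 2 - cabs (z + w) ^+ 2 = (1 - cabs w ^+ 2) * (1 - cabs z ^+ 2).
Proof. by rewrite !cabs_sqr !(ReD, ImD, ReM, ImM, Re_conj, Im_conj) /=; ring. Qed.

Lemma one_sub_neq0 c z : cabs c < 1 -> cabs z <= 1 -> 1 - c * z != 0.
Proof.
move=> c1 z1; rewrite -cabs_gt0; have := cabs_leB 1 (c * z).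
rewrite cabs1 cabsM => H; apply: lt_le_trans H; rewrite subr_gt0.
by apply: le_lt_trans c1; rewrite ler_piMr ?cabs_ge0.
Qed.

Lemma one_subr_sqr_gt0 z : cabs z < 1 -> 0 < 1 - cabs z ^+ 2.
Proof. by move=> z1; rewrite subr_gt0 expr_lt1 ?cabs_ge0. Qed.

Definition mob w z : C := (z - w) / (1 - w^* * z).

Lemma mob_norm w z : cabs w < 1 -> cabs z < 1 ->
  1 - cabs (mob w z) ^+ 2 =
    (1 - cabs w ^+ 2) * (1 - cabs z ^+ 2) / cabs (1 - w^* * z) ^+ 2.
Proof.
move=> w1 z1.
have n0 : 1 - w^* * z != 0 by apply: one_sub_neq0; rewrite ?cabs_conj // ltW.
have N0 : 0 < cabs (1 - w^* * z) by rewrite cabs_gt0.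
have := mobius_norm (- w) z; rewrite rmorphN mulNr cabsN => <-.
rewrite /mob cabsM cabsV exprMn; field; rewrite gt_eqF //.
Qed.

Lemma mobK w z : cabs w < 1 -> cabs z < 1 ->
  z = (mob w z + w) / (1 + w^* * mob w z).
Proof.
move=> w1 z1.
have n0 : 1 - w^* * z != 0 by apply: one_sub_neq0; rewrite ?cabs_conj // ltW.
have q0 : 1 - w^* * w != 0 by apply: one_sub_neq0; rewrite ?cabs_conj // ltW.
rewrite /mob; field; rewrite n0 /=.
rewrite (_ : _ + _ = 1 - w^* * w) //; ring.
Qed.

Lemma mob_lt1 w z : cabs w < 1 -> cabs z < 1 -> cabs (mob w z) < 1.
Proof.
move=> w1 z1; have E := mob_norm w1 z1.
have n0 : 1 - w^* * z != 0 by apply: one_sub_neq0; rewrite ?cabs_conj // ltW.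
have : 0 < 1 - cabs (mob w z) ^+ 2.
  rewrite E divr_gt0 //; last by rewrite exprn_gt0 // cabs_gt0.
  by rewrite mulr_gt0 // one_subr_sqr_gt0.
by rewrite subr_gt0 expr_lt1 ?cabs_ge0.
Qed.

Lemma mob_inv_norm w z : cabs w < 1 -> cabs z < 1 ->
  1 - cabs z ^+ 2 = (1 - cabs w ^+ 2) * (1 - cabs (mob w z) ^+ 2) /
    cabs (1 + w^* * mob w z) ^+ 2.
Proof.
move=> w1 z1; have m1 := mob_lt1 w1 z1.
have n0 : 1 + w^* * mob w z != 0.
  have := @one_sub_neq0 (- w^*) (mob w z).
  by rewrite mulNr opprK cabsN cabs_conj; apply => //; exact: ltW.
have N0 : 0 < cabs (1 + w^* * mob w z) by rewrite cabs_gt0.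
rewrite -mobius_norm {1}(mobK w1 z1) cabsM cabsV exprMn; field.
by rewrite gt_eqF.
Qed.

(** Disc automorphisms are hyperbolic isometries: the derivative and the defect both acquire the
    factor (1 - |w|^2) / |1 - w^* F|^2. *)
Lemma mob_contr D F dF w : 0 <= D -> cabs w < 1 -> hyp_contr D F dF ->
  exists dg, hyp_contr D (fun z => mob w (F z)) dg.
Proof.
move=> D0 w1 [hF F1 HD].
have n0 z : 0 < Re z -> - w^* * F z + 1 != 0.
  by move=> /F1 Fz; rewrite mulNr addrC; apply: one_sub_neq0; rewrite ?cabs_conj // ltW.
exists (fun z => (1 * 1 - (- w) * (- w^*)) / (- w^* * F z + 1) ^+ 2 * dF z); split.
- move=> z z0.
  have E : (fun u => mob w (F u)) = (fun u => (1 * F u + (- w)) / (- w^* * F u + 1)).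
    by apply/funext => u; rewrite /mob mul1r mulNr (addrC 1).
  rewrite E; exact: cdiff_comp (hF z z0) (cdiff_mobius 1 (- w) (n0 z z0)).
- by move=> z z0; apply: mob_lt1 => //; exact: F1.
move=> z z0; rewrite mob_norm ?F1 //.
have E1 : 1 * 1 - (- w) * (- w^*) = (1 - cabs w ^+ 2)%:C :> C.
  by rewrite rmorphB /= -conjM; ring.
rewrite E1 !cabsM cabsV cabsr.
have w0 := one_subr_sqr_gt0 w1.
rewrite (gtr0_norm w0) (_ : - w^* * F z + 1 = 1 - w^* * F z); last by ring.
have N0 : 0 < cabs (1 - w^* * F z).
  by rewrite cabs_gt0; have := n0 z z0; rewrite mulNr addrC.
rewrite !expr2 cabsM.
apply: le_trans (ler_wpM2l _ (HD z z0)) _.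
  by rewrite divr_ge0 ?(ltW w0) // mulr_ge0 // ltW.
by apply: le_of_eq; rewrite !expr2; field; rewrite !gt_eqF.
Qed.

Definition cayley c z : C := (1 + c * z) / (1 - c * z).

Lemma Re_cayley c z : cabs c < 1 -> cabs z <= 1 ->
  Re (cayley c z) = (1 - cabs (c * z) ^+ 2) / cabs (1 - c * z) ^+ 2.
Proof.
move=> c1 z1; have n0 := one_sub_neq0 c1 z1.
have N0 : 0 < cabs (1 - c * z) by rewrite cabs_gt0.
have -> : cayley c z = ((cabs (1 - c * z) ^+ 2)^-1)%:C * ((1 + c * z) * (1 - c * z)^*).
  rewrite fmorphV /= -conjM /cayley.
  have : (1 - c * z)^* != 0 by rewrite -cabs_gt0 cabs_conj cabs_gt0.
  move: (1 + c * z) (1 - c * z)^* (1 - c * z) n0 => a vb v n0 n1; field.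
  by rewrite n0 n1.
rewrite Re_realM mulrC; congr (_ / _).
by rewrite cabs_sqr !(ReD, ImD, ReM, ImM, Re_conj, Im_conj, ReN, ImN) /=; ring.
Qed.

(** After clearing denominators the derivative bound is |c| (1 - |g|^2) <= 1 - |c|^2 |g|^2, that is,
    (1 - |c|) (1 + |c| |g|^2) >= 0. *)
Lemma cayley_pos D g dg c : 0 <= D -> cabs c < 1 -> hyp_contr D g dg ->
  exists dG, [/\ hol (fun z => cayley c (g z)) dG,
    (forall z, 0 < Re z -> 0 < Re (cayley c (g z))) &
    forall z, 0 < Re z -> cabs (dG z) <= D * Re (cayley c (g z)) / Re z].
Proof.
move=> D0 c1 [hg g1 HD].
have n0 z : 0 < Re z -> - c * g z + 1 != 0.
  by move=> /g1 gz; rewrite mulNr addrC; apply: one_sub_neq0 => //; exact: ltW.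
have cg z : 0 < Re z -> cabs (c * g z) < 1.
  by move=> /g1 gz; rewrite cabsM mulr_ilt1 ?cabs_ge0.
have Rg z : 0 < Re z -> 0 < Re (cayley c (g z)).
  move=> z0; rewrite Re_cayley // ?ltW ?g1 //.
  rewrite divr_gt0 ?one_subr_sqr_gt0 ?cg // exprn_gt0 // cabs_gt0.
  by have := n0 z z0; rewrite mulNr addrC.
exists (fun z => (c * 1 - 1 * (- c)) / (- c * g z + 1) ^+ 2 * dg z); split => //.
- move=> z z0.
  have E : (fun u => cayley c (g u)) = (fun u => (c * g u + 1) / (- c * g u + 1)).
    by apply/funext => u; rewrite /cayley mulNr addrC (addrC 1).
  rewrite E; exact: cdiff_comp (hg z z0) (cdiff_mobius c 1 (n0 z z0)).
move=> z z0; rewrite (Re_cayley c1 (ltW (g1 z z0))).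
have N0 : 0 < cabs (1 - c * g z).
  by rewrite cabs_gt0; have := n0 z z0; rewrite mulNr addrC.
rewrite (_ : - c * g z + 1 = 1 - c * g z); last by ring.
rewrite (_ : c * 1 - 1 * - c = 2%:R%:C * c); last by rewrite rmorph_nat; ring.
rewrite !cabsM cabsV cabsr (ger0_norm (ler0n _ 2)) !expr2 !cabsM.
apply: le_trans (ler_wpM2l _ (HD z z0)) _.
  by rewrite divr_ge0 ?mulr_ge0 ?cabs_ge0.
rewrite [X in X <= _](_ : _ = D / (cabs (1 - c * g z) ^+ 2 * Re z) *
   (cabs c * (1 - cabs (g z) ^+ 2))); last by field; rewrite !gt_eqF.
rewrite [X in _ <= X](_ : _ = D / (cabs (1 - c * g z) ^+ 2 * Re z) *
   (1 - cabs c ^+ 2 * cabs (g z) ^+ 2)); last by field; rewrite !gt_eqF.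
rewrite ler_wpM2l ?divr_ge0 ?mulr_ge0 ?exprn_ge0 ?cabs_ge0 ?(ltW z0) //.
have := cabs_ge0 c; have := cabs_ge0 (g z); have := g1 z z0; have := c1.
move: (cabs c) (cabs (g z)) => p q p1 q1 q0 p0.
have : 0 <= (1 - p) * (1 + p * q ^+ 2).
  by apply: mulr_ge0; [lra|rewrite addr_ge0 // mulr_ge0 // sqr_ge0].
lra.
Qed.

End Mobius.

(** * The stopping rule and its geometry *)

Section Step.
Variable R : realType.
Local Notation C := R[i].
Local Notation arc := (R * R)%type.
Implicit Types (F dF g dg : C -> C) (J K : arc) (w z : C).

Definition radial_inner F : Prop :=
  {ae (@lebesgue_measure R), forall y : R, forall e : R, 0 < e ->
     exists2 eta : R, 0 < eta & forall x, 0 < x < eta -> 1 - e < cabs (F (x +i* y))}.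

(* Disjointness of the arcs T inside J, tested on superadditive functions of
   dyadic arcs: this is all that is needed of it, and it composes along trees. *)
Definition packed J (T : seq arc) : Prop := forall Lam : arc -> R,
  (forall K, 0 <= K.2 -> 0 <= Lam K) ->
  (forall K, 0 <= K.2 -> Lam (left_half K) + Lam (right_half K) <= Lam K) ->
  \sum_(K <- T) Lam K <= Lam J.

Definition defect F z : R := 1 - cabs (F z) ^+ 2.

(* Each passage from J to a child K moves F inward: the defect grows by the
   factor gam until it reaches the threshold q0; from then on it stays above q0
   at the apexes and above q1 on the rays between consecutive generations. *)
Definition step_ok F (c eps q0 gam q1 : R) J (T : seq arc) : Prop :=
  [/\ packed J T, c * J.2 <= \sum_(K <- T) K.2,
      forall K, K \in T -> [/\ 0 < K.2, K.2 <= eps * J.2, J.1 <= K.1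
        & K.1 + K.2 <= J.1 + J.2],
      forall K, K \in T -> Num.min q0 (gam * defect F (apex J)) <= defect F (apex K)
    & q0 <= defect F (apex J) -> forall K x y, K \in T -> K.2 <= x <= J.2 ->
        K.1 <= y <= K.1 + K.2 -> q1 <= defect F (x +i* y)].

Lemma expR_lnq (r : R) : 0 <= r < 1 -> expR (- lnq r) = (1 - r) / (1 + r).
Proof.
move=> /andP[r0 r1]; rewrite /lnq opprB expRD expRN !lnK ?posrE //; lra.
Qed.

Lemma lnq0 : lnq (0 : R) = 0.
Proof. by rewrite /lnq addr0 subr0 subrr. Qed.

Lemma lnq_le_imp (r b : R) : 0 <= r < 1 -> lnq r <= b -> expR (- b) <= 1 - r.
Proof.
move=> r01 rb; apply: le_trans (_ : expR (- lnq r) <= _).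
  by rewrite ler_expR lerN2.
have /andP[r0 r1] := r01; rewrite expR_lnq // ler_pdivrMr; last lra.
by rewrite ler_peMr; lra.
Qed.

Lemma ln2_le1 : ln 2 <= 1 :> R.
Proof. by have := @le_ln1Dx R 1; rewrite (_ : 1 + 1 = 2) //; apply; lra. Qed.

(** In the formula of [mob_inv_norm] the denominator is at most 4, and 1 - |g|^2 >= 1 - |g|. *)
Lemma defect_mob_ge F w z (a : R) : cabs w < 1 -> cabs (F z) < 1 ->
  a <= 1 - cabs (mob w (F z)) -> 0 <= a ->
  (1 - cabs w ^+ 2) * a / 4 <= defect F z.
Proof.
move=> w1 Fz am a0; rewrite /defect (mob_inv_norm w1 Fz).
set g := mob w (F z) in am *.
have g1 : cabs g < 1 by exact: mob_lt1.
have w0 := one_subr_sqr_gt0 w1.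
have n0 : 0 < cabs (1 + w^* * g).
  have := @one_sub_neq0 R (- w^*) g.
  by rewrite mulNr opprK cabsN cabs_conj cabs_gt0; apply => //; exact: ltW.
have n2 : cabs (1 + w^* * g) <= 2.
  apply: le_trans (cabsD _ _) _; rewrite cabs1 cabsM cabs_conj.
  have : cabs w * cabs g <= 1 by rewrite mulr_ile1 ?cabs_ge0 ?ltW.
  lra.
rewrite ler_pdivlMr ?exprn_gt0 //.
have ag : a <= 1 - cabs g ^+ 2.
  by have := cabs_ge0 g; nra.
have n4 : cabs (1 + w^* * g) ^+ 2 <= 4.
  rewrite (_ : 4 = 2 ^+ 2); last by ring.
  by rewrite ler_pXn2r ?nnegrE // ltW.
rewrite mulrAC ler_pdivrMr //.
apply: le_trans (_ : (1 - cabs w ^+ 2) * a * 4 <= _).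
  by apply: ler_wpM2l n4; apply: mulr_ge0 => //; exact: ltW.
by rewrite ler_pM2r // ler_pM2l.
Qed.

Section Stopping.
Variables (D : R) (F dF : C -> C) (w : C) (del : R).
Hypotheses (D0 : 0 < D) (D1 : D < 1) (HF : hyp_contr D F dF) (w1 : cabs w < 1).
Hypotheses (del0 : 0 < del) (del1 : del < 1).

Let g z := mob w (F z).
Definition far : pred arc := fun K => del <= cabs (mob w (F (apex K))).

Let F1 z : 0 < Re z -> cabs (F z) < 1. Proof. by have [_ H _] := HF; exact: H. Qed.
Let g1 z : 0 < Re z -> 0 <= cabs (g z) < 1.
Proof. by move=> z0; rewrite cabs_ge0 mob_lt1 // F1. Qed.

Let Hg : exists dg, hyp_contr D g dg.
Proof. exact: mob_contr (ltW D0) w1 HF. Qed.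

Lemma g_lip t l y y' : 0 < t -> t <= l ->
  `|lnq (cabs (g (t +i* y))) - lnq (cabs (g (l +i* y')))| <=
    D * (ln l - ln t + `|y - y'| / l).
Proof. by have [dg H] := Hg; exact: (hyp_contr_le y y' (ltW D0) H). Qed.

(** A point over the leaf K, at a height between the lengths of K and J, lies in the upper half of
    the square over an unstopped ancestor of K. Its hyperbolic distance to the apex of that
    ancestor, where |g| < del, is at most ln 2 + 1 <= 2. *)
Lemma ray_lnq n J K x y : 0 < J.2 -> ~~ far J -> K \in leaves far n J ->
  K.2 <= x <= J.2 -> K.1 <= y <= K.1 + K.2 ->
  lnq (cabs (g (x +i* y))) <= lnq del + 2 * D.
Proof.
move=> l0 nJ KJ.
(* The alternative with [far J] and K = J serves the base of the induction, where K has no proper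
   ancestor in the tree. *)
pose P J K := 0 < J.2 ->
  [/\ 0 < K.2, K.2 <= J.2, J.1 <= K.1 & K.1 + K.2 <= J.1 + J.2] /\
  ((far J /\ K = J) \/ (forall x y, K.2 <= x <= J.2 -> K.1 <= y <= K.1 + K.2 ->
    lnq (cabs (g (x +i* y))) <= lnq del + 2 * D)).
suff : P J K.
  case/(_ l0) => _ [[fJ _]|H xx yy]; first by rewrite fJ in nJ.
  exact: H.
move: n J K KJ {l0 nJ x y}.
have near J x y : 0 < J.2 -> ~~ far J -> J.2 / 2 <= x <= J.2 ->
    J.1 <= y <= J.1 + J.2 -> lnq (cabs (g (x +i* y))) <= lnq del + 2 * D.
  move=> l0 nJ /andP[x1 x2] /andP[y1 y2].
  have x0 : 0 < x by apply: lt_le_trans x1; rewrite divr_gt0.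
  have := g_lip y J.1 x0 x2; rewrite ler_norml => /andP[_ H].
  have gJ : lnq (cabs (g (apex J))) <= lnq del.
    have /andP[g0 _] := @g1 (apex J) l0.
    apply: lnq_mono => //; first by lra.
    by move: nJ; rewrite /far -ltNge => /ltW.
  have lnx : ln J.2 - ln x <= 1.
    apply: le_trans ln2_le1; rewrite lerBlDr -lnM ?posrE // ler_ln ?posrE ?mulr_gt0 //; lra.
  have yl : `|y - J.1| / J.2 <= 1.
    by rewrite ler_pdivrMr // mul1r ger0_norm; lra.
  have : D * (ln J.2 - ln x + `|y - J.1| / J.2) <= D * 2 by rewrite ler_pM2l //; lra.
  rewrite -/(apex J) in H; lra.
have up J K h : ~~ far J -> h.2 = J.2 / 2 ->
    (0 < J.2 -> J.1 <= h.1 /\ h.1 + h.2 <= J.1 + J.2) -> P h K -> P J K.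
  move=> nJ hJ hh IH l0; have [h1 h2] := hh l0.
  have l2 : 0 < h.2 by rewrite hJ divr_gt0.
  have [[k0 k1 k2 k3] H] := IH l2.
  split; first by split => //; lra.
  right=> x y /andP[x1 x2] /andP[y1 y2].
  have [xl|xl] := leP (J.2 / 2) x.
    by apply: (near J) => //; [rewrite xl|apply/andP; split; lra].
  case: H => [[_ E]|H]; first by rewrite E in x1; lra.
  by apply: H; [rewrite x1 hJ ltW|rewrite y1].
apply: leaves_ind => [J fJ l0|J K nJ|J K nJ].
- by split; [split|left].
- by apply: up => //= l0; split; lra.
- by apply: up => //= l0; split; lra.
Qed.

Lemma ray_gap n J K x y : 0 < J.2 -> ~~ far J -> K \in leaves far n J ->
  K.2 <= x <= J.2 -> K.1 <= y <= K.1 + K.2 ->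
  expR (- (lnq del + 2 * D)) <= 1 - cabs (g (x +i* y)).
Proof.
move=> l0 nJ KJ xx yy; apply: lnq_le_imp; last exact: (ray_lnq l0 nJ KJ).
apply: g1; case/andP: xx => K2 _; exact: lt_le_trans (leaves_gt0 l0 KJ) K2.
Qed.

(** g vanishes at the apex of J, so |g| reaches del only after the hyperbolic distance [lnq del],
    travelled at rate at most D. *)
Lemma leaf_length n J K : 0 < J.2 -> w = F (apex J) -> K \in leaves far n J ->
  lnq del <= D * (1 + (ln J.2 - ln K.2)).
Proof.
move=> l0 wJ KJ; have K0 := leaves_gt0 l0 KJ.
have [h1 h2 h3] := leaves_sub (ltW l0) KJ.
have := g_lip K.1 J.1 K0 h3; rewrite -/(apex K) -/(apex J).
have -> : g (apex J) = 0 by rewrite /g /mob -wJ subrr mul0r.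
rewrite cabs0 lnq0 subr0 ler_norml => /andP[_ H].
have /andP[_ gK] := @g1 (apex K) K0.
have dK : lnq del <= lnq (cabs (g (apex K))).
  apply: lnq_mono => //; first by have := del0; lra.
  exact: leaves_stop KJ.
apply: le_trans dK _; apply: le_trans H _; rewrite ler_pM2l // addrC lerD2r.
rewrite ler_pdivrMr // mul1r ger0_norm; lra.
Qed.

(** Over a point that is never stopped, |g| stays below a constant less than 1 at all heights J.2 /
    2^n, so |F| stays away from 1 along a sequence tending to the boundary. Such points form a null
    set because F is inner. *)
Lemma far_rest_small J (nu : R) : radial_inner F -> 0 < J.2 -> 0 < nu ->
  exists n, \sum_(K <- rest far n J) K.2 <= nu.
Proof.
move=> inF l0 nu0; apply: rest_small => //; first exact: ltW.
apply: negligibleS inF => y capy /= H.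
pose b := lnq del + 2 * D.
pose k := (1 - cabs w ^+ 2) * expR (- b) / 4.
have k0 : 0 < k.
  by rewrite divr_gt0 // mulr_gt0 ?expR_gt0 // one_subr_sqr_gt0.
have [eta eta0 He] := H (k / 2) (divr_gt0 k0 (ltr0n _ 2)).
pose n := Num.trunc (J.2 / eta).
have x0 : 0 < J.2 / 2 ^+ n by rewrite divr_gt0 ?exprn_gt0.
have xeta : J.2 / 2 ^+ n < eta.
  rewrite ltr_pdivrMr ?exprn_gt0 // -ltr_pdivrMl // mulrC.
  have : J.2 / eta < n.+1%:R by exact: truncnS_gt.
  move/lt_le_trans; apply; rewrite -natrX ler_nat; exact: ltn_expl.
have [K KJ /andP[y1 y2]] := rest_setP (ltW l0) (capy n I).
have K2 := rest_length KJ.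
have := He (J.2 / 2 ^+ n); rewrite x0 xeta => /(_ isT) {}He.
have := g_lip y K.1 x0 (lexx _); rewrite subrr add0r => L.
have nK := rest_stop KJ; rewrite /far -ltNge in nK.
have gK : lnq (cabs (g (apex K))) <= lnq del.
  apply: lnq_mono => //; last exact: ltW.
  by have := cabs_ge0 (g (apex K)); lra.
have gb : lnq (cabs (g (J.2 / 2 ^+ n +i* y))) <= b.
  move: L; rewrite ler_norml => /andP[_]; rewrite -K2 -/(apex K) /b.
  have : `|y - K.1| / K.2 <= 1.
    rewrite ler_pdivrMr ?K2 // mul1r -K2 ger0_norm; lra.
  rewrite -(ler_pM2l D0); have := D0; lra.
have := lnq_le_imp (@g1 (J.2 / 2 ^+ n +i* y) x0) gb.
move=> /(defect_mob_ge w1 (@F1 (J.2 / 2 ^+ n +i* y) x0)) /(_ (expR_ge0 _)).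
rewrite -/k /defect; have := cabs_ge0 (F (J.2 / 2 ^+ n +i* y)).
have : k <= 1.
  rewrite /k ler_pdivrMr // mul1r.
  have : (1 - cabs w ^+ 2) * expR (- b) <= 1 * 1.
    apply: ler_pM; rewrite ?expR_ge0 //.
    - by apply: ltW; exact: one_subr_sqr_gt0.
    - by rewrite gerBl exprn_ge0 // cabs_ge0.
    - rewrite -expR0 ler_expR /b; have : 0 <= lnq del.
        by have := @lnq_mono R 0 del; rewrite lnq0; apply => //; exact: ltW.
      by have := D0; lra.
  lra.
move: He; move: (cabs _) => r; nra.
Qed.

End Stopping.
End Step.

(** * The step for arbitrary D < 1: counting inward arcs by Poisson kernels *)

Section StepLarge.
Variable R : realType.
Local Notation C := R[i].
Local Notation arc := (R * R)%type.
Implicit Types (F dF : C -> C) (J K : arc) (w z h : C).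

Lemma inward_direction w : exists2 e : C, cabs e = 1 & w = - ((cabs w)%:C * e).
Proof.
have [->|w0] := eqVneq w 0; first by exists 1; rewrite ?cabs1 // cabs0 mul0r oppr0.
have p0 : 0 < cabs w by rewrite cabs_gt0.
exists (- (((cabs w)^-1)%:C * w)).
  by rewrite cabsN cabsM cabsr gtr0_norm ?invr_gt0 // mulVf // gt_eqF.
by rewrite mulrN opprK mulrA -rmorphM /= mulfV ?gt_eqF // mul1r.
Qed.

Definition poisson (tau : R) h : R :=
  (1 - cabs ((1 - tau)%:C * h) ^+ 2) / cabs (1 - (1 - tau)%:C * h) ^+ 2.

(** The numerator is at most of order x1 for tau = x1 and at least of order th for tau = th, while
    both denominators are comparable to |1 - h|^2 because h is at distance at least th from 1. *)
Lemma poisson_compare (x1 th : R) h : 0 < x1 -> x1 <= th -> th <= 1 ->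
  cabs h < 1 -> 1 - cabs h <= x1 -> th <= cabs (1 - h) ->
  poisson x1 h <= 64 * (x1 / th) * poisson th h.
Proof.
move=> x0 xt t1 h1 hx tX; set X := cabs (1 - h) in tX *.
have th0 : 0 < th := lt_le_trans x0 xt.
have X0 : 0 < X := lt_le_trans th0 tX.
have h0 := cabs_ge0 h.
have c_eq tau : 0 < tau <= 1 -> cabs ((1 - tau)%:C * h) = (1 - tau) * cabs h.
  by move=> /andP[_ tau1]; rewrite cabsM cabsr ger0_norm // subr_ge0.
have N_ge tau : 0 < tau <= 1 -> tau <= cabs (1 - (1 - tau)%:C * h).
  move=> /andP[tau0 tau1]; have := cabs_leB 1 ((1 - tau)%:C * h).
  rewrite cabs1 c_eq ?tau0 //; nra.
have N_le tau : 0 < tau <= 1 -> cabs (1 - (1 - tau)%:C * h) <= X + tau.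
  move=> /andP[tau0 tau1].
  rewrite (_ : 1 - _ = (1 - h) + tau%:C * h); last by rewrite rmorphB /=; ring.
  apply: le_trans (cabsD _ _) _; rewrite lerD2l cabsM cabsr gtr0_norm //; nra.
have X_le tau : 0 < tau <= 1 -> X <= cabs (1 - (1 - tau)%:C * h) + tau.
  move=> /andP[tau0 tau1]; rewrite /X.
  rewrite (_ : 1 - h = (1 - (1 - tau)%:C * h) - tau%:C * h); last by rewrite rmorphB /=; ring.
  apply: le_trans (cabsD _ _) _; rewrite cabsN lerD2l cabsM cabsr gtr0_norm //; nra.
have x01 : 0 < x1 <= 1 by rewrite x0 (le_trans xt t1).
have t01 : 0 < th <= 1 by rewrite th0.
rewrite /poisson !c_eq //.
have := N_ge _ x01; have := X_le _ x01; have := N_ge _ t01; have := N_le _ t01.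
set N1 := cabs (1 - (1 - x1)%:C * h); set N2 := cabs (1 - (1 - th)%:C * h).
move=> N2X N2t XN1 N1x.
have N20 : 0 < N2 := lt_le_trans th0 N2t.
have N10 : 0 < N1 := lt_le_trans x0 N1x.
set a := (1 - x1) * cabs h; set b := (1 - th) * cabs h.
have a1 : 1 - a <= 2 * x1 by rewrite /a; nra.
have b1 : th <= 1 - b by rewrite /b; nra.
have b0 : 0 <= b by rewrite /b mulr_ge0 // subr_ge0.
apply: le_trans (_ : 16 * x1 / X ^+ 2 <= _).
  rewrite ler_pdivrMr ?exprn_gt0 // mulrAC ler_pdivlMr ?exprn_gt0 //.
  apply: le_trans (_ : 4 * x1 * X ^+ 2 <= _).
    rewrite ler_wpM2r ?sqr_ge0 //; nra.
  rewrite [X in _ <= X](_ : _ = 4 * x1 * (2 * N1) ^+ 2); last by ring.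
  rewrite ler_pM2l ?mulr_gt0 // ler_pXn2r ?nnegrE ?mulr_ge0 ?(ltW X0) ?(ltW N10) //; lra.
apply: le_trans (_ : 64 * (x1 / th) * (th / (4 * X ^+ 2)) <= _).
  by apply: le_of_eq; field; rewrite !gt_eqF.
rewrite ler_pM2l; last by rewrite mulr_gt0 // divr_gt0.
rewrite ler_pdivrMr ?mulr_gt0 ?exprn_gt0 // mulrAC ler_pdivlMr ?exprn_gt0 //.
apply: le_trans (_ : th * (4 * X ^+ 2) <= _).
  rewrite ler_pM2l // (_ : 4 * X ^+ 2 = (2 * X) ^+ 2); last by ring.
  by rewrite ler_pXn2r ?nnegrE ?mulr_ge0 ?(ltW X0) ?(ltW N20) //; lra.
rewrite ler_wpM2r ?mulr_ge0 ?sqr_ge0 //; nra.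
Qed.

Lemma Re_cayley_poisson (e z : C) (tau : R) : 0 < tau <= 1 -> cabs e = 1 ->
  cabs z < 1 -> Re (cayley ((1 - tau)%:C * e^*) z) = poisson tau (e^* * z).
Proof.
move=> /andP[t0 t1] e1 z1; rewrite Re_cayley ?(ltW z1) // -?mulrA //.
by rewrite cabsM cabsr cabs_conj e1 mulr1 ger0_norm; lra.
Qed.

Lemma cayley_le c z : cabs c < 1 -> cabs z <= 1 ->
  cabs (cayley c z) <= 2 / (1 - cabs c).
Proof.
move=> c1 z1.
have cz : cabs (c * z) <= cabs c by rewrite cabsM ler_piMr ?cabs_ge0.
have N : 1 - cabs c <= cabs (1 - c * z).
  have := cabs_leB 1 (c * z); rewrite cabs1; lra.
rewrite /cayley cabsM cabsV.
apply: ler_pM; rewrite ?cabs_ge0 ?invr_ge0 ?cabs_ge0 //.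
  by apply: le_trans (cabsD _ _) _; rewrite cabs1; lra.
by rewrite lef_pV2 ?posrE //; lra.
Qed.

Section Counting.
Variables (D Cu cl e0 : R) (F dF : C -> C) (J : arc) (del th x1 : R).
Hypotheses (D0 : 0 < D) (D1 : D < 1) (HF : hyp_contr D F dF) (inF : radial_inner F).
Hypotheses (Cu1 : 1 <= Cu) (cl0 : 0 < cl) (e00 : 0 < e0) (e01 : e0 <= 1).
Hypothesis bounds : forall G dG Gam : C -> C,
    hol G dG -> hol Gam G -> (forall z, 0 < Re z -> 0 < Re (G z)) ->
    (forall z, 0 < Re z -> cabs (dG z) <= D * Re (G z) / Re z) ->
    forall (J : arc) (x : R), 0 < x -> 0 < J.2 ->
    (x <= J.2 -> Re (mass Gam x J) <= Cu * (J.2 * Re (G (apex J)))) /\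
    (x <= e0 * J.2 -> cl * (J.2 * Re (G (apex J))) <= Re (mass Gam x J)).
Hypotheses (l0 : 0 < J.2) (del0 : 0 < del) (del1 : del < 1).
Hypotheses (x10 : 0 < x1) (x1th : x1 <= th) (th1 : th <= 1) (delx : 1 - del <= x1).
Hypothesis x1E : 256 * Cu ^+ 2 * x1 <= cl ^+ 2 * th.

Let w := F (apex J).
Let g z := mob w (F z).
Variable e : C.
Hypothesis e1 : cabs e = 1.

Definition inward : pred arc := fun K => cabs (1 - e^* * mob w (F (apex K))) < th.

(** The kernel with tau = th gives an upper bound for the weighted sum over the leaves, the one with
    tau = x1 a lower bound. By [poisson_compare] the leaves that are not inward contribute to the
    second sum at most 64 x1 / th times the first, which [x1E] makes a small part of the lower
    bound. The inward leaves must supply the rest, and their kernels are at most 2 / x1. *)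
Lemma inward_mass : exists n,
  cl * x1 / (4 * Cu) * J.2 <= \sum_(K <- [seq K <- leaves (far F w del) n J | inward K]) K.2.
Proof.
have [hF F1 _] := HF.
have w1 : cabs w < 1 by exact: F1.
have th0 : 0 < th := lt_le_trans x10 x1th.
have g1 z : 0 < Re z -> cabs (g z) < 1 by move=> z0; apply: mob_lt1 => //; exact: F1.
(* The Cayley transform is bounded by 2 / x1, so the unstopped arcs contribute at most (2 / x1) nu,
   a quarter of cl J.2. *)
pose nu := cl * x1 / 8 * J.2.
have nu0 : 0 < nu by rewrite mulr_gt0 // divr_gt0 // mulr_gt0.
have [n Hn] := far_rest_small D0 HF w1 del0 del1 inF l0 nu0.
exists n; set T := leaves _ n J; set U := rest (far F w del) n J in Hn.
(* The factor e0 makes this single height admissible in the lower bounds for J and for every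
   leaf. *)
pose x := e0 * J.2 / 2 ^+ n.
have x0 : 0 < x by rewrite !divr_gt0 ?mulr_gt0 ?exprn_gt0.
have xT K : K \in T -> x <= e0 * K.2.
  by move=> KT; rewrite /x -mulrA ler_pM2l //; exact: leaves_length (ltW l0) KT.
have T0 K : K \in T -> 0 < K.2 by exact: leaves_gt0.
have xU K : K \in U -> x <= K.2.
  move=> KU; rewrite (rest_length KU) /x -mulrA ler_piMl //.
  by rewrite divr_ge0 ?exprn_ge0 // ltW.
have U0 K : K \in U -> 0 < K.2 by move=> /xU; exact: lt_le_trans.
have xJ : x <= e0 * J.2.
  rewrite /x ler_pdivrMr ?exprn_gt0 // ler_peMr //.
    by rewrite mulr_ge0 // ltW.
  by rewrite exprn_ege1 // ler1n.
have e0le (K : arc) : 0 < K.2 -> e0 * K.2 <= K.2 by move=> K0; rewrite ler_piMl // ltW.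
have [dg Hg] : exists dg, hyp_contr D g dg by exact: mob_contr (ltW D0) w1 HF.
have test tau : 0 < tau <= 1 ->
    let P K := poisson tau (e^* * g (apex K)) in
    cl * \sum_(K <- T) K.2 * P K <= Cu * J.2 /\
    cl * J.2 <= Cu * (\sum_(K <- T) K.2 * P K) + 2 / tau * nu.
  move=> t01 P; have /andP[t0 t1] := t01.
  pose c := (1 - tau)%:C * e^*.
  have cE : cabs c = 1 - tau.
    by rewrite /c cabsM cabsr cabs_conj e1 mulr1 ger0_norm // subr_ge0.
  have c1 : cabs c < 1 by rewrite cE; lra.
  have [dG [hG G0 HG]] := cayley_pos (ltW D0) c1 Hg.
  have [Gam hGam] := primitive hG.
  have B := bounds hG hGam G0 HG.
  have GJ : Re (cayley c (g (apex J))) = 1.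
    by rewrite /g /mob /w subrr mul0r /cayley mulr0 addr0 subr0 divr1.
  have GP K : 0 < K.2 -> Re (cayley c (g (apex K))) = P K.
    by move=> K0; rewrite /c Re_cayley_poisson // g1.
  have ML K : 0 < K.2 -> 0 <= Re (mass Gam x K).
    move=> K0; have := @mass_ler R Gam _ x K 0 hGam x0 (ltW K0); rewrite mul0r; apply.
    by move=> y _; rewrite ltW // G0.
  have split_mass : Re (mass Gam x J) =
      \sum_(K <- T) Re (mass Gam x K) + \sum_(K <- U) Re (mass Gam x K).
    by apply: (tree_additive _ n J (fun K => _)) => K; rewrite mass_halves ReD.
  have [_ BJ] := B J x x0 l0; have {}BJ := BJ xJ.
  have [BJ' _] := B J x x0 l0; have {}BJ' := BJ' (le_trans xJ (e0le J l0)).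
  rewrite GJ mulr1 in BJ BJ'.
  split.
    apply: le_trans BJ'; rewrite split_mass.
    apply: le_trans (_ : \sum_(K <- T) Re (mass Gam x K) <= _).
      rewrite mulr_sumr big_seq [X in _ <= X]big_seq; apply: ler_sum => K KT.
      have [_ BK] := B K x x0 (T0 K KT); rewrite -GP ?T0 //.
      exact: BK (xT K KT).
    by rewrite lerDl big_seq; apply: sumr_ge0 => K KU; exact: ML (U0 K KU).
  apply: le_trans BJ _; rewrite split_mass; apply: lerD.
    rewrite mulr_sumr big_seq [X in _ <= X]big_seq; apply: ler_sum => K KT.
    have [BK _] := B K x x0 (T0 K KT); rewrite -GP ?T0 //.
    exact: BK (le_trans (xT K KT) (e0le K (T0 K KT))).
  apply: le_trans (_ : \sum_(K <- U) 2 / tau * K.2 <= _); last first.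
    by rewrite -mulr_sumr ler_wpM2l // divr_ge0 // ltW.
  rewrite big_seq [X in _ <= X]big_seq; apply: ler_sum => K KU.
  apply: le_trans (Re_le_cabs _) _.
  have := @mass_cabs_le R Gam _ x K 0 (2 / tau) hGam x0 (ltW (U0 K KU)).
  rewrite mul0r subr0; apply => y _; rewrite subr0.
  have := @cayley_le c (g (x +i* y)) c1 (ltW (@g1 (x +i* y) x0)).
  by rewrite cE (_ : 1 - (1 - tau) = tau) //; ring.
have t01 : 0 < th <= 1 by rewrite th0.
have x01 : 0 < x1 <= 1 by rewrite x10 (le_trans x1th th1).
have [Sth _] := test th t01; have [_ Sx] := test x1 x01.
rewrite /= in Sth Sx.
set Pt := fun K => poisson th (e^* * g (apex K)).
set Px := fun K => poisson x1 (e^* * g (apex K)).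
have hlt K : K \in T -> cabs (e^* * g (apex K)) < 1.
  by move=> KT; rewrite cabsM cabs_conj e1 mul1r; exact: (g1 (apex K) (T0 K KT)).
have P0 tau K : 0 < tau <= 1 -> K \in T -> 0 <= poisson tau (e^* * g (apex K)) <= 2 / tau.
  move=> tt KT; have /andP[t0 t1] := tt.
  have gK := g1 _ (T0 K KT : 0 < Re (apex K)).
  have c1 : cabs ((1 - tau)%:C * e^*) < 1.
    by rewrite cabsM cabsr cabs_conj e1 mulr1 ger0_norm; lra.
  rewrite -Re_cayley_poisson //; apply/andP; split.
    rewrite Re_cayley ?(ltW gK) // divr_ge0 ?sqr_ge0 // subr_ge0.
    by rewrite expr_le1 ?cabs_ge0 // cabsM mulr_ile1 ?cabs_ge0 ?ltW.
  apply: le_trans (Re_le_cabs _) _; apply: le_trans (cayley_le c1 (ltW gK)) _.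
  rewrite cabsM cabsr cabs_conj e1 mulr1 ger0_norm ?subr_ge0 //.
  by rewrite (_ : 1 - (1 - tau) = tau) //; ring.
have bad K : K \in T -> ~~ inward K -> Px K <= 64 * (x1 / th) * Pt K.
  move=> KT; rewrite /inward -leNgt => X; apply: poisson_compare => //; first exact: hlt.
  rewrite cabsM cabs_conj e1 mul1r.
  apply: le_trans delx; rewrite lerD2l lerN2.
  exact: (leaves_stop KT).
set S := \sum_(K <- _) K.2.
have key : \sum_(K <- T) K.2 * Px K <=
    2 / x1 * S + 64 * (x1 / th) * \sum_(K <- T) K.2 * Pt K.
  rewrite /S big_filter (bigID inward) /=; apply: lerD.
    rewrite mulr_sumr big_seq_cond [X in _ <= X]big_seq_cond.
    apply: ler_sum => K /andP[KT _]; rewrite mulrC ler_wpM2r ?(ltW (T0 K KT)) //.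
    by have /andP[] := P0 _ _ x01 KT.
  rewrite mulr_sumr [X in _ <= X](bigID inward) /= ler_wpDl //.
    rewrite big_seq_cond; apply: sumr_ge0 => K /andP[KT _].
    have /andP[p0 _] := P0 _ _ t01 KT.
    apply: mulr_ge0; last by rewrite mulr_ge0 // ltW // T0.
    by rewrite mulr_ge0 // divr_ge0 // ltW.
  rewrite big_seq_cond [X in _ <= X]big_seq_cond; apply: ler_sum => K /andP[KT nK].
  rewrite [X in _ <= X]mulrCA ler_pM2l ?T0 //; exact: bad.
have nuE : 2 / x1 * nu = cl * J.2 / 4 by rewrite /nu; field; rewrite gt_eqF.
rewrite nuE in Sx.
have Cu0 : 0 < Cu by exact: lt_le_trans ltr01 Cu1.
have A : Cu * (64 * (x1 / th) * \sum_(K <- T) K.2 * Pt K) <= cl / 4 * J.2.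
  apply: le_trans (_ : 64 * Cu * (x1 / th) * (Cu * J.2 / cl) <= _).
    rewrite [X in X <= _](_ : _ = 64 * Cu * (x1 / th) * \sum_(K <- T) K.2 * Pt K); last by ring.
    rewrite ler_pM2l; last by rewrite mulr_gt0 ?divr_gt0 // mulr_gt0.
    by rewrite ler_pdivlMr // mulrC.
  rewrite [X in X <= _](_ : _ = (256 * Cu ^+ 2 * x1) / (4 * th * cl) * J.2); last first.
    by field; rewrite !gt_eqF.
  rewrite ler_pM2r // ler_pdivrMr ?mulr_gt0 // (le_trans x1E) //.
  by apply: le_of_eq; field.
have B : cl / 2 * J.2 <= Cu * (2 / x1 * S).
  have := ler_wpM2l (ltW Cu0) key; rewrite mulrDr => K1; lra.
rewrite [X in _ <= X](_ : _ = x1 / (2 * Cu) * (Cu * (2 / x1 * S))); last first.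
  by field; rewrite !gt_eqF.
rewrite [X in X <= _](_ : _ = x1 / (2 * Cu) * (cl / 2 * J.2)); last first.
  by field; rewrite !gt_eqF.
by rewrite ler_pM2l // divr_gt0 // mulr_gt0.
Qed.

End Counting.

End StepLarge.

(** * The step for arbitrary D < 1: choice of constants *)

Section StepLargeConclusion.
Variable R : realType.
Local Notation C := R[i].
Local Notation arc := (R * R)%type.
Implicit Types (F dF : C -> C) (J K : arc) (w z h : C).

Lemma packed_filter (stop : pred arc) (P : pred arc) n J : 0 < J.2 ->
  packed J [seq K <- leaves stop n J | P K].
Proof.
move=> l0 Lam L0 LS; rewrite big_filter.
apply: le_trans (leaves_superadditive stop n L0 LS (ltW l0)).
rewrite [X in _ <= X](bigID P) /= lerDl big_seq_cond.
by apply: sumr_ge0 => K /andP[KJ _]; apply: L0; exact: ltW (leaves_gt0 l0 KJ).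
Qed.

Lemma one_add_conj_le w (e z : C) : w = - ((cabs w)%:C * e) -> cabs w < 1 ->
  cabs (1 + w^* * z) <= (1 - cabs w) + cabs (1 - e^* * z).
Proof.
move=> wE w1; set r := cabs w in wE w1 *.
have r0 : 0 <= r by exact: cabs_ge0.
have -> : 1 + w^* * z = (1 - r)%:C + r%:C * (1 - e^* * z).
  rewrite wE; apply/eqP; rewrite eq_complex.
  rewrite !(ReD, ImD, ReM, ImM, ReN, ImN, Re_conj, Im_conj) /=.
  by apply/andP; split; apply/eqP; ring.
apply: le_trans (cabsD _ _) _; rewrite cabsM !cabsr ger0_norm; last lra.
rewrite (ger0_norm r0) lerD2l ler_piMl ?cabs_ge0 //; exact: ltW.
Qed.

(** With mu = s^2 and eps = e mu^(2/D) the bound is of order mu^(3/2), to be compared with a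
    proportion c of order mu. *)
Lemma eps_bound (D s : R) : 0 < D -> D < 1 -> 0 < s ->
  (expR 1 * (s ^+ 2) `^ (2 / D)) `^ (3 * D / 4) <= expR 1 * (s * s ^+ 2).
Proof.
move=> D0 D1 s0; have m0 : 0 < s ^+ 2 by exact: exprn_gt0.
have e0 : 0 < expR 1 :> R by exact: expR_gt0.
have p0 : 0 < (s ^+ 2) `^ (2 / D) by exact: powR_gt0.
have ep0 : 0 < expR 1 * (s ^+ 2) `^ (2 / D) by exact: mulr_gt0.
have sm0 : 0 < s * s ^+ 2 by exact: mulr_gt0.
rewrite -ler_ln ?posrE; [|exact: powR_gt0|exact: mulr_gt0].
rewrite ln_powR (lnM e0 p0) (lnM e0 sm0) (lnM s0 m0) ln_powR expRK (lnXn 2 s0) -mulr_natl.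
rewrite [X in X <= _](_ : _ = 3 * D / 4 + 3 * ln s); last by field; rewrite gt_eqF.
lra.
Qed.

Lemma eps_length (D m j k : R) : 0 < D -> 0 < m -> 0 < j -> 0 < k ->
  - (2 * ln m) <= D * (1 + (ln j - ln k)) -> k <= expR 1 * m `^ (2 / D) * j.
Proof.
move=> D0 m0 j0 k0 H.
have e0 : 0 < expR 1 :> R by exact: expR_gt0.
have p0 : 0 < m `^ (2 / D) by exact: powR_gt0.
have ep0 : 0 < expR 1 * m `^ (2 / D) by exact: mulr_gt0.
rewrite -ler_ln ?posrE //; last exact: mulr_gt0.
rewrite (lnM ep0 j0) (lnM e0 p0) ln_powR expRK.
have : - (2 * ln m) / D <= 1 + (ln j - ln k) by rewrite ler_pdivrMr // [X in _ <= X]mulrC.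
rewrite mulNr (mulrAC 2); lra.
Qed.

Lemma step_large (D : R) : 0 < D < 1 -> exists c eps q0 gam q1 : R,
  [/\ 0 < c <= 1, 0 < eps & eps `^ (3 * D / 4) <= c / 4] /\
  [/\ 0 < q0, 1 < gam & 0 < q1 < 1] /\
  forall F dF, hyp_contr D F dF -> radial_inner F -> forall J, 0 < J.2 ->
    exists T, step_ok F c eps q0 gam q1 J T.
Proof.
move=> D01; have /andP[D0 D1] := D01.
have [Cu [cl' [e0 [Cu1 cl'0 e00 e01 bnd]]]] := positive_mass_bounds D01.
pose cl := Num.min cl' 1.
have cl0 : 0 < cl by rewrite lt_min cl'0 ltr01.
have cl1 : cl <= 1 by rewrite ge_min lexx orbT.
have clcl' : cl <= cl' by rewrite ge_min lexx.
have Cu0 : 0 < Cu := lt_le_trans ltr01 Cu1.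
have bounds : forall G dG Gam : C -> C,
    hol G dG -> hol Gam G -> (forall z, 0 < Re z -> 0 < Re (G z)) ->
    (forall z, 0 < Re z -> cabs (dG z) <= D * Re (G z) / Re z) ->
    forall (J : arc) (x : R), 0 < x -> 0 < J.2 ->
    (x <= J.2 -> Re (mass Gam x J) <= Cu * (J.2 * Re (G (apex J)))) /\
    (x <= e0 * J.2 -> cl * (J.2 * Re (G (apex J))) <= Re (mass Gam x J)).
  move=> G dG Gam hG hGam G0 HG J x x0 l0.
  have [B1 B2] := bnd G dG Gam hG hGam G0 HG J x x0 l0; split => // xe.
  apply: le_trans (B2 xe); rewrite ler_wpM2r // mulr_ge0 // ltW //.
  exact: (G0 (apex J) l0).
(* [kap] makes x1 = kap th meet the counting condition with equality; th = mu / (3 e) keeps 2 (2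
   th)^2 below the gap e^(-2) mu^2, so that the defect doubles; the proportion c becomes A mu, and
   s0 solves A s0^2 / 4 = e s0^3. Finally [del] is the radius with exp (- lnq del) = mu^2. *)
pose kap := cl ^+ 2 / (256 * Cu ^+ 2).
pose th0 : R := expR (-1) / 3.
pose A := cl * kap * th0 / (4 * Cu).
pose s0 := A / (4 * expR 1).
pose mu := s0 ^+ 2.
pose th := th0 * mu.
pose x1 := kap * th.
pose del := (1 - mu ^+ 2) / (1 + mu ^+ 2).
have e1 : 1 <= expR 1 :> R by rewrite -expR0 ler_expR.
have em1 : expR (-1) <= 1 :> R by rewrite -[leRHS]expR0 ler_expR; lra.
have em0 : 0 < expR (-1) :> R by exact: expR_gt0.
have th00 : 0 < th0 by rewrite divr_gt0.
have th01 : th0 <= 1 / 3 by rewrite /th0; lra.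
have kap0 : 0 < kap by rewrite divr_gt0 ?mulr_gt0 ?exprn_gt0.
have kap1 : kap <= 1 / 256.
  rewrite /kap ler_pdivrMr ?mulr_gt0 ?exprn_gt0 //.
  have : cl ^+ 2 <= Cu ^+ 2.
    by rewrite ler_pXn2r ?nnegrE ?(ltW cl0) ?(ltW Cu0) // (le_trans cl1 Cu1).
  lra.
have A0 : 0 < A.
  by apply: divr_gt0; [apply: mulr_gt0 => //; exact: mulr_gt0|exact: mulr_gt0].
have A1 : 4 * A <= kap * th0.
  rewrite /A [X in X <= _](_ : _ = kap * th0 * (cl / Cu)); last by field; rewrite gt_eqF.
  apply: ler_piMr; first by apply: mulr_ge0; exact: ltW.
  by rewrite ler_pdivrMr // mul1r (le_trans cl1 Cu1).
have kt : kap * th0 <= 1 / 256 * (1 / 3) by apply: ler_pM => //; exact: ltW.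
have s00 : 0 < s0 by apply: divr_gt0 => //; rewrite mulr_gt0 // expR_gt0.
have s0A : 4 * s0 <= A.
  rewrite /s0 [X in X <= _](_ : _ = A / expR 1); last by field; rewrite gt_eqF // expR_gt0.
  by rewrite ler_pdivrMr ?expR_gt0 // ler_peMr // ltW.
have mu0 : 0 < mu by exact: exprn_gt0.
have mus : mu <= s0 by rewrite /mu expr2 ler_piMl ?(ltW s00) //; lra.
have mu1 : mu <= 1 / 100 by lra.
have mA : A <= 1 by lra.
have kap_le1 : kap <= 1 by lra.
clear kap1 kt.
have m20 : 0 < mu ^+ 2 by exact: exprn_gt0.
have m2n : 1 + mu ^+ 2 != 0 by rewrite gt_eqF // addr_gt0.
have m21 : mu ^+ 2 < 1 by rewrite expr_lt1 ?(ltW mu0) //; lra.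
have th_0 : 0 < th by exact: mulr_gt0.
have x10 : 0 < x1 by exact: mulr_gt0.
have x1th : x1 <= th by rewrite /x1 ler_piMl ?(ltW th_0) //; lra.
have th1 : th <= 1 by apply: mulr_ile1; rewrite ?(ltW th00) ?(ltW mu0) //; lra.
have del0 : 0 < del by apply: divr_gt0; [rewrite subr_gt0|exact: addr_gt0].
have del1 : del < 1 by rewrite ltr_pdivrMr ?addr_gt0 //; lra.
have delx : 1 - del <= x1.
  rewrite (_ : 1 - del = 2 * mu ^+ 2 / (1 + mu ^+ 2)); last by rewrite /del; field.
  apply: le_trans (_ : 2 * mu ^+ 2 <= _).
    rewrite ler_pdivrMr ?addr_gt0 //; apply: ler_peMr; last by lra.
    by apply: mulr_ge0 => //; exact: ltW.
  have : 2 * mu * mu <= kap * th0 * mu by rewrite ler_pM2r //; lra.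
  by rewrite /x1 /th; lra.
clear kap_le1 A1 s0A mus.
have x1E : 256 * Cu ^+ 2 * x1 <= cl ^+ 2 * th.
  by apply: le_of_eq; rewrite /x1 /kap; field; rewrite gt_eqF.
have lnqd : expR (- lnq del) = mu ^+ 2.
  rewrite expR_lnq ?(ltW del0) // /del; field; rewrite m2n /=.
  by rewrite (_ : 1 + mu ^+ 2 + (1 - mu ^+ 2) = 2) //; ring.
have lnqd2 : lnq del = - (2 * ln mu).
  by apply: oppr_inj; rewrite -[LHS]expRK lnqd lnXn // opprK mulr_natl.
pose k2 : R := expR (- 2).
have k20 : 0 < k2 by exact: expR_gt0.
have k2E : k2 = expR (-1) ^+ 2 by rewrite /k2 -expRM_natl; congr expR; lra.
pose gap := k2 * mu ^+ 2.
have gap0 : 0 < gap by exact: mulr_gt0.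
have gapE : gap <= expR (- (lnq del + 2 * D)).
  rewrite opprD expRD lnqd /gap (mulrC k2) ler_pM2l // ler_expR; lra.
have k21 : k2 <= 1 by rewrite k2E expr_le1 // ltW.
have gap1 : gap <= 1 by apply: mulr_ile1; rewrite ?(ltW k20) ?(ltW m20) ?(ltW m21).
pose q0 := th * gap / 4.
pose q1 := q0 * gap / 4.
have q00 : 0 < q0 by apply: divr_gt0 => //; exact: mulr_gt0.
have q10 : 0 < q1 by apply: divr_gt0 => //; exact: mulr_gt0.
have tg1 : th * gap <= 1 by apply: mulr_ile1; rewrite ?(ltW th_0) ?(ltW gap0).
have q01 : q0 <= 1 by rewrite /q0; lra.
have qg1 : q0 * gap <= 1 by apply: mulr_ile1; rewrite ?(ltW q00) ?(ltW gap0).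
have q11 : q1 < 1 by rewrite /q1; lra.
have thE : th = expR (-1) / 3 * mu by [].
have gapD : gap = expR (-1) ^+ 2 * mu ^+ 2 by rewrite -k2E.
have q0D : q0 = th * gap / 4 by [].
have q1D : q1 = q0 * gap / 4 by [].
have cE : cl * x1 / (4 * Cu) = A * mu.
  by rewrite /x1 /A /th; field; rewrite gt_eqF.
have sE : A * mu / 4 = expR 1 * (s0 * s0 ^+ 2).
  by rewrite /mu /s0; field; rewrite gt_eqF // expR_gt0.
have muE : mu = s0 ^+ 2 by [].
clearbody q1 q0 gap k2 del x1 th mu s0 A th0 kap cl.
exists (cl * x1 / (4 * Cu)), (expR 1 * mu `^ (2 / D)), q0, 2, q1.
have muD0 : 0 < mu `^ (2 / D) by exact: powR_gt0.
split; [split|split].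
- rewrite cE mulr_gt0 //=; by apply: mulr_ile1; rewrite ?(ltW A0) ?(ltW mu0) //; lra.
- by rewrite mulr_gt0 ?expR_gt0.
- by rewrite cE sE muE; exact: eps_bound.
- by split => //; [rewrite ltr1n|rewrite q10].
move=> F dF HF inF J l0.
have [hF F1 _] := HF.
set w := F (apex J).
have w1 : cabs w < 1 by exact: F1.
have [e e_1 wE] := inward_direction w.
have [n Hn] := inward_mass D0 HF inF Cu1 cl0 e00 e01 bounds l0 del0 del1 x10 x1th
  th1 delx x1E e_1.
clear x1E delx cE sE.
rewrite -/w in Hn; set T := [seq K <- _ | _] in Hn.
have nJ : ~~ far F w del J.
  by rewrite /far -ltNge /mob /w subrr mul0r cabs0.
have TL K : K \in T -> K \in leaves (far F w del) n J by rewrite mem_filter => /andP[].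
have Ki K : K \in T -> cabs (1 - e^* * mob w (F (apex K))) < th.
  by rewrite mem_filter => /andP[].
exists T; split.
- exact: packed_filter l0.
- exact: Hn.
- move=> K /TL KL; have K0 := leaves_gt0 l0 KL.
  have [h1 h2 h3] := leaves_sub (ltW l0) KL; split => //.
  have := leaf_length D0 HF w1 del0 l0 erefl KL; rewrite lnqd2 => H.
  exact: eps_length H.
- move=> K KT; have KL := TL _ KT; have K0 := leaves_gt0 l0 KL.
  have := ray_gap D0 HF w1 del1 l0 nJ KL (x := K.2) (y := K.1).
  have [h1 h2 h3] := leaves_sub (ltW l0) KL.
  rewrite lexx h3 lexx lerDl (ltW K0) => /(_ isT isT) gK.
  have FK : cabs (F (apex K)) < 1 by exact: F1.
  have gapK : gap <= 1 - cabs (mob w (F (apex K))) by exact: le_trans gK.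
  (* If w is far from the circle, [defect_mob_ge] reaches q0 at once. If it is near, the inward
     position of g forces |1 + w^* g| <= 2 th, and the defect doubles. *)
  have [wt|wt] := leP (1 - cabs w) th; last first.
    rewrite ge_min; apply/orP; left.
    apply: le_trans (defect_mob_ge w1 FK gapK (ltW gap0)).
    rewrite q0D ler_pM2r // ler_pM2r //; apply: le_trans (ltW wt) _.
    by rewrite lerD2l lerN2 expr2 ler_piMl ?cabs_ge0 // ltW.
  rewrite ge_min; apply/orP; right.
  rewrite /defect (mob_inv_norm w1 FK) -/w.
  set g := mob w (F (apex K)) in gapK *.
  have N2 : cabs (1 + w^* * g) <= 2 * th.
    apply: le_trans (one_add_conj_le _ wE w1) _.
    by have := Ki K KT; rewrite -/g; lra.
  have N0 : 0 < cabs (1 + w^* * g).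
    have := @one_sub_neq0 R (- w^*) g.
    rewrite mulNr opprK cabsN cabs_conj cabs_gt0; apply => //.
    have := gap0; lra.
  rewrite ler_pdivlMr ?exprn_gt0 // mulrAC [X in _ <= X]mulrC ler_pM2r ?one_subr_sqr_gt0 //.
  apply: le_trans (_ : 2 * (2 * th) ^+ 2 <= _).
    rewrite ler_pM2l //; have th2 : 0 <= 2 * th by rewrite mulr_ge0 // ltW.
    by rewrite ler_pXn2r ?nnegrE ?cabs_ge0.
  apply: le_trans (_ : gap <= _); last first.
    apply: le_trans gapK _; rewrite lerD2l lerN2 expr2 ler_piMl ?cabs_ge0 //.
    by have := gap0; lra.
  rewrite thE gapD.
  have : 0 <= (expR (-1) * mu) ^+ 2 by exact: sqr_ge0.
  lra.
- move=> qJ K x y /TL KL xx yy.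
  have gK := ray_gap D0 HF w1 del1 l0 nJ KL xx yy.
  have x0 : 0 < x by case/andP: xx => xx _; exact: lt_le_trans (leaves_gt0 l0 KL) xx.
  have Fx : cabs (F (x +i* y)) < 1 by exact: F1.
  apply: le_trans (defect_mob_ge w1 Fx (le_trans gapE gK) (ltW gap0)).
  by rewrite q1D ler_pM2r // ler_pM2r.
Qed.

End StepLargeConclusion.

(** * The step for small D: averages and their variance *)

Section StepSmall.
Variable R : realType.
Local Notation C := R[i].
Local Notation arc := (R * R)%type.
Implicit Types (F dF g dg G dG Gam : C -> C) (J K : arc) (w z c : C).

(** The case s = 1/2 of [mass_estimate], where 2 / (s (1 - s)) + 1 = 9; the hypothesis fits because
    1 / t <= l^(1/2) t^(-3/2) for t <= l. *)
Lemma mass_estimate_half G dG Gam (b x : R) K : hol G dG -> hol Gam G -> 0 <= b ->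
  (forall z, 0 < Re z -> cabs (dG z) <= b / Re z) -> 0 < x -> x <= K.2 ->
  cabs (mass Gam x K - G (apex K) * K.2%:C) <= 9 * b * K.2.
Proof.
move=> hG hGam b0 HG x0 xK; have K0 := lt_le_trans x0 xK.
have -> : 9 * b = b * (2 / (2^-1 * (1 - 2^-1)) + 1) by field.
have s1 : 2^-1 < 1 :> R by rewrite invf_lt1 // ltr1n.
apply: (mass_estimate hG hGam) => //.
move=> t y /andP[xt tK] _; have t0 := lt_le_trans x0 xt.
apply: le_trans (HG (t +i* y) t0) _; rewrite /= -mulrA ler_wpM2l //.
rewrite powRB; last by rewrite (gt_eqF t0) implybT.
rewrite powRr1 ?(ltW t0) // mulrA ler_peMl ?invr_ge0 ?(ltW t0) //.
rewrite -[leLHS](powRNr (2^-1) t0); apply: ler_wpM2r; first exact: powR_ge0.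
by apply: ge0_ler_powR; rewrite ?nnegrE ?invr_ge0 ?(ltW t0) ?(ltW K0).
Qed.

Lemma lnq_incr (a b : R) : 0 <= a -> a <= b -> b < 1 -> 2 * (b - a) <= lnq b - lnq a.
Proof.
move=> a0 ab b1; rewrite mulrBr.
apply: (@increment_le R (fun t => 2 * t) (fun=> 2) (@lnq R)
  (fun t => 2 * 1 / (1 - t ^+ 2)) a b ab) => t /andP[ta tb].
- exact: is_derive_linear.
- apply: (@is_derive_lnq R id t 1) => //=; lra.
- have t2 : t ^+ 2 < 1 by rewrite expr_lt1 ?(le_trans a0 ta) // (le_lt_trans tb b1).
  by rewrite mulr1 ler_pdivlMr ?subr_gt0 // ler_piMr // gerBl sqr_ge0.
Qed.

Lemma parallelogram (a b c : C) :
  cabs (a - c) ^+ 2 + cabs (b - c) ^+ 2 =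
  2 * cabs ((2^-1)%:C * (a + b) - c) ^+ 2 + cabs (a - b) ^+ 2 / 2.
Proof. by rewrite !cabs_sqr !(ReD, ImD, ReM, ImM, ReN, ImN) /=; field. Qed.

Section Variance.
Variables (g dg Gam : C -> C) (b x : R) (c : C) (stop : pred arc).
Hypotheses (hg : hol g dg) (hGam : hol Gam g) (b0 : 0 <= b).
Hypothesis dg_le : forall z, 0 < Re z -> cabs (dg z) <= b / Re z.
Hypothesis x0 : 0 < x.

Definition avg K : C := (K.2^-1)%:C * mass Gam x K.

Lemma avg_near K : x <= K.2 -> cabs (avg K - g (apex K)) <= 9 * b.
Proof.
move=> xK; have K0 := lt_le_trans x0 xK.
have := mass_estimate_half hg hGam b0 dg_le x0 xK.
rewrite -ler_pdivrMr //; apply: le_trans.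
have -> : avg K - g (apex K) = (K.2^-1)%:C * (mass Gam x K - g (apex K) * (K.2)%:C).
  have E : (K.2^-1)%:C * (K.2)%:C = 1 :> C by rewrite -rmorphM /= mulVf ?gt_eqF.
  by rewrite /avg mulrBr [X in _ = _ - X]mulrCA E mulr1.
by rewrite cabsM cabsr gtr0_norm ?invr_gt0 // mulrC.
Qed.

Lemma avg_halves K : 0 < K.2 ->
  avg K = (2^-1)%:C * (avg (left_half K) + avg (right_half K)).
Proof.
move=> K0; rewrite /avg mass_halves /=.
have -> : (K.2^-1)%:C = (2^-1)%:C * ((K.2 / 2)^-1)%:C :> C.
  by rewrite -rmorphM /=; congr (_%:C); field; rewrite gt_eqF.
by ring.
Qed.

Lemma avg_halves_near K : x <= K.2 / 2 ->
  cabs (avg (left_half K) - avg (right_half K)) <= 19 * b.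
Proof.
move=> xK; have K0 : 0 < K.2 / 2 := lt_le_trans x0 xK.
have L := @avg_near (left_half K) xK; have Rr := @avg_near (right_half K) xK.
have M : cabs (g (apex (right_half K)) - g (apex (left_half K))) <= b.
  apply: le_trans (_ : b / (K.2 / 2) * (K.1 + K.2 / 2) - b / (K.2 / 2) * K.1 <= _); last first.
    by rewrite -mulrBr addrAC subrr add0r divfK // gt_eqF.
  apply: (@path_increment R (fun t => g (K.2 / 2 +i* t))
    (fun t => 'i * dg (K.2 / 2 +i* t)) (fun t => b / (K.2 / 2) * t) (fun=> b / (K.2 / 2))).
  - by rewrite lerDl ltW.
  - by move=> t _; apply: cdiff_vert; exact: hg.
  - by move=> t _; exact: is_derive_linear.
  - by move=> t _; rewrite cabsM cabsi mul1r; exact: (dg_le (z := K.2 / 2 +i* t)).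
rewrite (_ : avg _ - avg _ = (avg (left_half K) - g (apex (left_half K))) -
  (avg (right_half K) - g (apex (right_half K))) -
  (g (apex (right_half K)) - g (apex (left_half K)))); last by ring.
apply: le_trans (cabsD _ _) _; rewrite cabsN.
apply: le_trans (lerD (cabsD _ _) (lexx _)) _; rewrite cabsN; lra.
Qed.

(** The averages of g form a stopped dyadic martingale. By the parallelogram identity a bisection
    adds a quarter of the squared difference of the halves to the mean square, and (19 b)^2 / 4 <=
    100 b^2. *)
Lemma leaves_variance n J : 0 < J.2 -> x <= J.2 / 2 ^+ n ->
  \sum_(K <- leaves stop n J) K.2 * cabs (avg K - c) ^+ 2 <=
  J.2 * cabs (avg J - c) ^+ 2 + n%:R * (100 * b ^+ 2 * J.2).
Proof.
elim: n J => [|n IH] J l0 xJ /=.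
  rewrite mul0r addr0; case: ifP => _; rewrite ?big_seq1 ?big_nil //.
  by rewrite mulr_ge0 ?sqr_ge0 // ltW.
have V0 : 0 <= 100 * b ^+ 2 * J.2 by rewrite !mulr_ge0 // ltW.
case: ifP => _; first by rewrite big_seq1 lerDl mulr_ge0 ?ler0n.
rewrite big_cat /=.
have l2 : 0 < J.2 / 2 by rewrite divr_gt0.
have xJ' : x <= J.2 / 2 / 2 ^+ n by rewrite -mulrA -invfM -exprS.
have xJ2 : x <= J.2 / 2.
  apply: le_trans xJ' _; rewrite ler_pdivrMr ?exprn_gt0 // ler_peMr ?(ltW l2) //.
  by rewrite exprn_ege1 // ler1n.
have IHl := IH (left_half J) l2 xJ'; have IHr := IH (right_half J) l2 xJ'.
apply: le_trans (lerD IHl IHr) _; rewrite /=.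
have P := parallelogram (avg (left_half J)) (avg (right_half J)) c.
rewrite -avg_halves // in P.
have dif : cabs (avg (left_half J) - avg (right_half J)) ^+ 2 <= 400 * b ^+ 2.
  have H := avg_halves_near xJ2.
  apply: le_trans (_ : (19 * b) ^+ 2 <= _); last by have := sqr_ge0 b; lra.
  by rewrite ler_pXn2r ?nnegrE ?cabs_ge0 ?mulr_ge0.
rewrite -(natr1 n).
have Q : J.2 / 2 * (cabs (avg (left_half J) - c) ^+ 2 + cabs (avg (right_half J) - c) ^+ 2)
   <= J.2 * cabs (avg J - c) ^+ 2 + 100 * b ^+ 2 * J.2.
  rewrite P; have := ler_wpM2l (ltW l2) dif; lra.
lra.
Qed.

End Variance.

(** A leaf longer than J.2 / 2^m has been stopped within m bisections, hence is already a leaf of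
    the shorter tree. *)
Lemma early_leaves (stop : pred arc) n m J : 0 < J.2 ->
  \sum_(K <- leaves stop n J | J.2 / 2 ^+ m < K.2) K.2 <=
  \sum_(K <- leaves stop m J) K.2.
Proof.
have nz k J' : 0 < J'.2 -> 0 <= \sum_(K <- leaves stop k J') K.2.
  by move=> l0; rewrite big_seq; apply: sumr_ge0 => K KJ; exact: ltW (leaves_gt0 l0 KJ).
elim: m n J => [|m IH] n J l0.
  rewrite big_seq_cond big_pred0 ?nz // => K.
  apply/negP => /andP[KJ]; have [_ _ h] := leaves_sub (ltW l0) KJ.
  by rewrite expr0 divr1 ltNge h.
have [sJ|sJ] := boolP (stop J).
  have Ek k : leaves stop k J = [:: J] by case: k => /=; rewrite sJ.
  rewrite !Ek big_mkcond !big_seq1; case: ifP => // _; exact: ltW.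
case: n => [|n]; first by rewrite /= (negbTE sJ) big_nil; have := nz m.+1 J l0;
  rewrite /= (negbTE sJ).
rewrite /= (negbTE sJ) !big_cat /= exprS invfM mulrA; apply: lerD.
  by apply: (IH n (left_half J)) => //=; rewrite divr_gt0.
by apply: (IH n (right_half J)) => //=; rewrite divr_gt0.
Qed.

Lemma mob_small w z (a b : R) : cabs w <= a -> cabs (mob w z) <= b ->
  a * b <= 1 / 100 -> cabs w < 1 -> cabs z < 1 -> cabs z <= (a + b) * (102 / 100).
Proof.
move=> wa gb ab w1 z1; set g := mob w z in gb.
have a0 := le_trans (cabs_ge0 _) wa; have b0 := le_trans (cabs_ge0 _) gb.
have N : 99 / 100 <= cabs (1 + w^* * g).
  have := cabs_leB 1 (- (w^* * g)); rewrite opprK cabs1 cabsN cabsM cabs_conj.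
  have : cabs w * cabs g <= a * b by apply: ler_pM; rewrite ?cabs_ge0.
  lra.
have N0 : 0 < cabs (1 + w^* * g) by apply: lt_le_trans N; lra.
rewrite (mobK w1 z1) -/g cabsM cabsV ler_pdivrMr //.
apply: le_trans (_ : a + b <= _).
  by apply: le_trans (cabsD _ _) _; rewrite addrC lerD.
rewrite -mulrA ler_peMr ?addr_ge0 //; lra.
Qed.

End StepSmall.

(** * The step for small D: sums of G over the leaves *)

Section StepSmallConclusion.
Variable R : realType.
Local Notation C := R[i].
Local Notation arc := (R * R)%type.
Implicit Types (F dF g dg G dG Gam : C -> C) (J K : arc) (w z c : C).

(** Since G vanishes at the apex of J, the mass of J is at most 9 b J.2 in modulus; replacing the
    mass of each leaf K by K.2 G (apex K) costs another 9 b J.2 in total. *)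
Lemma tree_sum_ge G dG Gam (stop : pred arc) n J (b x : R) c :
  hol G dG -> hol Gam G -> 0 <= b ->
  (forall z, 0 < Re z -> cabs (dG z) <= b / Re z) ->
  (forall z, 0 < Re z -> cabs (G z) <= 1) -> G (apex J) = 0 -> cabs c <= 1 ->
  0 < J.2 -> 0 < x -> x <= J.2 / 2 ^+ n ->
  - (18 * b * J.2 + \sum_(K <- rest stop n J) K.2) <=
  \sum_(K <- leaves stop n J) K.2 * Re (c * G (apex K)).
Proof.
move=> hG hGam b0 HG G1 GJ c1 l0 x0 xn.
have ME K : x <= K.2 -> Re (c * mass Gam x K) - K.2 * Re (c * G (apex K)) <= 9 * b * K.2.
  move=> xK; apply: le_trans (mass_estimate_half hG hGam b0 HG x0 xK).
  apply: le_trans _ (ReM_le_cabs _ c1); apply: le_of_eq.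
  rewrite mulrBr ReD ReN; congr (_ - _).
  by rewrite mulrA (mulrC (c * _)) Re_realM.
have xJ : x <= J.2.
  apply: le_trans xn _; rewrite ler_pdivrMr ?exprn_gt0 // ler_peMr ?(ltW l0) //.
  by rewrite exprn_ege1 // ler1n.
have xT K : K \in leaves stop n J -> x <= K.2.
  by move=> KT; apply: le_trans xn _; exact: leaves_length (ltW l0) KT.
have split_mass : Re (c * mass Gam x J) =
    \sum_(K <- leaves stop n J) Re (c * mass Gam x K) +
    \sum_(K <- rest stop n J) Re (c * mass Gam x K).
  by apply: (tree_additive stop n J (fun K => _)) => K; rewrite mass_halves mulrDr ReD.
have MJ : - (9 * b * J.2) <= Re (c * mass Gam x J).
  have := mass_estimate_half hG hGam b0 HG x0 xJ.
  rewrite GJ mul0r subr0 => /(le_trans _) H; rewrite lerNl -ReN -mulNr.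
  by apply: H; apply: ReM_le_cabs; rewrite cabsN.
have MU : \sum_(K <- rest stop n J) Re (c * mass Gam x K) <= \sum_(K <- rest stop n J) K.2.
  rewrite big_seq [X in _ <= X]big_seq; apply: ler_sum => K KU.
  have K0 : 0 <= K.2 by rewrite (rest_length KU) divr_ge0 ?exprn_ge0 // ltW.
  apply: le_trans (ReM_le_cabs _ c1) _.
  have := @mass_cabs_le R Gam G x K 0 1 hGam x0 K0; rewrite mul0r subr0 mul1r; apply.
  by move=> y _; rewrite subr0; exact: G1.
have MT : \sum_(K <- leaves stop n J) Re (c * mass Gam x K) <=
    \sum_(K <- leaves stop n J) K.2 * Re (c * G (apex K)) + 9 * b * J.2.
  apply: le_trans (_ : \sum_(K <- leaves stop n J)
      (K.2 * Re (c * G (apex K)) + 9 * b * K.2) <= _).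
    rewrite big_seq [X in _ <= X]big_seq; apply: ler_sum => K KT.
    by have := ME K (xT K KT); lra.
  rewrite big_split /= lerD2l -mulr_sumr ler_wpM2l ?mulr_ge0 //.
  have -> : J.2 = \sum_(K <- leaves stop n J) K.2 + \sum_(K <- rest stop n J) K.2.
    by apply: (tree_additive stop n J (fun K => _)) => K /=; lra.
  by rewrite lerDl big_seq; apply: sumr_ge0 => K /rest_length ->; rewrite divr_ge0 ?exprn_ge0 // ltW.
lra.
Qed.

End StepSmallConclusion.

(** * The step for small D: counting inward arcs by first and second moments *)

Section StepSmallMain.
Variable R : realType.
Local Notation C := R[i].
Local Notation arc := (R * R)%type.
Implicit Types (F dF g dg G dG Gam : C -> C) (J K : arc) (w z c : C).

(** This quadratic is nonpositive for p <= 0, below 0.15 d^2 for p < d / 8 and below 2.1 d^2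
    throughout, so a large mean forces p >= d / 8 on a fixed proportion. *)
Lemma quadratic_test (d p : R) : 0 < d -> - (101 / 100 * d) <= p -> p <= 101 / 100 * d ->
  p * (p + 101 / 100 * d) <= 15 / 100 * d ^+ 2 + (if d / 8 <= p then 21 / 10 * d ^+ 2 else 0).
Proof.
move=> d0 p1 p2; case: ifPn; rewrite -?ltNge => H; last by rewrite addr0; nra.
by nra.
Qed.

(** A and B stand for the sums of K.2 p^2 and K.2 p. Up to small errors A >= d^2 J / 2 and B >= 0,
    so S / J is at least about (0.5 - 0.15) / 2.1 = 1/6; the value 15/100 leaves room for the
    errors. *)
Lemma count_arith (d D J A B S T U : R) : 0 < d -> d <= 1 / 100 -> 0 < D -> 0 < J ->
  d ^+ 2 = 100 * (100 * (100 * D)) -> J = T + U -> 0 <= U -> U <= d ^+ 2 / 100 / 10 * J ->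
  (d ^+ 2 * T - (18 * D * J + U)) / 2 <= A -> - (18 * D * J + U) <= B ->
  A + 101 / 100 * d * B <= 15 / 100 * d ^+ 2 * T + 21 / 10 * d ^+ 2 * S ->
  15 / 100 * J <= S.
Proof.
move=> d0 d1 D0 J0 dD JE U0 UJ HA HB H.
have d20 : 0 < d ^+ 2 by exact: exprn_gt0.
have d21 : d ^+ 2 <= 1 / 100 * (1 / 100) by nra.
pose Y := d ^+ 2 * J.
have Y0 : 0 < Y by exact: mulr_gt0.
have DJ : 18 * D * J = 18 / 100 / 100 / 100 * Y by rewrite /Y dD; field.
have UY : U <= Y / 100 / 10 by rewrite /Y; lra.
have UJ2 : d ^+ 2 * U <= Y / 100 / 10.
  have : U <= J / 100 / 10 by nra.
  by move=> /(ler_wpM2l (ltW d20)); rewrite /Y; lra.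
have dT : d ^+ 2 * T = Y - d ^+ 2 * U by rewrite /Y JE; ring.
have T1 : d ^+ 2 * T <= Y by rewrite dT gerBl mulr_ge0 // ltW.
have [b [b0 bY HB2 HA2]] : exists b, [/\ 0 <= b, b <= Y / 100 / 5, - b <= B &
    (d ^+ 2 * T - b) / 2 <= A].
  by exists (18 * D * J + U); split => //; lra.
have dB : - (b / 10) <= 101 / 100 * d * B.
  have := ler_wpM2l (ltW d0) HB2.
  have : d * b <= 1 / 100 * b by apply: ler_wpM2r.
  lra.
have : 15 / 100 * Y <= d ^+ 2 * S.
  have H2 : A + 101 / 100 * d * B <= 15 / 100 * (d ^+ 2 * T) + 21 / 10 * (d ^+ 2 * S).
    by rewrite (mulrA (15 / 100)) (mulrA (21 / 10)).
  move: dB H2 HA2 T1 dT UJ2 bY b0 Y0.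
  move: (101 / 100 * d * B) (d ^+ 2 * T) (d ^+ 2 * U) (d ^+ 2 * S) => v t u s.
  lra.
by rewrite /Y mulrCA ler_pM2l.
Qed.

Lemma half_gap (d D k X a b : R) : d <= k -> k <= X + a + b -> a <= 9 * D ->
  b <= 9 * D -> D <= d / 100 -> 0 < D -> d / 2 <= X.
Proof. lra. Qed.

Lemma count_tail (J S E E' T : R) : 0 < J -> 15 / 100 * J <= S -> E <= 2 / 100 * J ->
  E' <= E -> S <= T + E' -> 1 / 10 * J <= T.
Proof. lra. Qed.

Lemma dilation_le (d D : R) : 0 < d -> d <= 1 / 100 -> 0 < D ->
  d ^+ 2 = 100 * (100 * (100 * D)) -> D <= d / 100.
Proof.
move=> d0 d1 D0 dD; have : d ^+ 2 <= d * (1 / 100) by rewrite expr2 ler_pM2l.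
by rewrite dD; lra.
Qed.

Section Count.
Variables (D del : R) (F dF : C -> C) (J : arc) (n0 : nat).
Hypotheses (D0 : 0 < D) (HF : hyp_contr D F dF) (inF : radial_inner F).
Hypotheses (l0 : 0 < J.2) (del0 : 0 < del) (del1 : del <= 1 / 100).
Hypotheses (delD : del ^+ 2 = 100 * (100 * (100 * D))) (nD : n0%:R * D <= 50).

Let w := F (apex J).
Let g z := mob w (F z).
Variable e : C.
Hypothesis e1 : cabs e = 1.

Definition inward_small : pred arc :=
  fun K => (del / 8 <= Re (e^* * mob w (F (apex K)))) && (K.2 <= J.2 / 2 ^+ n0).

Let Dd : D <= del / 100. Proof. exact: dilation_le. Qed.

Let delt1 : del < 1. Proof. by have := del1; lra. Qed.

Let F1 z : 0 < Re z -> cabs (F z) < 1. Proof. by have [_ H _] := HF; exact: H. Qed.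
Let w1 : cabs w < 1. Proof. exact: F1. Qed.
Let g1 z : 0 < Re z -> cabs (g z) < 1.
Proof. by move=> z0; apply: mob_lt1 => //; exact: F1. Qed.
Let gJ : g (apex J) = 0. Proof. by rewrite /g /mob /w subrr mul0r. Qed.

Lemma small_ray n K x y : K \in leaves (far F w del) n J ->
  K.2 <= x <= J.2 -> K.1 <= y <= K.1 + K.2 -> cabs (g (x +i* y)) <= del + D.
Proof.
move=> KJ xx yy.
have nJ : ~~ far F w del J by rewrite /far -ltNge -/(g (apex J)) gJ cabs0.
have := ray_lnq D0 HF w1 delt1 l0 nJ KJ xx yy; rewrite -/(g _) => H.
have x0 : 0 < x by case/andP: xx => xx _; exact: lt_le_trans (leaves_gt0 l0 KJ) xx.
have [gd|gd] := leP (cabs (g (x +i* y))) del.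
  by apply: le_trans gd _; rewrite lerDl ltW.
have := lnq_incr (ltW del0) (ltW gd) (@g1 (x +i* y) x0); lra.
Qed.

Lemma small_leaf n K : K \in leaves (far F w del) n J ->
  del <= cabs (g (apex K)) <= 101 / 100 * del.
Proof.
move=> KJ; have K0 := leaves_gt0 l0 KJ; have [_ _ h3] := leaves_sub (ltW l0) KJ.
have := @small_ray n K K.2 K.1 KJ; rewrite lexx h3 lexx lerDl (ltW K0).
move=> /(_ isT isT) H; rewrite (leaves_stop KJ : del <= cabs (g (apex K))) /=.
by apply: le_trans H _; have := Dd; have := del0; lra.
Qed.

(** Let p = Re (e^* g), so that 2 p^2 is |g|^2 plus the real part of the square of e^* g. As g and
    g^2 vanish at the apex of J, over the leaves the mean of p is nearly nonnegative and that of p^2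
    nearly at least del^2 / 2. The quadratic test puts p >= del / 8 on 15 percent of J, of which
    leaves stopped too early take at most 2 percent. *)
Lemma small_count : exists n,
  1 / 10 * J.2 <= \sum_(K <- [seq K <- leaves (far F w del) n J | inward_small K]) K.2.
Proof.
pose nu := del ^+ 2 / 100 / 10 * J.2.
have d20 : 0 < del ^+ 2 by exact: exprn_gt0.
have nu0 : 0 < nu by rewrite mulr_gt0 // !divr_gt0.
have [n Hn] := far_rest_small D0 HF w1 del0 delt1 inF l0 nu0.
exists n; set T := leaves _ n J; set U := rest (far F w del) n J in Hn.
(* The exponent n + n0 puts x below every arc of the two trees that occur, of depths n and n0. *)
pose x := J.2 / 2 ^+ (n + n0).
have x0 : 0 < x by rewrite divr_gt0 ?exprn_gt0.
have pw (i j : nat) : J.2 / 2 ^+ (i + j) <= J.2 / 2 ^+ i.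
  rewrite ler_pM2l // lef_pV2 ?posrE ?exprn_gt0 //.
  by rewrite ler_eXn2l ?ltr1n // leq_addr.
have xn : x <= J.2 / 2 ^+ n by exact: pw.
have xn0 : x <= J.2 / 2 ^+ n0 by rewrite /x addnC; exact: pw.
have [dg Hg] : exists dg, hyp_contr D g dg by exact: mob_contr (ltW D0) w1 HF.
have [hg _ dgD] := Hg.
have sq1 z : 0 < Re z -> 0 <= 1 - cabs (g z) ^+ 2 <= 1.
  move=> z0; rewrite subr_ge0 gerBl sqr_ge0 andbT.
  by rewrite expr_le1 ?cabs_ge0 // ltW // g1.
have dg_le z : 0 < Re z -> cabs (dg z) <= D / Re z.
  move=> z0; apply: le_trans (dgD z z0) _; have /andP[s0 s1] := sq1 z z0.
  rewrite invfM mulrA ler_pM2r ?invr_gt0 // -mulrA ler_piMr ?(ltW D0) //.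
  by rewrite ler_pdivrMr // mul1r; apply: le_trans s1 _; rewrite ler1n.
have [Gam hGam] := primitive hg.
have hg2 : hol (fun z => g z ^+ 2) (fun z => 2 * g z * dg z).
  by move=> z z0; exact: (cdiff_comp (hg z z0) (cdiff_sqr (g z))).
have dg2_le z : 0 < Re z -> cabs (2 * g z * dg z) <= D / Re z.
  move=> z0; have /andP[s0 s1] := sq1 z z0.
  have -> : 2 * g z * dg z = (2 : R)%:C * (g z * dg z).
    by rewrite mulrA; congr (_ * _ * _); rewrite rmorph_nat.
  rewrite (cabsM _ (g z * dg z)) (cabsM (g z)) cabsr ger0_norm //.
  apply: le_trans (_ : 2 * (1 * (D * 1 / (2 * Re z))) <= _); last first.
    by apply: le_of_eq; field; rewrite gt_eqF.
  rewrite ler_pM2l //; apply: ler_pM; rewrite ?cabs_ge0 //.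
    exact: ltW (@g1 z z0).
  apply: le_trans (dgD z z0) _; rewrite ler_pM2r ?invr_gt0 ?mulr_gt0 //.
  by rewrite ler_pM2l.
have [Gam2 hGam2] := primitive hg2.
have es1 : cabs (e^*) <= 1 by rewrite cabs_conj e1.
have es2 : cabs (e^* ^+ 2) <= 1 by rewrite expr2 cabsM cabs_conj e1 mulr1.
have gz1 z : 0 < Re z -> cabs (g z) <= 1 by move=> z0; rewrite ltW // g1.
have gz2 z : 0 < Re z -> cabs (g z ^+ 2) <= 1.
  by move=> z0; rewrite expr2 cabsM mulr_ile1 ?cabs_ge0 // gz1.
have gJ2 : g (apex J) ^+ 2 = 0 by rewrite gJ expr0n.
have S1 := tree_sum_ge (far F w del) hg hGam (ltW D0) dg_le gz1 gJ es1 l0 x0 xn.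
have S2 := tree_sum_ge (far F w del) hg2 hGam2 (ltW D0) dg2_le gz2 gJ2 es2 l0 x0 xn.
rewrite -/T -/U /= in S1 S2.
pose p K := Re (e^* * g (apex K)).
have T0 K : K \in T -> 0 < K.2 by exact: leaves_gt0.
have JE : J.2 = \sum_(K <- T) K.2 + \sum_(K <- U) K.2.
  by apply: (tree_additive (far F w del) n J (fun K => _)) => K /=; lra.
have U0 : 0 <= \sum_(K <- U) K.2.
  rewrite big_seq; apply: sumr_ge0 => K /rest_length ->.
  by rewrite divr_ge0 ?exprn_ge0 // ltW.
have pE K : p K ^+ 2 = (cabs (g (apex K)) ^+ 2 + Re (e^* ^+ 2 * g (apex K) ^+ 2)) / 2.
  have -> : cabs (g (apex K)) = cabs (e^* * g (apex K)) by rewrite [RHS]cabsM cabs_conj e1 mul1r.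
  have -> : e^* ^+ 2 * g (apex K) ^+ 2 = (e^* * g (apex K)) * (e^* * g (apex K)) by ring.
  rewrite /p; move: (e^* * g (apex K)) => h; rewrite cabs_sqr ReM; by field.
have HA : (del ^+ 2 * \sum_(K <- T) K.2 - (18 * D * J.2 + \sum_(K <- U) K.2)) / 2 <=
    \sum_(K <- T) K.2 * p K ^+ 2.
  have -> : \sum_(K <- T) K.2 * p K ^+ 2 = (\sum_(K <- T) K.2 * cabs (g (apex K)) ^+ 2 +
     \sum_(K <- T) K.2 * Re (e^* ^+ 2 * g (apex K) ^+ 2)) / 2.
    rewrite -big_split /= mulr_suml; apply: eq_bigr => K _; rewrite pE; lra.
  rewrite ler_pM2r ?invr_gt0 //; apply: lerD => //.
  rewrite mulr_sumr big_seq [X in _ <= X]big_seq; apply: ler_sum => K KT.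
  rewrite mulrC ler_pM2l ?T0 //; have /andP[h _] := small_leaf KT.
  by rewrite ler_pXn2r ?nnegrE ?cabs_ge0 ?(ltW del0).
set S := \sum_(K <- T | del / 8 <= p K) K.2.
have HS : \sum_(K <- T) K.2 * p K ^+ 2 + 101 / 100 * del * (\sum_(K <- T) K.2 * p K) <=
    15 / 100 * del ^+ 2 * (\sum_(K <- T) K.2) + 21 / 10 * del ^+ 2 * S.
  have -> : S = \sum_(K <- T) (if del / 8 <= p K then K.2 else 0) by rewrite /S big_mkcond.
  rewrite !mulr_sumr -!big_split /= big_seq [X in _ <= X]big_seq.
  apply: ler_sum => K KT.
  have /andP[_ h] := small_leaf KT.
  have pn : `|p K| <= 101 / 100 * del.
    by apply: le_trans h; apply: le_trans (normRe_le_cabs _) _; rewrite [leLHS]cabsM cabs_conj e1 mul1r.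
  move: pn; rewrite ler_norml => /andP[pa pb].
  have := ler_wpM2l (ltW (T0 K KT)) (quadratic_test del0 pa pb).
  by case: ifP => _ /=; lra.
have S15 : 15 / 100 * J.2 <= S.
  exact: (count_arith del0 del1 D0 l0 delD JE U0 Hn HA S1 HS).
(* On such a leaf the average of g differs from the average over J by at least del / 2. The variance
   after n0 bisections is at most 100 n0 D^2 <= 5000 D, which is 2/100 of (del / 2)^2 = 250000 D. *)
have early : \sum_(K <- leaves (far F w del) n0 J) K.2 <= 2 / 100 * J.2.
  have := @leaves_variance R g dg Gam D x (avg Gam x J) (far F w del) hg hGam
     (ltW D0) dg_le x0 n0 J l0 xn0.
  rewrite subrr cabs0 expr0n /= mulr0 add0r => V.
  have : \sum_(K <- leaves (far F w del) n0 J) K.2 * (del / 2) ^+ 2 <=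
      n0%:R * (100 * D ^+ 2 * J.2).
    apply: le_trans V; rewrite big_seq [X in _ <= X]big_seq; apply: ler_sum => K KT.
    have K0 := leaves_gt0 l0 KT.
    rewrite ler_pM2l // ler_pXn2r ?nnegrE ?cabs_ge0 ?divr_ge0 ?(ltW del0) //.
    have xK : x <= K.2 := le_trans xn0 (leaves_length (ltW l0) KT).
    have xJ : x <= J.2 by apply: le_trans xn0 _; have := pw 0%N n0; rewrite add0n expr0 divr1.
    have AK := avg_near hg hGam (ltW D0) dg_le x0 xK.
    have AJ := avg_near hg hGam (ltW D0) dg_le x0 xJ.
    rewrite gJ subr0 in AJ.
    have /andP[gK _] := small_leaf KT.
    have : cabs (g (apex K)) <= cabs (avg Gam x K - avg Gam x J) +
        cabs (avg Gam x K - g (apex K)) + cabs (avg Gam x J).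
      rewrite {1}(_ : g (apex K) = (avg Gam x K - avg Gam x J) -
         (avg Gam x K - g (apex K)) + avg Gam x J); last by ring.
      apply: le_trans (cabsD _ _) _; rewrite lerD2r.
      by apply: le_trans (cabsD _ _) _; rewrite cabsN.
    by move=> H; exact: half_gap gK H AK AJ Dd D0.
  rewrite -mulr_suml => H.
  have d4 : 0 < (del / 2) ^+ 2 by rewrite exprn_gt0 // divr_gt0.
  rewrite -(ler_pM2r d4).
  apply: le_trans H _.
  have -> : n0%:R * (100 * D ^+ 2 * J.2) = (n0%:R * D) * (100 * D * J.2) by ring.
  apply: le_trans (_ : 50 * (100 * D * J.2) <= _).
    by apply: ler_wpM2r nD; rewrite !mulr_ge0 // ltW.
  by rewrite exprMn delD; apply: le_of_eq; field.
have Eearly := early_leaves (far F w del) n n0 l0.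
rewrite -/T in Eearly.
have : S <= \sum_(K <- [seq K <- T | inward_small K]) K.2 +
    \sum_(K <- T | J.2 / 2 ^+ n0 < K.2) K.2.
  rewrite /S big_filter big_mkcond [X in _ <= X + _]big_mkcond [X in _ <= _ + X]big_mkcond /=.
  rewrite -big_split /= big_seq [X in _ <= X]big_seq; apply: ler_sum => K KT.
  have K0 := ltW (T0 K KT).
  rewrite /inward_small -/(g _) -/(p K) ltNge.
  by case: (del / 8 <= p K); case: (K.2 <= J.2 / 2 ^+ n0); rewrite /= ?addr0 ?add0r.
exact: count_tail l0 S15 early Eearly.
Qed.

End Count.

End StepSmallMain.

(** * The step for small D: growth of the defect and choice of constants *)

Section StepSmallFinal.
Variable R : realType.
Local Notation C := R[i].
Local Notation arc := (R * R)%type.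
Implicit Types (F dF : C -> C) (J K : arc) (w z : C).

Lemma cabs_one_add_sqr z : cabs (1 + z) ^+ 2 = 1 + 2 * Re z + cabs z ^+ 2.
Proof. by rewrite !cabs_sqr !(ReD, ImD) /=; ring. Qed.

(** Here r = |w|, G = |g|^2, p = Re (e^* g), and the second factor on the left is |1 + w^* g|^2. Its
    cross term 2 r p >= 4 d^2 outweighs the losses G <= 1.03 d^2; the threshold 16 d for |w| is set
    for this. *)
Lemma inward_gain (d r p G : R) : 0 < d -> d <= 1 / 100 -> 16 * d <= r -> r < 1 ->
  d / 8 <= p -> 0 <= G -> G <= (101 / 100 * d) ^+ 2 ->
  (1 + d ^+ 2) * (1 - 2 * (r * p) + r ^+ 2 * G) <= 1 - G.
Proof.
move=> d0 d1 r0 r1 p0 G0 G1.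
have rp : 2 * d ^+ 2 <= r * p.
  have -> : 2 * d ^+ 2 = (16 * d) * (d / 8) by field.
  by apply: ler_pM; rewrite ?mulr_ge0 ?divr_ge0 ?(ltW d0).
have rG : r ^+ 2 * G <= G.
  rewrite ler_piMl // expr_le1 ?(ltW r1) //.
  by apply: le_trans r0; rewrite mulr_ge0 // ltW.
have d20 : 0 < d ^+ 2 by exact: exprn_gt0.
have G2 : G <= 103 / 100 * d ^+ 2.
  by apply: le_trans G1 _; rewrite exprMn ler_pM2r //; lra.
have N : 1 - 2 * (r * p) + r ^+ 2 * G <= 1 - 297 / 100 * d ^+ 2 by lra.
apply: le_trans (_ : (1 + d ^+ 2) * (1 - 297 / 100 * d ^+ 2) <= _).
  by rewrite ler_pM2l // addr_gt0.
have : 0 <= d ^+ 2 * d ^+ 2 by rewrite mulr_ge0 // ltW.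
lra.
Qed.

Lemma defect_ge_sqr F z (a b : R) : cabs (F z) <= a -> a <= b -> 1 - b ^+ 2 <= defect F z.
Proof.
move=> Fa ab; rewrite /defect lerD2l lerN2.
have F0 := cabs_ge0 (F z); have b0 := le_trans F0 (le_trans Fa ab).
by rewrite ler_pXn2r ?nnegrE // (le_trans Fa ab).
Qed.

(* del = 1000 sqrt D; the nested products keep the unary numerals small. *)
Lemma step_small (D del : R) (n0 : nat) : 0 < D -> 0 < del -> del <= 1 / 100 ->
  del ^+ 2 = 100 * (100 * (100 * D)) -> n0%:R * D <= 50 ->
  forall F dF, hyp_contr D F dF -> radial_inner F -> forall J, 0 < J.2 ->
    exists T, step_ok F (1 / 10) ((2^-1) ^+ n0) (1 - (18 * del) ^+ 2) (1 + del ^+ 2)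
      (1 - (20 * del) ^+ 2) J T.
Proof.
move=> D0 del0 del1 delD nD F dF HF inF J l0.
have [hF F1 _] := HF; set w := F (apex J).
have w1 : cabs w < 1 by exact: F1.
have [e e_1 wE] := inward_direction w.
have [n Hn] := small_count D0 HF inF l0 del0 del1 delD nD e_1.
rewrite -/w in Hn; set T := [seq K <- _ | _] in Hn.
have TL K : K \in T -> K \in leaves (far F w del) n J by rewrite mem_filter => /andP[].
have Dd : D <= del / 100 by exact: dilation_le.
have dd : del * del <= 1 / 100 * (1 / 100) by apply: ler_pM => //; exact: ltW.
exists T; split.
- exact: packed_filter l0.
- exact: Hn.
- move=> K KT; have KL := TL K KT; have [h1 h2 h3] := leaves_sub (ltW l0) KL.
  split => //; first exact: leaves_gt0 l0 KL.
  by move: KT; rewrite mem_filter => /andP[/andP[_ h] _]; rewrite exprVn mulrC.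
- move=> K KT; have KL := TL K KT; have K0 := leaves_gt0 l0 KL.
  have FK : cabs (F (apex K)) < 1 by exact: F1.
  have := small_leaf D0 HF l0 del0 del1 delD KL; rewrite -/w => /andP[ga gb].
  rewrite ge_min.
  (* Below 16 del, [mob_small] gives |F| <= 1.02 (16 + 1.01) del <= 18 del at the apex of K, which
     is q0; starting from 18 del it gives 20 del on the rays, which is q1. *)
  have [wd|wd] := leP (16 * del) (cabs w); last first.
    apply/orP; left.
    have := mob_small (ltW wd) gb _ w1 FK.
    rewrite (_ : 16 * del * (101 / 100 * del) = 16 * (101 / 100) * (del * del)); last by ring.
    move=> H; apply: (defect_ge_sqr (H _)); last by lra.
    move: dd; lra.
  apply/orP; right; rewrite /defect (mob_inv_norm w1 FK) -/w.
  have w0 := one_subr_sqr_gt0 w1.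
  have pK : del / 8 <= Re (e^* * mob w (F (apex K))).
    by move: KT; rewrite mem_filter => /andP[/andP[]].
  set g := mob w (F (apex K)) in ga gb pK *.
  have N0 : 0 < cabs (1 + w^* * g).
    have := @one_sub_neq0 R (- w^*) g.
    rewrite mulNr opprK cabsN cabs_conj cabs_gt0; apply => //.
    by apply: le_trans gb _; lra.
  rewrite ler_pdivlMr ?exprn_gt0 // mulrAC [X in _ <= X]mulrC ler_pM2r //.
  rewrite cabs_one_add_sqr cabsM cabs_conj exprMn.
  have -> : Re (w^* * g) = - (cabs w * Re (e^* * g)).
    rewrite {1}wE; move: (cabs w) => r.
    by rewrite !(ReM, ImM, ReN, ImN, Re_conj, Im_conj) /=; ring.
  rewrite mulrN; apply: inward_gain => //; first exact: sqr_ge0.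
  by rewrite ler_pXn2r ?nnegrE ?cabs_ge0 // mulr_ge0 // ltW.
- move=> qJ K x y /TL KL xx yy.
  have x0 : 0 < x by case/andP: xx => xx _; exact: lt_le_trans (leaves_gt0 l0 KL) xx.
  have Fx : cabs (F (x +i* y)) < 1 by exact: F1.
  have gx := small_ray D0 HF l0 del0 del1 KL xx yy; rewrite -/w in gx.
  have wd : cabs w <= 18 * del.
    move: qJ; rewrite /defect -/w lerD2l lerN2 ler_pXn2r ?nnegrE ?cabs_ge0 //.
    by rewrite mulr_ge0 // ltW.
  have gb : cabs (mob w (F (x +i* y))) <= 101 / 100 * del.
    by apply: le_trans gx _; lra.
  have := mob_small wd gb _ w1 Fx.
  rewrite (_ : 18 * del * (101 / 100 * del) = 18 * (101 / 100) * (del * del)); last by ring.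
  move=> H; apply: (defect_ge_sqr (H _)); last by lra.
  move: dd; lra.
Qed.

End StepSmallFinal.

(** * The mass distribution principle on a tree of arcs *)

Lemma mem_pairs (R : realType) (p q : nat -> R) N (I : R * R) :
  I \in [seq (p i, q i) | i <- iota 0 N] <-> exists2 i, (i < N)%N & I = (p i, q i).
Proof.
split.
  elim: N => [|N IH]; first by [].
  rewrite -addn1 iotaD map_cat mem_cat add0n => /orP[/IH[i iN ->]|].
    by exists i; rewrite // addn1 ltnS ltnW.
  by rewrite /= inE => /eqP ->; exists N; rewrite ?addn1.
by case=> i iN ->; apply: map_f; rewrite mem_iota.
Qed.

Section TreeContent.
Variable R : realType.
Local Notation arc := (R * R)%type.
Variables (good : arc -> Prop) (T : arc -> seq arc) (c eps s : R).
Hypotheses (c0 : 0 < c) (c1 : c <= 1) (eps0 : 0 < eps) (s0 : 0 < s) (s1 : s < 1).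
Hypothesis epsc : eps `^ (1 - s) <= c / 4.
Hypothesis good_pos : forall J, good J -> 0 < J.2.
Hypothesis good_packed : forall J, good J -> packed J (T J).
Hypothesis good_mass : forall J, good J -> c * J.2 <= \sum_(K <- T J) K.2.
Hypothesis good_child : forall J K, good J -> K \in T J ->
  [/\ good K, K.2 <= eps * J.2, J.1 <= K.1 & K.1 + K.2 <= J.1 + J.2].
Implicit Types (J K I : arc) (n : nat).

Let tot J := \sum_(K <- T J) K.2.

Let tot_gt0 J : good J -> 0 < tot J.
Proof.
move=> gJ; apply: lt_le_trans (good_mass gJ); rewrite mulr_gt0 //; exact: good_pos.
Qed.

(* The share of a unit mass put on J, distributed among the children in
   proportion to their lengths, that n generations later sits in arcs contained
   in the interval [I.1, I.2]. *)
Fixpoint share n J I : R :=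
  if n is k.+1 then \sum_(K <- T J) K.2 / tot J * share k K I
  else if (I.1 <= J.1) && (J.1 + J.2 <= I.2) then 1 else 0.

Lemma share_bounds n J I : good J -> 0 <= share n J I <= 1.
Proof.
elim: n J => [|n IH] J gJ /=; first by case: ifP; rewrite ?lexx ?ler01.
have t0 := tot_gt0 gJ.
have K0 K : K \in T J -> 0 < K.2 by move=> /(good_child gJ)[/good_pos].
apply/andP; split.
  rewrite big_seq; apply: sumr_ge0 => K KJ; have [gK _ _ _] := good_child gJ KJ.
  have /andP[h _] := IH K gK.
  by rewrite mulr_ge0 // divr_ge0 ?(ltW t0) // ltW // K0.
apply: le_trans (_ : \sum_(K <- T J) K.2 / tot J <= _).
  rewrite big_seq [X in _ <= X]big_seq; apply: ler_sum => K KJ.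
  have [gK _ _ _] := good_child gJ KJ; have /andP[_ h] := IH K gK.
  by rewrite ler_piMr // divr_ge0 ?(ltW t0) // ltW // K0.
by rewrite -mulr_suml mulfV ?gt_eqF.
Qed.

Lemma share_eq0 n J I : good J -> (J.1 + J.2 <= I.1) || (I.2 <= J.1) ->
  share n J I = 0.
Proof.
elim: n J => [|n IH] J gJ /= H.
  have l0 := good_pos gJ; case: ifP => // /andP[h1 h2].
  by case/orP: H => h; lra.
rewrite big_seq big1 // => K KJ; have [gK _ h1 h2] := good_child gJ KJ.
rewrite IH ?mulr0 //; case/orP: H => h; apply/orP; [left|right].
  exact: le_trans h2 h.
exact: le_trans h h1.
Qed.

Lemma powR_div_mul (x y t : R) : 0 < x -> 0 < y -> (x / y) `^ t = x `^ t / y `^ t.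
Proof.
by move=> x0 y0; rewrite powRM ?invr_ge0 ?(ltW x0) ?(ltW y0) // -powR_inv1 ?(ltW y0) //
  powRAC powR_inv1 // powR_ge0.
Qed.

(** By induction on the depth. If I is at least as long as J the bound exceeds 1. Otherwise the
    children inside I have total length at most |I|, and those that straddle an end of I, at most
    one for each end, are controlled by the induction hypothesis; [epsc] makes these two
    contributions absorbable. *)
Lemma share_le n J I : good J -> I.1 < I.2 ->
  share n J I <= 2 / c * ((I.2 - I.1) / J.2) `^ s.
Proof.
move=> gJ pq; set rho := I.2 - I.1.
have rho0 : 0 < rho by rewrite subr_gt0.
have C1 : 1 <= 2 / c by rewrite ler_pdivlMr // mul1r (le_trans c1) // ler1n.
have big_rho k K : good K -> K.2 <= rho -> share k K I <= 2 / c * (rho / K.2) `^ s.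
  move=> gK Kr; have K0 := good_pos gK; have /andP[_ h] := share_bounds k I gK.
  apply: le_trans h _; rewrite -[leLHS]mulr1; apply: ler_pM => //.
  rewrite -[leLHS](powRr0 (rho / K.2)); apply: ler_powR; last exact: ltW.
  by rewrite ler_pdivlMr // mul1r.
elim: n J gJ => [|n IH] J gJ; have l0 := good_pos gJ.
  have [lr|lr] := leP J.2 rho; first exact: big_rho.
  rewrite /=; case: ifP => [/andP[h1 h2]|_]; first by move: lr; rewrite /rho; lra.
  by rewrite mulr_ge0 ?powR_ge0 ?divr_ge0 ?(ltW c0).
have [lr|lr] := leP J.2 rho; first exact: big_rho.
have t0 := tot_gt0 gJ.
have K0 K : K \in T J -> 0 < K.2 by move=> /(good_child gJ)[/good_pos].
pose cl (y : R) := Num.min (Num.max y I.1) I.2.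
have cl_mono y z : y <= z -> cl y <= cl z.
  by move=> yz; rewrite /cl le_min2 // le_max2.
have cl_id y : I.1 <= y <= I.2 -> cl y = y.
  by case/andP=> h1 h2; rewrite /cl (max_idPl h1) (min_idPl h2).
have cl_rng y : I.1 <= cl y <= I.2.
  by rewrite /cl ge_min lexx orbT le_min (ltW pq) le_max lexx orbT.
(* The inductive bound for K.2 times the share of K, increasing in K.2, at the largest admissible
   child length eps J.2. *)
pose E := 2 / c * (rho `^ s * (eps * J.2) `^ (1 - s)).
have E0 : 0 <= E by rewrite mulr_ge0 ?divr_ge0 ?(ltW c0) // mulr_ge0 ?powR_ge0.
pose inb (y : R) K : R := if K.1 <= y < K.1 + K.2 then E else 0.
have inb0 y K : 0 <= inb y K by rewrite /inb; case: ifP.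
(* The length of K inside I, plus E for each end of I in K. It is superadditive because a point lies
   in only one of two half-open halves, so [packed] applies. *)
pose Lam K := (cl (K.1 + K.2) - cl K.1) + (inb I.1 K + inb I.2 K).
have inb_half y K : 0 <= K.2 -> inb y (left_half K) + inb y (right_half K) <= inb y K.
  move=> k0; rewrite /inb /left_half /right_half /=.
  have Eh : K.1 + K.2 / 2 + K.2 / 2 = K.1 + K.2 by field.
  rewrite Eh; have [h|h] := leP (K.1 + K.2 / 2) y.
    have h1 : K.1 <= y by lra.
    by rewrite h1 /= add0r.
  have h1 : y < K.1 + K.2 by lra.
  by rewrite h1 /= andbT addr0.
have L := @good_packed J gJ Lam _ _.
have {}L : \sum_(K <- T J) Lam K <= Lam J.
  apply: L => K k0.
    apply: addr_ge0; last by rewrite addr_ge0.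
    by rewrite subr_ge0 cl_mono // lerDl.
  have h1 := inb_half I.1 K k0; have h2 := inb_half I.2 K k0.
  rewrite /Lam /=.
  have Eh : K.1 + K.2 / 2 + K.2 / 2 = K.1 + K.2 by field.
  by rewrite Eh; lra.
have LJ : Lam J <= rho + 2 * E.
  rewrite /Lam; have /andP[a1 a2] := cl_rng (J.1 + J.2); have /andP[b1 b2] := cl_rng J.1.
  have i1 : inb I.1 J <= E by rewrite /inb; case: ifP.
  have i2 : inb I.2 J <= E by rewrite /inb; case: ifP.
  by rewrite /rho; lra.
have term K : K \in T J -> K.2 * share n K I <= Lam K.
  move=> KJ; have [gK Ke h1 h2] := good_child gJ KJ; have k0 := K0 K KJ.
  have clK : 0 <= cl (K.1 + K.2) - cl K.1 by rewrite subr_ge0 cl_mono // lerDl ltW.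
  have /andP[m0 m1] := share_bounds n I gK.
  have mE : K.2 * share n K I <= E.
    apply: le_trans (ler_wpM2l (ltW k0) (IH K gK)) _.
    rewrite powR_div_mul // /E mulrCA ler_pM2l ?divr_gt0 //.
    rewrite mulrCA ler_pM2l ?powR_gt0 //.
    have -> : K.2 / K.2 `^ s = K.2 `^ (1 - s).
      by rewrite powRB ?(gt_eqF k0) ?implybT // powRr1 // ltW.
    apply: ge0_ler_powR; rewrite ?nnegrE ?subr_ge0 ?(ltW s1) ?(ltW k0) //.
    by rewrite mulr_ge0 // ltW.
  have [KI|KI] := boolP ((I.1 <= K.1) && (K.1 + K.2 <= I.2)).
    case/andP: KI => a1 a2; rewrite /Lam !cl_id ?a1 ?a2 ?andbT /=; last 2 first.
    - by apply: le_trans a2; rewrite lerDl ltW.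
    - by apply: le_trans a1 _; rewrite lerDl ltW.
    rewrite (addrC K.1) addrK; apply: le_trans (_ : K.2 <= _).
      by rewrite ler_piMr // ltW.
    by rewrite lerDl addr_ge0.
  have [dj|] := boolP ((K.1 + K.2 <= I.1) || (I.2 <= K.1)).
    by rewrite share_eq0 // mulr0 addr_ge0 // addr_ge0.
  rewrite negb_or -!ltNge => /andP[d1 d2].
  move: KI; rewrite negb_and -!ltNge => /orP[e1|e1].
    apply: le_trans mE _; rewrite /Lam.
    have -> : inb I.1 K = E by rewrite /inb (ltW e1) d1.
    by have := inb0 I.2 K; lra.
  apply: le_trans mE _; rewrite /Lam.
  have -> : inb I.2 K = E by rewrite /inb (ltW d2) e1.
  by have := inb0 I.1 K; lra.
have total : share n.+1 J I <= (rho + 2 * E) / (c * J.2).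
  have -> : share n.+1 J I = (\sum_(K <- T J) K.2 * share n K I) / tot J.
    by rewrite /= mulr_suml; apply: eq_bigr => K _; rewrite mulrAC.
  have S0 : 0 <= rho + 2 * E by apply: addr_ge0; [exact: ltW|exact: mulr_ge0].
  apply: le_trans (_ : (rho + 2 * E) / tot J <= _).
    rewrite ler_pM2r ?invr_gt0 //; apply: le_trans LJ; apply: le_trans L.
    by rewrite big_seq [X in _ <= X]big_seq; exact: ler_sum.
  apply: ler_wpM2l => //; rewrite lef_pV2 ?posrE ?mulr_gt0 //.
  exact: good_mass.
apply: le_trans total _.
set q := (rho / J.2) `^ s.
have q0 : 0 < q by rewrite powR_gt0 // divr_gt0.
have r1 : rho / J.2 <= q.
  by apply: ger1_powR; rewrite ?(ltW s1) // divr_gt0 //= ler_pdivrMr // mul1r ltW.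
have EJ : E / J.2 <= 2 / c * q * (c / 4).
  rewrite /E /q powR_div_mul // powRM ?(ltW eps0) ?(ltW l0) //.
  have -> : 2 / c * (rho `^ s * (eps `^ (1 - s) * J.2 `^ (1 - s))) / J.2 =
     2 / c * (rho `^ s / J.2 `^ s) * eps `^ (1 - s).
    rewrite [J.2 `^ (1 - s)]powRB ?(gt_eqF l0) ?implybT // powRr1 ?(ltW l0) //.
    by field; rewrite !gt_eqF // powR_gt0.
  by apply: ler_wpM2l => //; apply: mulr_ge0; apply: divr_ge0; rewrite ?powR_ge0 ?(ltW c0).
have -> : (rho + 2 * E) / (c * J.2) = (rho / J.2 + 2 * (E / J.2)) / c.
  by field; rewrite !gt_eqF.
rewrite ler_pdivrMr // (_ : 2 / c * q * c = 2 * q); last by field; rewrite gt_eqF.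
have : 2 / c * q * (c / 4) = q / 2 by field; rewrite gt_eqF.
lra.
Qed.

Fixpoint covered n J (L : seq arc) : Prop :=
  if n is k.+1 then forall K, K \in T J -> covered k K L
  else exists2 I, I \in L & (I.1 <= J.1) && (J.1 + J.2 <= I.2).

Lemma covered_share n J L : good J -> covered n J L ->
  1 <= \sum_(I <- L) share n J I.
Proof.
elim: n J => [|n IH] J gJ /=.
  case=> I IL HI; rewrite (big_rem I) //= HI lerDl.
  by apply: sumr_ge0 => I' _; case: ifP.
move=> H; have t0 := tot_gt0 gJ; rewrite exchange_big /=.
apply: le_trans (_ : \sum_(K <- T J) K.2 / tot J <= _).
  by rewrite -mulr_suml mulfV ?gt_eqF.
rewrite big_seq [X in _ <= X]big_seq; apply: ler_sum => K KJ.
have [gK _ _ _] := good_child gJ KJ; have k0 := good_pos gK.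
rewrite -mulr_sumr ler_peMr ?divr_ge0 ?(ltW k0) ?(ltW t0) //.
exact: IH (H K KJ).
Qed.

(** The intervals of L together catch the whole unit mass, and by [share_le] each catches at most (2
    / c) (|I| / |J|)^s. *)
Lemma covered_content n J L : good J -> (forall I, I \in L -> I.1 < I.2) ->
  covered n J L -> c / 2 * J.2 `^ s <= \sum_(I <- L) (I.2 - I.1) `^ s.
Proof.
move=> gJ LI cov; have l0 := good_pos gJ.
have : 1 <= \sum_(I <- L) 2 / c * ((I.2 - I.1) / J.2) `^ s.
  apply: le_trans (covered_share gJ cov) _.
  by rewrite big_seq [X in _ <= X]big_seq; apply: ler_sum => I IL; apply: share_le => //; exact: LI.
have -> : \sum_(I <- L) 2 / c * ((I.2 - I.1) / J.2) `^ s =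
    2 / c / J.2 `^ s * \sum_(I <- L) (I.2 - I.1) `^ s.
  rewrite mulr_sumr big_seq [RHS]big_seq; apply: eq_bigr => I IL.
  by rewrite powR_div_mul ?subr_gt0 ?LI // mulrCA mulrC -!mulrA; congr (_ * (_ * _)); rewrite mulrC.
have p0 : 0 < J.2 `^ s by exact: powR_gt0.
move=> H; rewrite -[leLHS]mulr1; apply: le_trans (ler_wpM2l _ H) _.
  by rewrite mulr_ge0 ?divr_ge0 ?ltW.
by apply: le_of_eq; rewrite mulrA; field; rewrite !gt_eqF.
Qed.

Lemma covered_mono n m J L : good J -> (n <= m)%N -> covered n J L -> covered m J L.
Proof.
elim: n m J => [|n IH] m J gJ.
  move=> _ [I IL HI]; elim: m J gJ HI => [|m IHm] J gJ HI /=; first by exists I.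
  move=> K KJ; have [gK _ h1 h2] := good_child gJ KJ; apply: IHm => //.
  by case/andP: HI => a b; rewrite (le_trans a h1) (le_trans h2 b).
case: m => // m nm H K KJ; have [gK _ _ _] := good_child gJ KJ.
exact: IH (H K KJ).
Qed.

Lemma covered_sub n J L L' : {subset L <= L'} -> covered n J L -> covered n J L'.
Proof.
move=> LL; elim: n J => [|n IH] J /=; first by case=> I /LL IL HI; exists I.
by move=> H K KJ; apply: IH; exact: H.
Qed.

(** The points of the limit set. The arcs are taken closed here, so that every infinite descent
    contains a point. *)
Definition branch J (y : R) : Prop := exists Js : nat -> arc,
  [/\ Js 0%N = J, forall k, Js k.+1 \in T (Js k) &
      forall k, (Js k).1 <= y <= (Js k).1 + (Js k).2].

Lemma eps_lt1 : eps < 1.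
Proof.
rewrite ltNge; apply/negP => e1.
have : 1 <= eps `^ (1 - s).
  by rewrite -[leLHS](powRr0 eps); apply: ler_powR => //; rewrite subr_ge0 ltW.
by have := epsc; have := c1; lra.
Qed.

(** Compactness by a König argument: if no finite part of the cover catches a whole generation, some
    child has the same defect, and so on. The branch obtained contains a point y; an open interval
    around y contains all sufficiently short arcs of the branch, a contradiction. *)
Lemma branch_cover J (p q : nat -> R) : good J ->
  (forall y, branch J y -> exists i, p i < y < q i) ->
  exists n N, covered n J [seq (p i, q i) | i <- iota 0 N].
Proof.
move=> gJ cov; apply: contrapT => nJ.
pose bad K := good K /\ ~ exists n N, covered n K [seq (p i, q i) | i <- iota 0 N].
have step K : bad K -> exists2 K', K' \in T K & bad K'.
  move=> [gK nK]; apply: contrapT => H; apply: nK.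
  have HK K' : K' \in T K -> exists nN : nat * nat,
      covered nN.1 K' [seq (p i, q i) | i <- iota 0 nN.2].
    move=> KT; have [gK' _ _ _] := good_child gK KT.
    apply: contrapT => H'; apply: H; exists K' => //; split=> // -[n [N HN]].
    by apply: H'; exists (n, N).
  have /choice[f Hf] : forall K', exists nN : nat * nat, K' \in T K ->
      covered nN.1 K' [seq (p i, q i) | i <- iota 0 nN.2].
    move=> K'; have [KT|KT] := boolP (K' \in T K); last by exists (0%N, 0%N).
    by have [nN HN] := HK K' KT; exists nN.
  pose n := \max_(K' <- T K) (f K').1; pose N := \max_(K' <- T K) (f K').2.
  exists n.+1, N => K' KT; have [gK' _ _ _] := good_child gK KT.
  apply: (@covered_mono (f K').1) => //; first by rewrite /n (big_rem K' KT) /= leq_maxl.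
  apply: covered_sub (Hf K' KT) => I /mem_pairs[i iN ->].
  apply/mem_pairs; exists i => //; apply: leq_trans iN _.
  by rewrite /N (big_rem K' KT) /= leq_maxl.
have /choice[next Hnext] : forall K, exists K', bad K -> K' \in T K /\ bad K'.
  move=> K; have [bK|bK] := pselect (bad K); last by exists K.
  by have [K' h1 h2] := step K bK; exists K'.
pose Js k := iter k next J.
have badJ k : bad (Js k).
  by elim: k => [|k IH]; [split|have [] := Hnext _ IH].
have child k : Js k.+1 \in T (Js k) by have [] := Hnext _ (badJ k).
have Jg k : good (Js k) by have [] := badJ k.
have [y Hy] : exists l, forall k, (Js k).1 <= l <= (Js k).1 + (Js k).2.
  apply: nested_intervals => k.
  - by have [] := good_child (Jg k) (child k).
  - by have [] := good_child (Jg k) (child k).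
  - by rewrite lerDl ltW // good_pos.
have [i /andP[pi qi]] : exists i, p i < y < q i by apply: cov; exists Js.
have len k : (Js k).2 <= eps ^+ k * J.2.
  elim: k => [|k IH]; first by rewrite expr0 mul1r.
  have [_ h _ _] := good_child (Jg k) (child k).
  by apply: le_trans h _; rewrite exprS -mulrA ler_pM2l.
have [k Hk] : exists k, eps ^+ k * J.2 < Num.min (y - p i) (q i - y).
  have m0 : 0 < Num.min (y - p i) (q i - y) / J.2.
    by rewrite divr_gt0 ?good_pos // lt_min !subr_gt0 pi.
  have := @cvg_expr R eps; rewrite ger0_norm ?(ltW eps0) // => /(_ eps_lt1).
  move=> /cvgrPdist_lt /(_ _ m0) [k _ /(_ k (leqnn k))].
  rewrite /= sub0r normrN ger0_norm ?exprn_ge0 ?(ltW eps0) // => h; exists k.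
  by rewrite -ltr_pdivlMr // good_pos.
have [_ nk] := badJ k; apply: nk; exists 0%N, i.+1.
exists (p i, q i); first by apply/mem_pairs; exists i.
have /andP[y1 y2] := Hy k; have := len k; move: Hk; rewrite lt_min => /andP[a b] e /=.
by apply/andP; split; lra.
Qed.

Lemma tree_content J (p q : nat -> R) : good J -> (forall i, p i < q i) ->
  (forall y, branch J y -> exists i, p i < y < q i) ->
  exists N, c / 2 * J.2 `^ s <= \sum_(i < N) (q i - p i) `^ s.
Proof.
move=> gJ pq cov; have [n [N H]] := branch_cover gJ cov; exists N.
have LI I : I \in [seq (p i, q i) | i <- iota 0 N] -> I.1 < I.2.
  by move=> /mem_pairs[i _ ->]; exact: pq.
apply: le_trans (covered_content gJ LI H) _.
by rewrite big_map -(big_mkord xpredT (fun i => (q i - p i) `^ s)) /index_iota subn0.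
Qed.

End TreeContent.

(** * Branches along which F stays away from the circle *)

Section HalfPlaneContent.
Variable R : realType.
Local Notation arc := (R * R)%type.
Variables (F : Cx R -> Cx R) (c eps q0 gam q1 s : R).
Hypothesis F1 : forall z, 0 < complex.Re z -> cabs (F z) < 1.
Hypotheses (c01 : 0 < c <= 1) (eps0 : 0 < eps) (s01 : 0 < s < 1).
Hypothesis epsc : eps `^ (1 - s) <= c / 4.
Hypotheses (q0_gt0 : 0 < q0) (gam1 : 1 < gam).
Hypothesis steps : forall J : arc, 0 < J.2 -> exists T, step_ok F c eps q0 gam q1 J T.

(** The clause of [step_ok] about rays requires the defect at the apex to be at least q0. Following
    one child per step multiplies the defect by gam until q0 is reached, which provides the root of
    the tree. *)
Lemma deep_arc (J0 : arc) : 0 < J0.2 ->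
  exists J : arc, [/\ 0 < J.2, J0.1 <= J.1, J.1 + J.2 <= J0.1 + J0.2 &
                      q0 <= defect F (apex J)].
Proof.
have /andP[c0 c1] := c01 => l0.
have next (J : arc) : 0 < J.2 -> exists K : arc,
    [/\ 0 < K.2, J.1 <= K.1, K.1 + K.2 <= J.1 + J.2 &
        Num.min q0 (gam * defect F (apex J)) <= defect F (apex K)].
  move=> j0; have [T [_ mT cT mq _]] := steps j0.
  have [K KT] : exists K, K \in T.
    case: T mT {cT mq} => [|K T _]; last by exists K; rewrite mem_head.
    by rewrite big_nil => h; have := mulr_gt0 c0 j0; rewrite ltNge h.
  have [k0 _ k1 k2] := cT K KT.
  by exists K; split=> //; exact: mq.
have c_gt0 : 0 < defect F (apex J0).
  by rewrite /defect subr_gt0 expr_lt1 ?cabs_ge0 // F1.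
have iterate k : exists J : arc, [/\ 0 < J.2, J0.1 <= J.1, J.1 + J.2 <= J0.1 + J0.2 &
    Num.min q0 (gam ^+ k * defect F (apex J0)) <= defect F (apex J)].
  elim: k => [|k [J [j0 j1 j2 hJ]]].
    by exists J0; split=> //; rewrite expr0 mul1r ge_min lexx orbT.
  have [K [k0 k1 k2 hK]] := next J j0; exists K; split=> //.
  - exact: le_trans j1 k1.
  - exact: le_trans k2 j2.
  apply: le_trans hK; rewrite le_min ge_min lexx /= ge_min.
  move: hJ; rewrite ge_min => /orP[h|h].
    have cJ : 0 <= defect F (apex J) by exact: le_trans (ltW q0_gt0) h.
    by rewrite (le_trans h) // ler_peMl // ltW.
  by apply/orP; right; rewrite exprS -mulrA ler_pM2l // (lt_trans ltr01).
have [k Hk] : exists k, q0 <= gam ^+ k * defect F (apex J0).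
  have := @cvg_expr R gam^-1; rewrite ger0_norm ?invr_ge0 ?(le_trans ler01 (ltW gam1)) //.
  rewrite invf_lt1 ?(lt_trans ltr01) // => /(_ gam1) /cvgrPdist_lt.
  move=> /(_ (defect F (apex J0) / q0)) []; first by rewrite divr_gt0.
  move=> k _ /(_ k (leqnn k)); have g0 : 0 < gam by exact: lt_trans gam1.
  rewrite /= sub0r normrN ger0_norm ?exprn_ge0 ?invr_ge0 ?(ltW g0) // exprVn => h.
  exists k; move: h; rewrite ltr_pdivlMr // mulrC ltr_pdivrMr ?exprn_gt0 // => h.
  by rewrite mulrC ltW.
have [J [j0 j1 j2 hJ]] := iterate k; exists J; split=> //.
by move: hJ; rewrite (min_idPl Hk).
Qed.

(** Every height in ]0, J.2] lies between the lengths of two consecutive arcs of a branch, where the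
    clause about rays gives the defect q1. Hence a cover of all y with such rays covers every
    branch, and [tree_content] applies. *)
Lemma content_of_shallow_rays (J0 : arc) : 0 < J0.2 ->
  exists J : arc, [/\ 0 < J.2, J0.1 <= J.1, J.1 + J.2 <= J0.1 + J0.2 &
    forall p q : nat -> R, (forall i, p i < q i) ->
      (forall y, J.1 <= y <= J.1 + J.2 ->
         (forall x, 0 < x <= J.2 -> q1 <= defect F (x +i* y)) ->
         exists i, p i < y < q i) ->
      exists N, c / 2 * J.2 `^ s <= \sum_(i < N) (q i - p i) `^ s].
Proof.
have /andP[c0 c1] := c01; have /andP[s0 s1] := s01.
move=> /deep_arc[J [j0 j1 j2 jq]]; exists J; split=> // p q pq cov.
pose good (K : arc) := 0 < K.2 /\ q0 <= defect F (apex K).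
have /choice[T HT] : forall K : arc, exists T, good K -> step_ok F c eps q0 gam q1 K T.
  move=> K; have [k0|k0] := pselect (0 < K.2); last by exists [::] => -[].
  by have [T hT] := steps k0; exists T.
have child (K K' : arc) : good K -> K' \in T K ->
    [/\ good K', K'.2 <= eps * K.2, K.1 <= K'.1 & K'.1 + K'.2 <= K.1 + K.2].
  move=> gK KT; have [k0 kq] := gK; have [_ _ cT mq _] := HT K gK.
  have [h0 h1 h2 h3] := cT K' KT; split=> //; split=> //.
  have cK : 0 <= defect F (apex K) by exact: le_trans (ltW q0_gt0) kq.
  by apply: le_trans (mq K' KT); rewrite le_min lexx (le_trans kq) // ler_peMl // ltW.
have tc := @tree_content R good T c eps s c0 c1 eps0 s0 s1 epsc.
apply: (tc _ _ _ _ J p q) => //.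
- by move=> K [].
- by move=> K /HT[].
- by move=> K /HT[].
move=> y [Js [Js0 Js1 Jsy]]; apply: cov; first by rewrite -Js0; exact: Jsy.
move=> x /andP[x0 xJ].
have gJs k : good (Js k).
  by elim: k => [|k IH]; [rewrite Js0|have [] := child _ _ IH (Js1 k)].
have eps1 : eps < 1 by exact: (@eps_lt1 R c eps s).
have len k : (Js k).2 <= eps ^+ k * J.2.
  elim: k => [|k IH]; first by rewrite expr0 mul1r Js0.
  have [_ h _ _] := child _ _ (gJs k) (Js1 k).
  by apply: le_trans h _; rewrite exprS -mulrA ler_pM2l.
have [k0 Hk0] : exists k, (Js k).2 <= x.
  have := @cvg_expr R eps; rewrite ger0_norm ?(ltW eps0) // => /(_ eps1).
  move=> /cvgrPdist_lt /(_ (x / J.2)) []; first by rewrite divr_gt0.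
  move=> k _ /(_ k (leqnn k)).
  rewrite /= sub0r normrN ger0_norm ?exprn_ge0 ?(ltW eps0) // => h; exists k.
  by apply: le_trans (len k) _; rewrite -ler_pdivlMr // ltW.
have [k [h1 h2]] : exists k, (Js k.+1).2 <= x /\ x <= (Js k).2.
  elim: k0 Hk0 => [|k IH] hk.
    exists 0%N; rewrite Js0; split=> //; have [_ h _ _] := child _ _ (gJs 0%N) (Js1 0%N).
    apply: le_trans h _; apply: le_trans hk.
    by rewrite ler_piMl ?(ltW eps1) //; have [/ltW] := gJs 0%N.
  by have [h|h] := leP (Js k).2 x; [exact: IH|exists k; rewrite (ltW h)].
have [_ _ _ _ st] := HT _ (gJs k); have [_ gq] := gJs k.
by apply: (st gq _ x y (Js1 k)); rewrite ?h1 ?h2 //; exact: Jsy.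
Qed.

End HalfPlaneContent.

(** * The chart exp (- z) *)

Section ExponentialChart.
Variable R : realType.
Implicit Types (x y : R) (f : Cx R -> Cx R).

Lemma derivable_cdiff f (z : Cx R) : derivable f z 1 -> cdiff f z (derive1 f z).
Proof.
move=> Df; have E := derive1E f z; rewrite E => e e0.
have e0' : (0 : R[i]) < e%:C by rewrite ltcR.
have := Df; rewrite /derivable => /cvgrPdist_le /(_ _ e0').
rewrite near_withinE => /nbhs_ballP[d /= d0 B].
have dE : d = (complex.Re d)%:C.
  by case: d d0 {B} => a b; rewrite ltcE /= => /andP[/eqP -> _].
have dR : 0 < complex.Re d by move: d0; rewrite dE ltcR.
exists (complex.Re d) => // h hd.
have [->|h0] := eqVneq h 0.
  by rewrite addr0 subrr mulr0 subr0 cabs0 mulr0.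
have := B h; rewrite /ball /= sub0r normrN normE dE ltcR => /(_ hd h0).
rewrite /= normE lecR /shift /= => H.
set G := (X in cabs X <= _).
have -> : G = - (h * ('D_1 f z - h^-1 *: (f (h *: 1 + z) - f z))).
  rewrite /G /GRing.scale /= mulr1 (addrC z) mulrBr mulrA mulfV // mul1r opprB.
  by rewrite mulrC.
by rewrite cabsN cabsM mulrC ler_wpM2r ?cabs_ge0.
Qed.

(** The function exp (- z). The horizontal ray with imaginary part y goes to the radius of angle -
    y, and x -> 0 is the approach to the circle. *)
Definition expN (z : Cx R) : Cx R := (expR (- complex.Re z))%:C * expi (- complex.Im z).

Lemma expi_abs x : cabs (expi x) = 1.
Proof. by rewrite /cabs /expi /= cos2Dsin2 sqrtr1. Qed.

Lemma expiD x y : expi (x + y) = expi x * expi y.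
Proof. by rewrite /expi sinD cosD; simpc; congr (_ +i* _); rewrite addrC. Qed.

Lemma expN_abs z : cabs (expN z) = expR (- complex.Re z).
Proof. by rewrite /expN cabsM cabsr expi_abs mulr1 ger0_norm ?expR_ge0. Qed.

Lemma expND z w : expN (z + w) = expN z * expN w.
Proof.
rewrite /expN ReD ImD !opprD expRD expiD rmorphM /=; ring.
Qed.

Lemma cdiff_expN z : cdiff expN z (- expN z).
Proof.
suff H0 : forall e : R, 0 < e -> exists2 del : R, 0 < del &
    forall h : Cx R, cabs h < del -> cabs (expN h - 1 + h) <= e * cabs h.
  move=> e e0; have k0 : 0 < cabs (expN z) by rewrite expN_abs expR_gt0.
  have [del del0 H] := H0 (e / cabs (expN z)) (divr_gt0 e0 k0).
  exists del => // h hd.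
  have -> : expN (z + h) - expN z - - expN z * h = expN z * (expN h - 1 + h).
    by rewrite expND; ring.
  rewrite cabsM mulrC -ler_pdivlMr // mulrAC; exact: H.
move=> e e0.
have [k [k0 ke k1]] : exists k : R, [/\ 0 < k, k <= e / 8 & k <= 1 / 2].
  exists (Num.min (e / 8) (1 / 2)).
  by rewrite lt_min !divr_gt0 // !ge_min !lexx orbT.
have /is_derive_epsP/(_ _ k0)[d1 d10 H1] := is_derive_expR (0 : R).
have /is_derive_epsP/(_ _ k0)[d2 d20 H2] := is_derive_sin (0 : R).
have /is_derive_epsP/(_ _ k0)[d3 d30 H3] := is_derive_cos (0 : R).
exists (Num.min k (Num.min d1 (Num.min d2 d3))); first by rewrite !lt_min k0 d10 d20 d30.
move=> h; rewrite !lt_min => /and4P[hk h1 h2 h3].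
have aL := normRe_le_cabs h; have bL := Im_le_cabs h.
apply: le_trans (cabs_le_ReIm _) _.
have -> : complex.Re (expN h - 1 + h) = expR (- complex.Re h) * cos (complex.Im h) - 1 + complex.Re h.
  by case: h {h1 h2 h3 hk aL bL} => a b; rewrite /expN /expi /= cosN sinN; ring.
have -> : complex.Im (expN h - 1 + h) = complex.Im h - expR (- complex.Re h) * sin (complex.Im h).
  by case: h {h1 h2 h3 hk aL bL} => a b; rewrite /expN /expi /= cosN sinN; ring.
move: aL bL hk h1 h2 h3; set a := complex.Re h; set b := complex.Im h; set m := cabs h.
move=> aL bL hk h1 h2 h3.
have := H1 (- a); rewrite normrN !add0r expR0 => /(_ (le_lt_trans aL h1)) {}H1.
have := H2 b; rewrite !add0r sin0 cos0 => /(_ (le_lt_trans bL h2)) {}H2.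
have := H3 b; rewrite !add0r sin0 cos0 => /(_ (le_lt_trans bL h3)) {}H3.
have [E0 Eu] : 0 <= expR (- a) /\ expR (- a) - 1 + a = expR (- a) - 1 - 1 * - a.
  by split; [exact: expR_ge0|ring].
rewrite -Eu in H1.
have m0 : 0 <= m by exact: cabs_ge0.
have kam : k * `|a| <= k * m by rewrite ler_pM2l.
have kbm : k * `|b| <= k * m by rewrite ler_pM2l.
have kmm : k * m <= e / 8 * m by rewrite ler_wpM2r.
have kms : k * m <= 1 / 4 by nra.
have E1 : `|expR (- a) - 1| <= 2 * m.
  have -> : expR (- a) - 1 = (expR (- a) - 1 + a) - a by ring.
  by apply: le_trans (ler_normB _ _) _; nra.
have E2 : expR (- a) <= 2.
  by move: E1; rewrite ler_norml => /andP[_]; lra.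
have C1 : `|expR (- a) * (cos b - 1)| <= 2 * (k * m).
  rewrite normrM (ger0_norm E0); apply: ler_pM => //.
  apply: le_trans kbm; apply: le_trans H3.
  by rewrite oppr0 mul0r subr0.
have C2 : `|expR (- a) * (sin b - b)| <= 2 * (k * m).
  rewrite normrM (ger0_norm E0); apply: ler_pM => //.
  apply: le_trans kbm; apply: le_trans H2.
  by rewrite subr0 mul1r.
have C3 : `|(expR (- a) - 1) * b| <= 2 * (k * m).
  rewrite normrM; apply: le_trans (ler_pM _ _ E1 bL) _; rewrite ?normr_ge0 //.
  by rewrite -mulrA ler_pM2l // ler_wpM2r // ltW.
have -> : expR (- a) * cos b - 1 + a = expR (- a) * (cos b - 1) + (expR (- a) - 1 + a) by ring.
have -> : b - expR (- a) * sin b = - (expR (- a) * (sin b - b)) - (expR (- a) - 1) * b by ring.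
have N1 := ler_normD (expR (- a) * (cos b - 1)) (expR (- a) - 1 + a).
have N2 := ler_normB (- (expR (- a) * (sin b - b))) ((expR (- a) - 1) * b).
rewrite normrN in N2.
have em0 : 0 <= e * m by rewrite mulr_ge0 // ltW.
by lra.
Qed.

End ExponentialChart.

(** * Transfer of the hypotheses from the disc to the half-plane *)

Section DiscToHalfPlane.
Variable R : realType.
Implicit Types (x y : R) (f : Cx R -> Cx R).

Lemma expN_disc x y : 0 < x -> cabs (expN (x +i* y)) < 1.
Proof. by move=> x0; rewrite expN_abs /= expR_lt1 oppr_lt0. Qed.

(** This is x <= sinh x, a consequence of cosh >= 1. It says that the chart does not expand
    hyperbolic length. *)
Lemma expN_Poincare x : 0 <= x -> 2 * x * expR (- x) <= 1 - expR (- x) ^+ 2.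
Proof.
move=> x0.
have H : 2 * x - 2 * 0 <= (expR x - expR (- x)) - (expR 0 - expR (- 0)).
  apply: (@increment_le R (fun t => 2 * t) (fun=> 2) (fun t => expR t - expR (- t))
    (fun t => expR t + expR (- t)) 0 x x0) => t _.
  - exact: is_derive_linear.
  - have D1 : is_derive t 1 (fun t => expR (- t)) (- expR (- t)).
      have D : is_derive t 1 (expR \o -%R) (expR (- t) * -1) by apply: is_derive1_comp.
      by apply: is_derive_eq D _; rewrite mulrN1.
    have D : is_derive t 1 (expR - (fun t => expR (- t))) (expR t - (- expR (- t))).
      exact: is_deriveB.
    by apply: is_derive_eq D _; rewrite opprK.
  - have e0 := expR_gt0 t; have e1 := expR_gt0 (- t).
    have E : expR t * expR (- t) = 1 by rewrite -expRD subrr expR0.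
    have : 0 <= (expR t - expR (- t)) ^+ 2 by exact: sqr_ge0.
    nra.
move: H; rewrite oppr0 subrr subr0 mulr0 subr0 => H.
apply: le_trans (ler_wpM2r (expR_ge0 (- x)) H) _.
have E : expR x * expR (- x) = 1 by rewrite -expRD subrr expR0.
by rewrite mulrBl E expr2.
Qed.

Lemma hyp_contr_expN f (D D' : R) : holomorphic_on_disc f ->
  (forall z : Cx R, cabs z < 1 -> cabs (f z) < 1) -> D' < D ->
  (forall z : Cx R, cabs z < 1 -> Dh f z <= D') ->
  hyp_contr D (fun z => f (expN z)) (fun z => derive1 f (expN z) * - expN z).
Proof.
move=> hf f1 DD HD; have disc (z : Cx R) : 0 < complex.Re z -> cabs (expN z) < 1.
  by case: z => x y /= x0; exact: expN_disc.
split=> z z0.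
- apply: cdiff_comp; first exact: cdiff_expN.
  by apply: derivable_cdiff; apply: hf; exact: disc.
- by apply: f1; exact: disc.
have z1 := disc z z0; have fz := f1 _ z1; have := HD _ z1; rewrite /Dh.
set w := expN z; set d := cabs (derive1 f w); have d0 : 0 <= d by exact: cabs_ge0.
have q0 : 0 < 1 - cabs (f w) ^+ 2 by rewrite subr_gt0 expr_lt1 ?cabs_ge0.
rewrite ler_pdivrMr // => H.
have P := expN_Poincare (ltW z0).
have wE : cabs w = expR (- complex.Re z) by rewrite expN_abs.
rewrite -wE in P.
rewrite cabsM cabsN ler_pdivlMr ?mulr_gt0 // -/d -/w.
have H' : D' * (1 - cabs (f w) ^+ 2) <= D * (1 - cabs (f w) ^+ 2) by rewrite ler_pM2r // ltW.
apply: le_trans (le_trans H H').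
have -> : d * cabs w * (2 * complex.Re z) = (2 * complex.Re z * cabs w) * d by ring.
exact: ler_wpM2r.
Qed.

(** The angle is - y, so the exceptional null set is the reflection of the given one. *)
Lemma radial_inner_expN f : inner f -> radial_inner (fun z => f (expN z)).
Proof.
case=> _ _ [A [mA A0 sA]].
exists (-%R @^-1` A); split.
- by rewrite -[X in measurable X]setTI; exact: measurable_realfun.oppr_measurable.
- by have := lebesgue_measureN mA; rewrite /pushforward A0.
move=> y /= ny; apply: sA => -[L [L1 H]]; apply: ny => e e0.
have e0' : (0 : R[i]) < e%:C by rewrite ltcR.
have := H => /cvgrPdist_lt /(_ _ e0').
rewrite near_withinE => /nbhs_ballP[eta /= eta0 B].
exists eta => // x /andP[x0 xe].
have ex : 1 - x <= expR (- x) by rewrite expR_ge1Dx.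
have ex1 : expR (- x) < 1 by rewrite expR_lt1 oppr_lt0.
have := B (expR (- x)); rewrite /ball /= => /(_ _ ex1).
rewrite normE ltcR => /(_ _) h.
have {}h : cabs (L - f (expN (x +i* y))) < e.
  by apply: h; rewrite gtr0_norm ?subr_gt0 //; lra.
have := cabs_leB L (f (expN (x +i* y))); rewrite L1; lra.
Qed.

End DiscToHalfPlane.

(** * From covers on the circle to covers of the angles *)

Section DimensionTransfer.
Variable R : realType.
Local Notation arc := (R * R)%type.
Implicit Types (x y : R).

Lemma sin_ge_half (u : R) : 0 <= u <= 1 / 2 -> u / 2 <= sin u.
Proof.
case/andP=> u0 u1.
have cosB (t : R) : 0 <= t <= 1 / 2 -> 1 / 2 <= cos t.
  case/andP=> t0 t1.
  have H : cos 0 - cos t <= 1 * t - 1 * 0.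
    have := @increment_le R (fun t => - cos t) sin (fun t => 1 * t) (fun=> 1) 0 t t0.
    move=> H; have {H} : - cos t - - cos 0 <= 1 * t - 1 * 0.
      apply: H => r _; [|exact: is_derive_linear|exact: sin_le1].
      have D : is_derive r 1 (- cos) (- - sin r) by exact: is_deriveN.
      by apply: is_derive_eq D _; rewrite opprK.
    by rewrite opprK addrC.
  by move: H; rewrite cos0; lra.
have := @increment_le R (fun t => 1 / 2 * t) (fun=> 1 / 2) sin cos 0 u u0.
rewrite sin0 => H; suff : 1 / 2 * u - 1 / 2 * 0 <= sin u - 0 by lra.
apply: H => t; first by move=> _; exact: is_derive_linear.
by case/andP=> t0 tu; apply: cosB; rewrite t0 (le_trans tu).
Qed.

Lemma expi_chord x y : `|x - y| <= 1 / 2 -> `|x - y| / 2 <= cabs (expi x - expi y).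
Proof.
move=> h; have -> : expi x - expi y = expi y * (expi (x - y) - 1).
  by rewrite mulrBr mulr1 -expiD (addrC y) subrK.
rewrite cabsM expi_abs mul1r; apply: le_trans (Im_le_cabs _).
have -> : complex.Im (expi (x - y) - 1) = sin (x - y) by rewrite ImD ImN /= subr0.
have -> : `|sin (x - y)| = `|sin `|x - y| |.
  by case: (ger0P (x - y)) => _ //; rewrite sinN normrN.
by apply: le_trans (ler_norm _); apply: sin_ge_half; rewrite normr_ge0.
Qed.

Lemma geometric_sum_le (k : R) N : 0 <= k -> \sum_(i < N) k * 2^-1 ^+ i <= 2 * k.
Proof.
move=> k0; have -> : \sum_(i < N) k * 2^-1 ^+ i = 2 * k - 2 * k * 2^-1 ^+ N.
  elim: N => [|N IH]; first by rewrite big_ord0 expr0 mulr1 subrr.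
  rewrite big_ord_recr /= IH exprS.
  by lra.
by rewrite gerBl !mulr_ge0 // exprn_ge0 // invr_ge0.
Qed.

(* A cover of E by sets of small diameter yields a cover of the angles by
   intervals of comparable length; the floor rho i > 0 on the radii takes care
   of the sets of diameter 0. *)
Lemma hdim_gt (E : set (Cx R)) (d s kap : R) (J : arc) :
  d < s -> 0 < s < 1 -> J.2 <= 1 / 2 -> 0 < kap ->
  (forall p q : nat -> R, (forall i, p i < q i) ->
     (forall y, J.1 <= y <= J.1 + J.2 -> E (expi (- y)) -> exists i, p i < y < q i) ->
     exists N, kap <= \sum_(i < N) (q i - p i) `^ s) ->
  (d%:E < hdim E)%E.
Proof.
move=> ds /andP[s0 s1] J2 kap0 H; rewrite ltNge; apply/negP => hd.
have : (hdim E < s%:E)%E by apply: le_lt_trans hd _; rewrite lte_fin.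
move=> /ereal_inf_lt[_ [t [t0 tE] <-]]; rewrite lte_fin => ts.
(* The budget: the i-th interval will cost at most 8 h i + 2 a i, and 8 (kap / 32) + 4 (kap / 8) = 3
   kap / 4 < kap. *)
have : (hcontent t (1 / 8) E < (kap / 32)%:E)%E.
  apply: le_lt_trans (_ : 0%E < _)%E; last by rewrite lte_fin divr_gt0.
  by rewrite -tE; apply: ereal_sup_ubound; exists (1 / 8) => //=.
move=> /ereal_inf_lt[_ [U [EU dU] <-]] sumU.
pose h i : R := fine (hterm t (U i)).
have hE i : hterm t (U i) = (h i)%:E by rewrite /h /hterm; case: pselect.
have h0 i : 0 <= h i by rewrite /h /hterm; case: pselect => //= _; exact: powR_ge0.
have sumh N : \sum_(i < N) h i <= kap / 32.
  rewrite -lee_fin; apply: le_trans (ltW sumU).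
  rewrite -sumEFin -(big_mkord xpredT (fun i => (h i)%:E)).
  under eq_bigr do rewrite -hE.
  by apply: nneseries_lim_ge => i _ _; rewrite hE lee_fin.
pose dm i : R := if pselect (U i !=set0) then fine (diam (U i)) else 0.
have dmP i (z w : Cx R) : U i z -> U i w -> cabs (z - w) <= dm i.
  move=> Uz Uw; rewrite /dm; case: pselect => [ne|]; last by case; exists z.
  have zw : ((cabs (z - w))%:E <= diam (U i))%E.
    by apply: ereal_sup_ubound; exists z => //; exists w.
  rewrite -lee_fin fineK //; rewrite fin_numElt (lt_le_trans (ltNyr _) zw) /=.
  exact: le_lt_trans (dU i) (ltry _).
have dm0 i : 0 <= dm i.
  have [[z Uz]|ne] := pselect (U i !=set0); last by rewrite /dm; case: pselect.
  by rewrite (le_trans (cabs_ge0 (z - z))) // dmP.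
have dm1 i : dm i <= 1.
  rewrite /dm; case: pselect => // -[z Uz].
  have zz : (0%:E <= diam (U i))%E.
    apply: le_trans (_ : (cabs (z - z))%:E <= _)%E; first by rewrite lee_fin cabs_ge0.
    by apply: ereal_sup_ubound; exists z => //; exists z.
  rewrite -lee_fin fineK.
    by apply: le_trans (dU i) _; rewrite lee_fin; lra.
  rewrite fin_numElt (lt_le_trans (ltNyr _) zz) /=.
  exact: le_lt_trans (dU i) (ltry _).
have dmh i : dm i `^ s <= h i.
  have [d0|d0] := eqVneq (dm i) 0; first by rewrite d0 powR0 ?gt_eqF.
  have dp : 0 < dm i by rewrite lt_neqAle eq_sym d0 dm0.
  have -> : h i = dm i `^ t.
    by move: d0; rewrite /h /hterm /dm; case: pselect => //=; rewrite eqxx.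
  by apply: ger_powR; rewrite ?dp ?dm1 // ltW.
pose a i := kap / 8 * 2^-1 ^+ i.
have a0 i : 0 < a i by rewrite mulr_gt0 ?divr_gt0 ?exprn_gt0 ?invr_gt0.
pose rho i := a i `^ s^-1.
have rho0 i : 0 < rho i by exact: powR_gt0.
have rhos i : rho i `^ s = a i.
  by rewrite /rho -powRrM mulVf ?gt_eqF // powRr1 // ltW.
(* The centre c i is an angle of J whose point lies in U i, or 0 when U i meets no point of the
   arc. *)
have /choice[c Hc] : forall i, exists y, (exists2 y', J.1 <= y' <= J.1 + J.2 & U i (expi (- y'))) ->
    J.1 <= y <= J.1 + J.2 /\ U i (expi (- y)).
  move=> i; have [[y hy Uy]|n] := pselect (exists2 y', J.1 <= y' <= J.1 + J.2 & U i (expi (- y'))).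
    by exists y.
  by exists 0.
(* A chord is at least half the angle, so the angles caught by U i are within 2 dm i of c i; the
   factor 4 makes the inequality strict. *)
pose r i := Num.max (4 * dm i) (rho i).
have r0 i : 0 < r i by rewrite lt_max rho0 orbT.
have [||N HN] := H (fun i => c i - r i) (fun i => c i + r i).
- by move=> i; have := r0 i; lra.
- move=> y hy Ey; have [i _ Ui] := EU _ Ey; exists i.
  have [hc Uc] : J.1 <= c i <= J.1 + J.2 /\ U i (expi (- c i)) by apply: Hc; exists y.
  have yc : `|y - c i| <= 1 / 2.
    by rewrite ler_norml; case/andP: hy => ? ?; case/andP: hc => ? ?; apply/andP; split; lra.
  have := @expi_chord (- c i) (- y); rewrite opprK addrC => /(_ yc).
  move=> /le_trans/(_ (dmP i _ _ Uc Ui)) ycd.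
  have : `|y - c i| < r i.
    rewrite /r lt_max; have [d0|d0] := eqVneq (dm i) 0.
      by rewrite (le_lt_trans _ (rho0 i)) ?orbT //; lra.
    have dp : 0 < dm i by rewrite lt_neqAle eq_sym d0 dm0.
    by apply/orP; left; lra.
  by rewrite ltr_norml => /andP[h1 h2]; apply/andP; split; lra.
have term i : (c i + r i - (c i - r i)) `^ s <= 8 * h i + 2 * a i.
  have -> : c i + r i - (c i - r i) = 2 * r i by ring.
  have two_s (k : R) : 1 <= k -> k `^ s <= k.
    by move=> k1; rewrite -[leRHS]powRr1 ?(le_trans ler01) //; apply: ler_powR => //; exact: ltW.
  rewrite /r /Num.max; case: ifP => _.
    rewrite powRM ?(ltW (rho0 i)) // rhos.
    have := two_s 2; rewrite ler1n => /(_ isT) k2.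
    have := ler_wpM2r (ltW (a0 i)) k2; have := h0 i; lra.
  have -> : 2 * (4 * dm i) = 8 * dm i by ring.
  rewrite powRM //.
  have := two_s 8; rewrite ler1n => /(_ isT) k8.
  have := ler_pM (powR_ge0 8 s) (powR_ge0 (dm i) s) k8 (dmh i); have := a0 i; lra.
have : kap <= \sum_(i < N) (8 * h i + 2 * a i).
  by apply: le_trans HN _; apply: ler_sum => i _; exact: term.
have sa : \sum_(i < N) a i <= 2 * (kap / 8).
  by apply: geometric_sum_le; rewrite divr_ge0 // ltW.
have -> : \sum_(i < N) (8 * h i + 2 * a i) = 8 * \sum_(i < N) h i + 2 * \sum_(i < N) a i.
  by rewrite big_split /= !mulr_sumr.
by have := sumh N; lra.
Qed.

End DimensionTransfer.

(** * The dimension bound and the two choices of t *)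

Section Dimension.
Variable R : realType.

(** The strict inequality 1 - q1 < t^2 turns |F|^2 <= 1 - q1 along a ray into an upper limit
    strictly below t. *)
Definition step_data (D t : R) : Prop := exists c eps q0 gam q1 : R,
  [/\ 0 < c <= 1, 0 < eps & eps `^ (3 * D / 4) <= c / 4] /\
  [/\ 0 < q0, 1 < gam & 1 - q1 < t ^+ 2] /\
  forall F dF, hyp_contr D F dF -> radial_inner F -> forall J, 0 < J.2 ->
    exists T, step_ok F c eps q0 gam q1 J T.

Lemma step_data_large (D : R) : 0 < D < 1 -> exists2 t, 0 < t < 1 & step_data D t.
Proof.
move=> D01; have [c [eps [q0 [gam [q1 [H1 [[H2 H3 /andP[q10 q11]] H4]]]]]]] := step_large D01.
exists (1 - q1 / 2); first by apply/andP; split; lra.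
by exists c, eps, q0, gam, q1; split=> //; split=> //; split=> //; nra.
Qed.

Lemma step_data_small (D del : R) : 0 < D -> 0 < del -> del <= 1 / 100 ->
  del ^+ 2 = 100 * (100 * (100 * D)) -> step_data D (21 * del).
Proof.
move=> D0 del0 del1 delD.
have D1 : D <= 1.
  have : del ^+ 2 <= 1 by rewrite expr_le1 ?(ltW del0) //; lra.
  by rewrite delD; lra.
have x0 : 0 <= 50 / D by rewrite divr_ge0 // ltW.
(* n0 is the integer part of 50 / D, so n0 D >= 49 and n0 (3 D / 4) >= 6; already 2^(-6) <= 1/40 = c
   / 4. *)
have /andP[] := truncn_itv x0; set n0 := Num.trunc _ => n1 n2.
have nD : n0%:R * D <= 50 by rewrite -ler_pdivlMr.
have nD' : 49 <= n0%:R * D.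
  by move: n2; rewrite ltr_pdivrMr // -[n0.+1%:R]natr1 mulrDl mul1r; lra.
exists (1 / 10), ((2^-1) ^+ n0), (1 - (18 * del) ^+ 2), (1 + del ^+ 2), (1 - (20 * del) ^+ 2).
split; [split|split; [split|]].
- by apply/andP; split; lra.
- by rewrite exprn_gt0 // invr_gt0.
- have h0 : (0 : R) < 2^-1 by rewrite invr_gt0.
  rewrite -powR_mulrn ?(ltW h0) // -powRrM.
  apply: le_trans (_ : 2^-1 `^ 6%:R <= _).
    by apply: ger_powR; [apply/andP; split; lra|lra].
  by rewrite powR_mulrn ?(ltW h0) //; rewrite !exprS expr0; lra.
- have : (18 * del) ^+ 2 < 1 by rewrite expr_lt1 ?mulr_ge0 ?(ltW del0) //; lra.
  by lra.
- by have := exprn_gt0 2 del0; lra.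
- by rewrite opprB addrC subrK ltr_pXn2r ?nnegrE ?mulr_ge0 ?(ltW del0) //; lra.
exact: step_small.
Qed.

Lemma limf_esup_left_le (g : R -> R) (u m : R) : u < 1 ->
  (forall r, u < r < 1 -> g r <= m) ->
  (limf_esup (fun r => (g r)%:E) (1 : R)^'- <= m%:E)%E.
Proof.
move=> u1 H; rewrite limf_esupE.
apply: (@le_trans _ _ (ereal_sup [set (g r)%:E | r in [set r | u < r < 1]])); last first.
  by apply: ub_ereal_sup => _ [r hr <-]; rewrite lee_fin H.
apply: ereal_inf_lbound; exists [set r | u < r < 1] => //.
near=> r; apply/andP; split; near: r; [exact: nbhs_left_gt|exact: nbhs_left_lt].
Unshelve. all: by end_near.
Qed.

Lemma step_data_dim (D t : R) (f : Cx R -> Cx R) : 0 < D < 1 -> 0 < t ->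
  step_data D t -> inner f ->
  (forall z : Cx R, cabs z < 1 -> cabs (f z) < 1) ->
  (exists D' : R, D' < D /\ forall z : Cx R, cabs z < 1 -> Dh f z <= D') ->
  forall a b : R, a < b ->
    ((1 - D)%:E <
     hdim [set xi : Cx R | circle_arc a b xi /\
             (limf_esup (fun r : R => (cabs (f (r%:C * xi)))%:E)
                (1:R)^'- < t%:E)%E])%E.
Proof.
move=> /andP[D0 D1] t0 [c [eps [q0 [gam [q1 [[c01 eps0 epsc] [[q00 gam1 q1t] steps]]]]]]].
move=> inf f1 [D' [DD HD]] a b ab.
have [hf _ _] := inf.
have contr := hyp_contr_expN hf f1 DD HD.
have rad := radial_inner_expN inf.
set F := (fun z => _) in contr rad.
have [_ F1 _] := contr.
pose s := 1 - 3 * D / 4.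
have s01 : 0 < s < 1 by rewrite /s; apply/andP; split; lra.
have epss : eps `^ (1 - s) <= c / 4 by rewrite /s opprB addrC subrK.
(* With 3 w <= b - a the interval [- b + w, - b + 2 w] lies strictly between - b and - a, hence its
   negatives lie in ]a, b[; w <= 1/2 is the range of the chord bound. *)
pose w := Num.min ((b - a) / 3) (1 / 2).
have w0 : 0 < w by rewrite lt_min; apply/andP; split; lra.
have wab : w <= (b - a) / 3 by rewrite ge_min lexx.
have w12 : w <= 1 / 2 by rewrite ge_min lexx orbT.
have [J [J0 J1 J2 HJ]] := content_of_shallow_rays F1 c01 eps0 s01 epss q00 gam1
  (steps _ _ contr rad) (J0 := (- b + w, w)) w0.
have /andP[c0 _] := c01.
apply: (@hdim_gt R _ (1 - D) s (c / 2 * J.2 `^ s) J) => //.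
- by rewrite /s; lra.
- by move: J1 J2 => /=; lra.
- by rewrite mulr_gt0 ?divr_gt0 // powR_gt0.
move=> p q pq cov; apply: HJ => // y hy Hy; apply: cov => //; split.
  exists (- y) => //; rewrite /= in_itv /=.
  by case/andP: hy => y1 y2; move: J1 J2 => /= J1 J2; apply/andP; split; lra.
apply: (@le_lt_trans _ _ (Num.sqrt (1 - q1))%:E); last first.
  by rewrite lte_fin -[ltRHS](ger0_norm (ltW t0)) -sqrtr_sqr ltr_sqrt // exprn_gt0.
apply: (@limf_esup_left_le _ (expR (- J.2))); first by rewrite expR_lt1 oppr_lt0.
move=> r /andP[r1 r2]; have r0 : 0 < r by exact: lt_trans (expR_gt0 _) r1.
have lr : 0 < - ln r <= J.2.
  rewrite oppr_gt0 ln_lt0 ?r0 //= lerNl -[leLHS]expRK ler_ln ?posrE ?expR_gt0 //.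
  exact: ltW.
have := Hy _ lr; rewrite /defect /F /expN /= opprK lnK ?posrE // => h.
rewrite -[leLHS](ger0_norm (cabs_ge0 _)) -sqrtr_sqr; apply: ler_wsqrtr.
by lra.
Qed.

End Dimension.

Theorem theorem5 (R : realType) :
  exists t : R -> R,
    (forall D : R, 0 < D < 1 -> 0 < t D < 1) /\
    (t D @[D --> (0:R)^'+] --> (0:R)) /\
    forall (f : Cx R -> Cx R) (D : R),
      inner f -> 0 < D < 1 ->
      (forall z : Cx R, cabs z < 1 -> cabs (f z) < 1) ->
      (exists D' : R, D' < D /\
         forall z : Cx R, cabs z < 1 -> Dh f z <= D') ->
      forall a b : R, a < b -> b - a <= 2 * pi ->
        ((1 - D)%:E <
         hdim [set xi : Cx R | circle_arc a b xi /\
                 (limf_esup (fun r : R => (cabs (f (r%:C * xi)))%:E)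
                    (1:R)^'- < (t D)%:E)%E])%E.
Proof.
pose del (D : R) := Num.sqrt (100 * (100 * (100 * D))).
have delE (D : R) : 0 < D -> del D ^+ 2 = 100 * (100 * (100 * D)).
  by move=> D0; rewrite sqr_sqrtr // !mulr_ge0 // ltW.
have del0 (D : R) : 0 < D -> 0 < del D by move=> D0; rewrite sqrtr_gt0 !mulr_gt0.
(* When del D <= 1/100 the explicit value of t is taken, and the last clause records it for the
   limit at 0. *)
have /choice[t Ht] : forall D : R, exists t : R, 0 < D < 1 ->
    [/\ 0 < t < 1, step_data D t & del D <= 1 / 100 -> t = 21 * del D].
  move=> D; have [D01|] := boolP (0 < D < 1); last by exists 0.
  have /andP[D0 D1] := D01.
  have [d1|d1] := leP (del D) (1 / 100).
    exists (21 * del D) => _; have dD := del0 D D0; split=> //.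
      by apply/andP; split; lra.
    exact: step_data_small (delE D D0).
  by have [t t01 tD] := step_data_large D01; exists t => _; split.
exists t; split; first by move=> D /Ht[].
split; last first.
  move=> f D inf D01 f1 HD a b ab _; have [/andP[t0 _] tD _] := Ht D D01.
  exact: step_data_dim.
apply/cvgrPdist_lt => e e0.
pose k := Num.min (1 / 100) (e / 21).
have k0 : 0 < k by rewrite lt_min; apply/andP; split; lra.
(* D < m amounts to del D < k, and k <= e / 21 then gives 21 del D < e. *)
pose m := k ^+ 2 / (100 * (100 * 100)).
have m0 : 0 < m by apply: divr_gt0; [exact: exprn_gt0|lra].
near=> D.
have D0 : 0 < D by near: D; exact: nbhs_right_gt.
have Dm : D < m by near: D; exact: nbhs_right_lt.
have D1 : D < 1 by near: D; exact: nbhs_right_lt.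
have dk : del D < k.
  rewrite -(ger0_norm (ltW k0)) -sqrtr_sqr ltr_sqrt ?exprn_gt0 //.
  by move: Dm; rewrite ltr_pdivlMr ?mulr_gt0 // => Dm; lra.
have [_ _ tE] := Ht D (introT andP (conj D0 D1)).
move: dk; rewrite lt_min => /andP[d1 d2].
rewrite tE ?(ltW d1) // sub0r normrN ger0_norm ?mulr_ge0 ?(ltW (del0 _ _)) //.
by move: d2; rewrite ltr_pdivlMr // mulrC.
Unshelve. all: by end_near.
Qed.
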